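(* Let $(G,H,\alpha,\tau)$ be a Lie crossed module corresponding to a categorical group $\mathbf K$, and $\overline A$ a connection form on a principal $G$-bundle $\pi:P\to M$. Let $\mathbb P^{\rm bt}(M)$ be the category whose objects are the points of $M$ and whose morphisms are the backtrack-erased piecewise $C^1$ paths on $M$. Let $\mathbb P^{\rm bt}(P)^{\rm dec}_{\overline A}$ be the category whose object set is $P$, whose morphisms are the pairs $(\tilde\gamma,h)$ with $\tilde\gamma$ a piecewise $C^1$ backtrack-erased $\overline A$-horizontal path on $P$ and $h\in H$, with $$s(\tilde\gamma,h)=s(\tilde\gamma),\qquad t(\tilde\gamma,h)=t(\tilde\gamma)\tau(h^{-1}),$$ and composition $$(\tilde\gamma_2,h_2)\circ(\tilde\gamma_1,h_1)=\bigl(\tilde\gamma_2\tau(h_1)\circ\tilde\gamma_1,\;h_2h_1\bigr).$$ Let $\pi:\mathbb P^{\rm bt}(P)^{\rm dec}_{\overline A}\to\mathbb P^{\rm bt}(M)$ be the functor that takes each object $p\in P$ to $\pi(p)\in M$ and each morphism $(\tilde\gamma,h)$ to the backtrack-erased path $\pi\circ\tilde\gamma$. Then $\pi:\mathbb P^{\rm bt}(P)^{\rm dec}_{\overline A}\to\mathbb P^{\rm bt}(M)$, along with the right action of $\mathbf K$ on $\mathbb P^{\rm bt}(P)^{\rm dec}_{\overline A}$ given on objects by the right action of $G$ on $P$ and on morphisms by $$(\tilde\gamma,h)\cdot(h_1,g_1)=\bigl(\tilde\gamma g_1,\;\alpha(g_1^{-1})(h_1^{-1}h)\bigr),$$ is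 a principal categorical bundle.
   Context: A crossed module $(G,H,\alpha,\tau)$ consists of groups $G,H$ and homomorphisms $\tau:H\to G$, $\alpha:G\to\mathrm{Aut}(H)$ with $\tau(\alpha(g)h)=g\tau(h)g^{-1}$ and $\alpha(\tau(h))(h')=hh'h^{-1}$ for all $g\in G$, $h,h'\in H$. It is a Lie crossed module if $G,H$ are Lie groups, $\tau$ is smooth, and $(g,h)\mapsto\alpha(g)h$ is smooth. A categorical group is a (small) category $\mathbf K$ with a bifunctor $\otimes:\mathbf K\times\mathbf K\to\mathbf K$ such that $\mathrm{Obj}(\mathbf K)$ and $\mathrm{Mor}(\mathbf K)$ are groups under $\otimes$. The categorical group corresponding to $(G,H,\alpha,\tau)$ has $\mathrm{Obj}(\mathbf K)=G$ and $\mathrm{Mor}(\mathbf K)=H\times G$ with $s(h,a)=a$, $t(h,a)=\tau(h)a$, composition $(h_2,b)\circ(h_1,a)=(h_2h_1,a)$ when $b=\tau(h_1)a$, and group law $(h,a)(k,c)=(h\,\alpha(a)(k),ac)$. Paths: a parametrized path $c_1$ is identified with $c_2$ if $c_2=c_1\circ\phi$ for a strictly increasing piecewise $C^1$ map $\phi$ of the domain of $c_2$ onto the domain of $c_1$. Piecewise $C^1$ paths $c_1,c_2$ are elementary backtrack equivalent if, after such reparametrizations, $\{c_1,c_2\}=\{add^{-1}b,\,ab\}$ for some piecewise $C^1$ paths $a,b,d$ (with $a$ or $b$ possibly a trivial one-point path), where juxtaposition is composition (concatenation) of paths and $d^{-1}$ is the reverse of $d$. Backtrack equivalence is the equivalence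 relation generated by this, and a backtrack-erased path is a backtrack equivalence class; composition is induced by concatenation ($\gamma_2\circ\gamma_1$ is $\gamma_1$ followed by $\gamma_2$), identities are the classes of constant paths, and $s(\gamma),t(\gamma)$ are the initial and final points. A backtrack-erased $\overline A$-horizontal path on $P$ is the backtrack equivalence class of a piecewise $C^1$ path $\tilde\gamma$ in $P$ with $\overline A(\tilde\gamma'(t))=0$ wherever $\tilde\gamma'(t)$ exists; $\tilde\gamma g$ is its right translate by $g\in G$. A right action of $\mathbf K$ on a category $\mathbf P$ is a functor $\mathbf P\times\mathbf K\to\mathbf P$ that is a right action of $\mathrm{Obj}(\mathbf K)$ on $\mathrm{Obj}(\mathbf P)$ and of $\mathrm{Mor}(\mathbf K)$ on $\mathrm{Mor}(\mathbf P)$. A principal categorical bundle with structure categorical group $\mathbf K$ is a functor $\pi:\mathbf P\to\mathbf B$ along with a right action of $\mathbf K$ on $\mathbf P$ such that: (i) $\pi$ is surjective on objects and on morphisms; (ii) the action is free on both objects and morphisms; (iii) $\mathrm{Obj}(\mathbf K)$ acts transitively on the fiber $\pi^{-1}(b)$ for each $b\in\mathrm{Obj}(\mathbf B)$, and $\mathrm{Mor}(\mathbf K)$ acts transitively on the fiber $\pi^{-1}(\phi)$ for each $\phi\in\mathrm{Mor}(\mathbf B)$ (in particular the actions preserve the fibers). *)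

(* Defs.v *)
From HB Require Import structures.
From mathcomp Require Import all_boot all_order all_algebra.
From mathcomp Require Import all_classical all_reals all_analysis.
From Stdlib Require Import Relation_Operators.
Set Implicit Arguments.
Unset Strict Implicit.
Unset Printing Implicit Defensive.
Import Order.TTheory GRing.Theory Num.Theory.
Import numFieldNormedType.Exports.
Local Open Scope classical_set_scope.
Local Open Scope ring_scope.

(* C^k on an open subset U; all uses have E finite-dimensional, so that it
   suffices to iterate directional derivatives. *)
Fixpoint Ck (R : realType) (E F : normedModType R) (k : nat)
    (U : set E) (f : E -> F) : Prop :=
  match k with
  | 0 => {in U, continuous f}
  | k'.+1 => (forall x, U x -> differentiable f x) /\
             (forall v : E, Ck k' U ('D_v f))
  end.

(* The local inverse cinv is total; only its values on crng matter. *)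
Record chart (R : realType) (n : nat) (M : topologicalType) := Chart {
  cdom : set M;
  cmap : M -> 'rV[R]_n;
  cinv : 'rV[R]_n -> M;
  cdom_open : open cdom;
  crng_open : open (cmap @` cdom);
  cmapK : {in cdom, cancel cmap cinv};
  cmap_cont : {in cdom, continuous cmap};
  cinv_cont : {in cmap @` cdom, continuous cinv} }.

Definition crng (R : realType) (n : nat) (M : topologicalType)
  (phi : chart R n M) : set 'rV[R]_n := cmap phi @` cdom phi.

HB.mixin Record isManifold (R : realType) (M : Type) of Topological M := {
  mdim : nat;
  atlas : set (chart R mdim M);
  atlas_cover : forall x : M, exists2 phi, atlas phi & cdom phi x;
  atlas_compat : forall phi psi, atlas phi -> atlas psi -> forall k,
    Ck k (crng phi `&` cinv phi @^-1` cdom psi) (cmap psi \o cinv phi);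
  manifold_hausdorff : hausdorff_space M;
  manifold_second_countable : @second_countable M }.

#[short(type="manifoldType")]
HB.structure Definition Manifold (R : realType) :=
  {M of Topological M & isManifold R M}.

(* The charts at p; all smoothness below is tested in charts of the atlas. *)
Definition chart_at (R : realType) (M : manifoldType R) (p : M) :
  set (chart R (@mdim R M) M) := [set phi | atlas phi /\ cdom phi p].

Definition Ckm (R : realType) (E : normedModType R) (M : manifoldType R)
    (k : nat) (U : set E) (f : E -> M) : Prop :=
  {in U, continuous f} /\
  forall phi, (@atlas R M) phi ->
    Ck k (U `&` f @^-1` cdom phi) (cmap phi \o f).

Definition smooth_on (R : realType) (M N : manifoldType R)
    (U : set M) (f : M -> N) : Prop :=
  forall phi, (@atlas R M) phi -> forall k,
    Ckm k (crng phi `&` cinv phi @^-1` U) (f \o cinv phi).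

(* Smoothness on the open subset U * V of the product manifold M * N. *)
Definition smooth2_on (R : realType) (M N Q : manifoldType R)
    (U : set M) (V : set N) (f : M -> N -> Q) : Prop :=
  forall phi psi, (@atlas R M) phi -> (@atlas R N) psi -> forall k,
    Ckm k ((crng phi `&` cinv phi @^-1` U) `*` (crng psi `&` cinv psi @^-1` V))
      (fun x => f (cinv phi x.1) (cinv psi x.2)).

(* A tangent vector at p is the family of its coordinate vectors in the charts
   at p; the value 0 on other charts makes the representation unique. *)
Record tangent (R : realType) (M : manifoldType R) (p : M) := Tangent {
  tcoord :> chart R (@mdim R M) M -> 'rV[R]_(@mdim R M);
  tcoord_trans : forall phi psi, chart_at p phi -> chart_at p psi ->
    tcoord psi = 'D_(tcoord phi) (cmap psi \o cinv phi) (cmap phi p);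
  tcoord_out : forall phi, ~ chart_at p phi -> tcoord phi = 0 }.

(* w is the image of v under the differential of the smooth map f at p. *)
Definition is_push (R : realType) (M N : manifoldType R) (f : M -> N)
    (p : M) (q : N) (v : tangent p) (w : tangent q) : Prop :=
  f p = q /\ forall phi psi, chart_at p phi -> chart_at q psi ->
    w psi = 'D_(v phi) (cmap psi \o f \o cinv phi) (cmap phi p).

(* The (two-sided) derivative gamma'(t) exists and equals v. *)
Definition is_velocity (R : realType) (M : manifoldType R) (gamma : R -> M)
    (t : R) (v : tangent (gamma t)) : Prop :=
  forall phi, chart_at (gamma t) phi ->
    is_derive (t : R^o) 1 (cmap phi \o gamma : R^o -> _) (v phi).

HB.mixin Record isLieGroup (R : realType) (G : Type)
    of Manifold R G & Group G := {
  mulg_smooth : smooth2_on setT setT (fun x y : G => (x * y)%g);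
  invg_smooth : smooth_on setT (fun x : G => x^-1%g) }.

#[short(type="lieGroupType")]
HB.structure Definition LieGroup (R : realType) :=
  {G of Manifold R G & Group G & isLieGroup R G}.

Record crossed_module (G H : groupType) := CrossedModule {
  cm_tau : H -> G;
  cm_alpha : G -> H -> H;
  cm_tauM : forall h k, cm_tau (h * k)%g = (cm_tau h * cm_tau k)%g;
  cm_alpha_bij : forall g, bijective (cm_alpha g);
  cm_alpha_mor : forall g h k,
    cm_alpha g (h * k)%g = (cm_alpha g h * cm_alpha g k)%g;
  cm_alphaM : forall g g' h,
    cm_alpha (g * g')%g h = cm_alpha g (cm_alpha g' h);
  cm_tau_alpha : forall g h, cm_tau (cm_alpha g h) = (g * cm_tau h * g^-1)%g;
  cm_alpha_tau : forall h h', cm_alpha (cm_tau h) h' = (h * h' * h^-1)%g }.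

Record lie_crossed_module (R : realType) (G H : lieGroupType R) :=
  LieCrossedModule {
  lcm :> crossed_module G H;
  lcm_tau_smooth : smooth_on setT (cm_tau lcm);
  lcm_alpha_smooth : smooth2_on setT setT (cm_alpha lcm) }.

(* Over U, the diffeomorphism p |-> (bproj p, triv p) onto U * G has inverse
   tinv and intertwines the G-actions.  Surjectivity of bproj, freeness of the
   action and its transitivity on the fibers are consequences. *)
Record principal_bundle (R : realType) (G : lieGroupType R)
    (P M : manifoldType R) := PrincipalBundle {
  bproj : P -> M;
  bact : P -> G -> P;
  bproj_smooth : smooth_on setT bproj;
  bact_smooth : smooth2_on setT setT bact;
  bact1 : forall p, bact p 1%g = p;
  bactM : forall p g g', bact p (g * g')%g = bact (bact p g) g';
  bproj_act : forall p g, bproj (bact p g) = bproj p;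
  bundle_trivial : forall x : M, exists U : set M, [/\ open U, U x &
    exists (triv : P -> G) (tinv : M -> G -> P),
      [/\ smooth_on (bproj @^-1` U) triv,
          smooth2_on U setT tinv,
          (forall y g, U y -> bproj (tinv y g) = y /\ triv (tinv y g) = g),
          (forall p, U (bproj p) -> tinv (bproj p) (triv p) = p) &
          (forall p g, U (bproj p) -> triv (bact p g) = (triv p * g)%g)]] }.

(* Connection 1-form with values in the Lie algebra T_1 G. *)
Record connection (R : realType) (G : lieGroupType R) (P M : manifoldType R)
    (B : principal_bundle G P M) := Connection {
  cform : forall p : P, tangent p -> tangent (1%g : G);
  cform_linear : forall (p : P) (a : R) (u v w : tangent p),
    (forall phi, w phi = a *: u phi + v phi) ->
    forall psi, cform w psi = a *: cform u psi + cform v psi;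
  (* the coefficients in a chart phi are smooth: X is the coordinate vector
     field on cdom phi with constant coordinates c *)
  cform_smooth : forall phi psi (c : 'rV[R]_(@mdim R P))
      (X : forall p : P, tangent p),
    (@atlas R P) phi -> chart_at (1%g : G) psi ->
    (forall p, cdom phi p -> X p phi = c) ->
    forall k, Ck k (crng phi) (fun x => cform (X (cinv phi x)) psi);
  (* A(pX) = X for X in the Lie algebra *)
  cform_vertical : forall (p : P) (X : tangent (1%g : G)) (w : tangent p),
    is_push (bact B p) X w -> cform w = X;
  (* R_g^* A = Ad(g^-1) A *)
  cform_equivariant : forall (p : P) (g : G) (v : tangent p)
      (w : tangent (bact B p g)),
    is_push (bact B ^~ g) v w ->
    is_push (fun x : G => g^-1 * x * g)%g (cform v) (cform w) }.

(* A curve is given on [ca, cb]; values of cf elsewhere are irrelevant.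
   ca = cb gives a one-point path. *)
Record curve (R : realType) (T : Type) := Curve { ca : R; cb : R; cf : R -> T }.

Section Curves.
Variables (R : realType) (T : Type).
Implicit Types c d : curve R T.

Definition cstart c : T := cf c (ca c).
Definition cend c : T := cf c (cb c).

(* c followed by d *)
Definition ccat c d : curve R T :=
  Curve (ca c) (cb c + (cb d - ca d))
        (fun t => if t <= cb c then cf c t else cf d (ca d + (t - cb c))).

Definition crev c : curve R T :=
  Curve (ca c) (cb c) (fun t => cf c (ca c + cb c - t)).

Definition cpoint (x : T) : curve R T := Curve 0 0 (fun=> x).

(* C1 U g expresses that g is of class C^1 on the open set U; being C^1 on a
   closed interval means having a C^1 extension to a neighbourhood of it. *)
Definition piecewise (C1 : set R -> (R -> T) -> Prop) (a b : R) (f : R -> T) :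
    Prop :=
  a <= b /\ exists2 s : seq R, itv_partition a b s &
  forall i, (i < size s)%N ->
    let J := `[nth b (a :: s) i, nth b s i]%classic in
    exists (U : set R) (g : R -> T),
      [/\ open U, J `<=` U, C1 U g & {in J, g =1 f}].
End Curves.

Definition ccomp (R : realType) (T T' : Type) (F : T -> T') (c : curve R T) :
  curve R T' := Curve (ca c) (cb c) (F \o cf c).

Section BacktrackEquivalence.
Variables (R : realType) (M : manifoldType R).
Implicit Types a b c d : curve R M.

Definition pc1 : set (curve R M) :=
  [set c | piecewise (fun U g => Ckm 1 (U : set R^o) g) (ca c) (cb c) (cf c)].

(* c2 = c1 o phi *)
Definition reparam c1 c2 : Prop :=
  [/\ pc1 c1, pc1 c2 & exists phi : R -> R,
    let I1 := `[ca c1, cb c1]%classic in let I2 := `[ca c2, cb c2]%classic in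
    [/\ piecewise (fun U g => Ck 1 (U : set R^o) (g : R^o -> R^o))
          (ca c2) (cb c2) phi,
        {in I2 &, {homo phi : s t / s < t}},
        phi @` I2 = I1 &
        {in I2, cf c2 =1 cf c1 \o phi}]].

Definition same_path : curve R M -> curve R M -> Prop :=
  clos_refl_sym_trans _ reparam.

Definition elem_backtrack c1 c2 : Prop :=
  exists a b d, [/\ [/\ pc1 a, pc1 b & pc1 d],
    cend a = cstart d, cend a = cstart b &
    let long := ccat (ccat (ccat a d) (crev d)) b in
    let short := ccat a b in
    [/\ pc1 c1, pc1 c2 & (same_path c1 long /\ same_path c2 short) \/
                         (same_path c1 short /\ same_path c2 long)]].

Definition bt_equiv : curve R M -> curve R M -> Prop :=
  clos_refl_sym_trans _ elem_backtrack.

Definition bt_class c : set (curve R M) := [set c' | bt_equiv c c'].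

(* Backtrack equivalence classes of the curves satisfying Q. *)
Definition btpath (Q : set (curve R M)) : Type :=
  {S : set (curve R M) | exists2 c, Q c & S = bt_class c}.

Variable Q : set (curve R M).
Implicit Types X Y : btpath Q.

Definition btrep X : curve R M := s2val (cid2 (svalP X)).
Definition btsrc X : M := cstart (btrep X).
Definition bttgt X : M := cend (btrep X).

Definition btclass c (Qc : Q c) : btpath Q :=
  exist _ (bt_class c) (ex_intro2 _ _ c Qc erefl).

(* S itself when it is a class; X is a junk value otherwise. *)
Definition btpath_of X (S : set (curve R M)) : btpath Q :=
  if pselect (exists2 c, Q c & S = bt_class c) is left h then exist _ S h
  else X.

(* Y o X, induced by concatenation of arbitrary representatives; it is junk
   only if bttgt X <> btsrc Y. *)
Definition btcomp Y X : btpath Q :=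
  btpath_of X [set c | exists c1 c2,
    [/\ sval X c1, sval Y c2 & bt_equiv (ccat c1 c2) c]].
End BacktrackEquivalence.

(* The class of F o c for arbitrary representatives c of X. *)
Definition btmap (R : realType) (M N : manifoldType R)
    (Q : set (curve R M)) (Q' : set (curve R N)) (F : M -> N)
    (X0 : btpath Q') (X : btpath Q) : btpath Q' :=
  btpath_of X0 [set c | exists2 c1, sval X c1 & bt_equiv (ccomp F c1) c].

Lemma pc1_point (R : realType) (M : manifoldType R) (x : M) :
  pc1 (cpoint R x).
Proof. by split=> //; exists [::] => //; split=> /=. Qed.

(* The class of the one-point path; it contains all constant paths at x. *)
Definition btid (R : realType) (M : manifoldType R) (x : M) :
  btpath (@pc1 R M) := btclass (pc1_point x).

(* Data of a category; compm g f is relevant only when src g = tgt f. *)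
Record catdata := CatData {
  ob : Type;
  mor : Type;
  src : mor -> ob;
  tgt : mor -> ob;
  idm : ob -> mor;
  compm : mor -> mor -> mor }.

Definition is_category (C : catdata) : Prop :=
  [/\ (forall x : ob C, src (idm x) = x /\ tgt (idm x) = x),
      (forall g f : mor C, src g = tgt f ->
         src (compm g f) = src f /\ tgt (compm g f) = tgt g),
      (forall f : mor C, compm (idm (tgt f)) f = f /\ compm f (idm (src f)) = f) &
      (forall h g f : mor C, src h = tgt g -> src g = tgt f ->
         compm h (compm g f) = compm (compm h g) f)].

Record functordata (C D : catdata) := FunctorData {
  fob : ob C -> ob D;
  fmor : mor C -> mor D }.

Definition is_functor (C D : catdata) (F : functordata C D) : Prop :=
  [/\ (forall f, src (fmor F f) = fob F (src f)),
      (forall f, tgt (fmor F f) = fob F (tgt f)),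
      (forall x, fmor F (idm x) = idm (fob F x)) &
      (forall g f, src g = tgt f ->
         fmor F (compm g f) = compm (fmor F g) (fmor F f))].

Definition prodcat (C D : catdata) : catdata :=
  @CatData (ob C * ob D) (mor C * mor D)
    (fun f => (src f.1, src f.2)) (fun f => (tgt f.1, tgt f.2))
    (fun x => (idm x.1, idm x.2))
    (fun g f => (compm g.1 f.1, compm g.2 f.2)).

Definition is_group (T : Type) (op : T -> T -> T) (e : T) : Prop :=
  [/\ associative op, left_id e op, right_id e op &
      forall x, exists y, op y x = e /\ op x y = e].

Record catgroupdata := CatGroupData {
  cgcat :> catdata;
  cgtensor : functordata (prodcat cgcat cgcat) cgcat;
  ob1 : ob cgcat;
  mor1 : mor cgcat }.

Definition obM (K : catgroupdata) (x y : ob K) : ob K :=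
  fob (cgtensor K) (x, y).
Definition morM (K : catgroupdata) (f g : mor K) : mor K :=
  fmor (cgtensor K) (f, g).

Definition is_categorical_group (K : catgroupdata) : Prop :=
  [/\ is_category K, is_functor (cgtensor K),
      is_group (@obM K) (ob1 K) & is_group (@morM K) (mor1 K)].

Definition is_raction (T X : Type) (op : T -> T -> T) (e : T)
    (act : X -> T -> X) : Prop :=
  (forall x, act x e = x) /\
  (forall x k l, act x (op k l) = act (act x k) l).

Section PrincipalCategoricalBundle.
Variables (P B : catdata) (K : catgroupdata).
Variables (proj : functordata P B) (act : functordata (prodcat P K) P).

Definition oact (p : ob P) (k : ob K) : ob P := fob act (p, k).
Definition mact (f : mor P) (k : mor K) : mor P := fmor act (f, k).

Definition is_categorical_action : Prop :=
  [/\ is_functor act, is_raction (@obM K) (ob1 K) oact &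
      is_raction (@morM K) (mor1 K) mact].

Definition is_principal_categorical_bundle : Prop :=
  [/\ [/\ is_category P, is_category B & is_categorical_group K],
      is_functor proj /\ is_categorical_action,
      (forall b, exists p, fob proj p = b) /\
      (forall f, exists g, fmor proj g = f),
      (forall p k, oact p k = p -> k = ob1 K) /\
      (forall f k, mact f k = f -> k = mor1 K) &
      [/\ (forall p k, fob proj (oact p k) = fob proj p),
          (forall p q, fob proj p = fob proj q -> exists k, q = oact p k),
          (forall f k, fmor proj (mact f k) = fmor proj f) &
          (forall f g, fmor proj f = fmor proj g -> exists k, g = mact f k)]].
End PrincipalCategoricalBundle.

Definition crossed_cat (G H : groupType) (X : crossed_module G H) : catdata :=
  @CatData G (H * G) snd (fun f => cm_tau X f.1 * f.2)%g (fun a => (1%g, a))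
    (fun f2 f1 => (f2.1 * f1.1, f1.2)%g).

Definition crossed_catgroup (G H : groupType) (X : crossed_module G H) :
    catgroupdata :=
  @CatGroupData (crossed_cat X)
    (@FunctorData (prodcat (crossed_cat X) (crossed_cat X)) (crossed_cat X)
      (fun x => x.1 * x.2)%g
      (fun f => (f.1.1 * cm_alpha X f.1.2 f.2.1, f.1.2 * f.2.2)%g))
    1%g (1%g, 1%g).

Definition path_cat (R : realType) (M : manifoldType R) : catdata :=
  @CatData M (btpath (@pc1 R M)) (@btsrc R M _) (@bttgt R M _)
    (@btid R M) (@btcomp R M _).

Section Decorated.
Variables (R : realType) (G H : lieGroupType R).
Variables (X : lie_crossed_module G H) (P M : manifoldType R).
Variables (B : principal_bundle G P M) (A : connection B).

Definition horizontal : set (curve R P) :=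
  [set c | pc1 c /\
    forall t, ca c < t < cb c -> forall v : tangent (cf c t),
      @is_velocity R P (cf c) t v -> forall phi, cform A v phi = 0].

Lemma horizontal_point (p : P) : horizontal (cpoint R p).
Proof.
split; first exact: pc1_point.
by move=> t /= /andP[t0 /(lt_trans t0)]; rewrite ltxx.
Qed.

Definition hpath : Type := btpath horizontal.

Definition hid (p : P) : hpath := btclass (horizontal_point p).

Definition htranslate (gamma : hpath) (g : G) : hpath :=
  btmap (bact B ^~ g) gamma gamma.

Definition dec_cat : catdata :=
  @CatData P (hpath * H)
    (fun f => btsrc f.1)
    (fun f => bact B (bttgt f.1) (cm_tau X f.2^-1%g))
    (fun p => (hid p, 1%g))
    (fun f2 f1 =>
       (btcomp (htranslate f2.1 (cm_tau X f1.2)) f1.1, (f2.2 * f1.2)%g)).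

Definition dec_proj : functordata dec_cat (path_cat M) :=
  @FunctorData dec_cat (path_cat M)
    (bproj B)
    (fun f => btmap (bproj B) (btid (bproj B (btsrc f.1))) f.1).

Definition dec_action :
    functordata (prodcat dec_cat (crossed_catgroup X)) dec_cat :=
  @FunctorData (prodcat dec_cat (crossed_catgroup X)) dec_cat
    (fun x => bact B x.1 x.2)
    (fun x => let: (f, k) := x in
       (htranslate f.1 k.2, cm_alpha X k.2^-1%g (k.1^-1 * f.2)%g)).
End Decorated.

(* Main.v *)
(* A horizontal lift of a C^1 path gamma is found locally as s(gamma) k^-1, for
   a local section s and a solution k of k' = k . A((s o gamma)') in G.
   Right translation by G turns this into a local lift through any given point,
   and interval induction into a lift of a piecewise C^1 path.  Two lifts of the
   same path with the same start differ by a curve k in G with k^-1 k' = 0 off a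
   finite set, hence coincide; therefore reparametrizations and backtracks in M
   lift to reparametrizations and backtracks of the horizontal lifts, and a
   backtrack class in M together with a point over its start has exactly one
   horizontal lift class.  This is surjectivity and transitivity on morphisms.
   Freeness is that of the action of G on the initial points, and the remaining
   claims are algebra in the crossed module. *)
Require Import Defs.
From mathcomp Require Import all_boot all_order all_algebra.
From mathcomp Require Import all_classical all_reals all_analysis.
From mathcomp Require Import lra ring.
From Stdlib Require Import Relation_Operators.
Set Implicit Arguments.
Unset Strict Implicit.
Unset Printing Implicit Defensive.
Import Order.TTheory GRing.Theory Num.Theory.
Import numFieldNormedType.Exports.
Local Open Scope classical_set_scope.
Local Open Scope ring_scope.

(** * C^1 maps between normed modules *)

Section C1AtPoint.
Variable R : realType.
Implicit Types E F W : normedModType R.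

(** The obstacle is that horizontality is tested at every parameter with a two-sided derivative,
    joints of a concatenation included, while chain and product rules reach only the parameters
    where the pieces are C^1. All constructions therefore establish horizontality off a finite set,
    and two facts close the gap: A of the velocity is continuous along a C^1 piece, which settles
    the joints; and a continuous curve in G that is locally constant off a finite set is constant,
    which gives uniqueness. Uniqueness is proved for curves that are merely one-sidedly continuous
    and horizontal off a finite set, so that a lift composed with a change of parameter can be
    compared with another lift. Equivalences are lifted by induction on the generating steps; the
    intermediate curves of a chain in M come without lifts, so existence is used there as well. The
    equation in G is only ever solved near one parameter, inside one chart at 1; its coefficients
    and coordinates are truncated so that a global contraction argument applies. *)

Definition C1_at E F (h : E -> F) (x : E) : Prop :=
  exists U : set E, [/\ open U, U x & Ck 1 U h].

Lemma C1_at_differentiable E F (h : E -> F) x : C1_at h x -> differentiable h x.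
Proof. by move=> [U [_ Ux [dh _]]]; exact: dh. Qed.

Lemma C1_at_near E F (h : E -> F) x : C1_at h x -> \forall y \near x, C1_at h y.
Proof.
move=> [U [oU Ux ch]]; apply: filterS (open_nbhs_nbhs (conj oU Ux)) => y Uy.
by exists U.
Qed.

Lemma C1_at_continuous E F (h : E -> F) x : C1_at h x -> {for x, continuous h}.
Proof. by move=> /C1_at_differentiable/differentiable_continuous. Qed.

Lemma C1_at_derive E F (h : E -> F) x v :
  C1_at h x -> {for x, continuous ('D_v h)}.
Proof. by move=> [U [_ Ux [_ ch]]]; apply: ch; exact/mem_set. Qed.

Lemma C1_at_intro E F (h : E -> F) x :
  (\forall y \near x, differentiable h y /\
     forall v, {for y, continuous ('D_v h)}) -> C1_at h x.
Proof.
move=> hx; exists (interior [set y | differentiable h y /\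
     forall v, {for y, continuous ('D_v h)}]); split.
- exact: open_interior.
- exact: hx.
- split=> [y /interior_subset[]//|v y /set_mem /interior_subset[_]]; exact.
Qed.

Lemma Ck1_at E F (U : set E) (h : E -> F) :
  Ck 1 U h <-> forall x, U x -> differentiable h x /\
    forall v, {for x, continuous ('D_v h)}.
Proof.
split=> [[dh ch] x Ux|H].
  by split=> [|v]; [exact: dh|apply: ch; exact/mem_set].
by split=> [x /H[]//|v x /set_mem/H[_]]; exact.
Qed.

Lemma C1_at_Ck1 E F (U : set E) (h : E -> F) :
  (forall x, U x -> C1_at h x) -> Ck 1 U h.
Proof.
move=> H; apply/Ck1_at => x /H ch; split; first exact: C1_at_differentiable.
by move=> v; exact: C1_at_derive.
Qed.

(** The difference [g - f] vanishes near x, so it is differentiable there with differential 0. *)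
Lemma near_eq_differentiable E F (f g : E -> F) x :
  (\forall y \near x, f y = g y) -> differentiable f x -> differentiable g x.
Proof.
move=> fg df.
have -> : g = f + (g - f) by rewrite addrC subrK.
apply: differentiableD; first exact: df.
have k0 : \forall y \near x, (g - f) y = 0.
  by apply: filterS fg => y fgy; rewrite !fctE fgy subrr.
set k := g - f in k0 *.
have kd : k \o shift x = cst (k x) + (\0 : E -> F) +o_ 0 id.
  apply/eqaddoP => e e0; near=> y.
  have -> : (k \o shift x - (cst (k x) + \0)) y = k (y + x) - (k x + 0) by [].
  rewrite (nbhs_singleton k0) addr0 subr0.
  have -> : k (y + x) = 0.
    by near: y; move: k0; rewrite (near_shift 0) /= subr0.
  by rewrite normr0 mulr_ge0 // ltW.
have kc : continuous (\0 : E -> F) by exact: cst_continuous.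
have := @diff_unique _ _ _ _ (\0 : {linear E -> F}) _ kc kd => dk.
apply/diff_locallyP; rewrite dk; split => //.
Unshelve. all: by end_near. Qed.

Lemma near_eq_continuous_at (T U : topologicalType) (f g : T -> U) x :
  (\forall y \near x, f y = g y) -> {for x, continuous f} ->
  {for x, continuous g}.
Proof.
move=> fg; rewrite /prop_for /continuous_at -(nbhs_singleton fg) => cf.
by apply: cvg_trans cf; exact: near_eq_cvg.
Qed.

Lemma near_eq_C1_at E F (f g : E -> F) x :
  (\forall y \near x, f y = g y) -> C1_at f x -> C1_at g x.
Proof.
move=> fg cf; apply: C1_at_intro.
near=> y.
have fgy : \forall z \near y, f z = g z by near: y; exact: near_join.
have cy : C1_at f y by near: y; exact: C1_at_near.
split; first exact: near_eq_differentiable fgy (C1_at_differentiable cy).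
move=> v; apply: (@near_eq_continuous_at _ _ ('D_v f)); last exact: C1_at_derive.
apply: filterS (near_join fgy) => z fgz; exact: near_eq_derive.
Unshelve. all: by end_near. Qed.

Lemma C1_at_cst E F (a : F) (x : E) : C1_at (cst a) x.
Proof.
apply: C1_at_intro; near=> y; split; first exact: differentiable_cst.
move=> v; rewrite (_ : 'D_v (cst a) = cst 0); first exact: cst_continuous.
by apply/funext => z; rewrite derive_cst.
Unshelve. all: by end_near. Qed.

Lemma C1_at_id E (x : E) : C1_at id x.
Proof.
apply: C1_at_intro; near=> y; split=> // v.
rewrite (_ : 'D_v id = cst v); first exact: cst_continuous.
by apply/funext => z; rewrite derive_id.
Unshelve. all: by end_near. Qed.

Lemma C1_atD E F (f g : E -> F) (x : E) :
  C1_at f x -> C1_at g x -> C1_at (f \+ g) x.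
Proof.
move=> cf cg; apply: C1_at_intro; near=> y.
have fy : C1_at f y by near: y; exact: C1_at_near.
have gy : C1_at g y by near: y; exact: C1_at_near.
split; first by apply: differentiableD; exact: C1_at_differentiable.
move=> v; have D z : C1_at f z -> C1_at g z ->
    'D_v (f \+ g) z = 'D_v f z + 'D_v g z.
  by move=> ? ?; rewrite deriveD//; apply: diff_derivable;
     exact: C1_at_differentiable.
apply: (@near_eq_continuous_at _ _ (fun z => 'D_v f z + 'D_v g z)); last first.
  by apply: cvgD; exact: C1_at_derive.
by near=> z; apply/esym/D; near: z => //; exact: C1_at_near.
Unshelve. all: by end_near. Qed.

Lemma C1_atZ E F (k : R) (f : E -> F) (x : E) :
  C1_at f x -> C1_at (k \*: f) x.
Proof.
move=> cf; apply: C1_at_intro; near=> y.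
have fy : C1_at f y by near: y; exact: C1_at_near.
split; first by apply: differentiableZ; exact: C1_at_differentiable.
move=> v; have D z : C1_at f z -> 'D_v (k \*: f) z = k *: 'D_v f z.
  by move=> ?; rewrite deriveZ//; apply: diff_derivable;
     exact: C1_at_differentiable.
apply: (@near_eq_continuous_at _ _ (fun z => k *: 'D_v f z)); last first.
  by apply: cvgZl_tmp; exact: C1_at_derive.
by near=> z; apply/esym/D; near: z => //; exact: C1_at_near.
Unshelve. all: by end_near. Qed.

Lemma derive_pair E F W (f : E -> F) (g : E -> W) x v :
  differentiable f x -> differentiable g x ->
  'D_v (fun z => (f z, g z)) x = ('D_v f x, 'D_v g x).
Proof.
move=> df dg.
have dfg := differentiable_pair df dg.
by rewrite (deriveE _ dfg) (diff_pair df dg) /= (deriveE _ dg) (deriveE _ df).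
Qed.

Lemma C1_at_pair E F W (f : E -> F) (g : E -> W) x :
  C1_at f x -> C1_at g x -> C1_at (fun z => (f z, g z)) x.
Proof.
move=> cf cg; apply: C1_at_intro; near=> y.
have fy : C1_at f y by near: y; exact: C1_at_near.
have gy : C1_at g y by near: y; exact: C1_at_near.
split; first by apply: differentiable_pair; exact: C1_at_differentiable.
move=> v; have D z : C1_at f z -> C1_at g z ->
    'D_v (fun z => (f z, g z)) z = ('D_v f z, 'D_v g z).
  by move=> ? ?; rewrite derive_pair//; exact: C1_at_differentiable.
apply: (@near_eq_continuous_at _ _ (fun z => ('D_v f z, 'D_v g z))); last first.
  by apply: cvg_pair; exact: C1_at_derive.
by near=> z; apply/esym/D; near: z => //; exact: C1_at_near.
Unshelve. all: by end_near. Qed.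

Lemma derive_comp E F W (f : E -> F) (g : F -> W) x v :
  differentiable f x -> differentiable g (f x) ->
  'D_v (g \o f) x = 'D_('D_v f x) g (f x).
Proof.
move=> df dg; have dgf := differentiable_comp df dg.
by rewrite (deriveE _ dgf) (diff_comp df dg) /= (deriveE _ dg) (deriveE _ df).
Qed.

Lemma continuous_at_sum (T : topologicalType) E n (f : 'I_n -> T -> E) (x : T) :
  (forall i, {for x, continuous (f i)}) ->
  {for x, continuous (fun y => \sum_i f i y)}.
Proof.
move=> cf; elim: n f cf => [|n IHn] f cf.
  rewrite (_ : (fun y => _) = cst 0); first exact: cvg_cst.
  by apply/funext => y; rewrite big_ord0.
rewrite (_ : (fun y => _) =
    (fun y => f ord0 y + \sum_(i < n) f (lift ord0 i) y)).
  by apply: cvgD; [exact: cf|apply: IHn => i; exact: cf].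
by apply/funext => y; rewrite big_ord_recl.
Qed.

(* A finite spanning family with continuous coordinates, as carried by R,
   row vectors and their products; this is what the chain rule for C^1 maps
   needs, C^1 being expressed by directional derivatives. *)
Definition finite_coordinates E : Prop :=
  exists n (e : 'I_n -> E) (c : 'I_n -> E -> R),
    (forall i, continuous (c i)) /\ forall v, v = \sum_i c i v *: e i.

Lemma derive_sum_dir E F n (h : E -> F) (x : E) (c : 'I_n -> R) (e : 'I_n -> E) :
  differentiable h x ->
  'D_(\sum_i c i *: e i) h x = \sum_i c i *: 'D_(e i) h x.
Proof.
move=> dh; rewrite deriveE// linear_sum; apply: eq_bigr => i _.
by rewrite linearZ deriveE.
Qed.

Lemma C1_at_comp E F W (f : E -> F) (g : F -> W) x : finite_coordinates F ->
  C1_at f x -> C1_at g (f x) -> C1_at (g \o f) x.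
Proof.
move=> [n [e [c [cc cE]]]] cf cg.
have cgf : \forall y \near x, C1_at g (f y).
  by apply: (C1_at_continuous cf); exact: C1_at_near.
apply: C1_at_intro; near=> y.
have fy : C1_at f y by near: y; exact: C1_at_near.
have gfy : \forall z \near y, C1_at g (f z) by near: y; exact: near_join.
split.
  apply: differentiable_comp; apply: C1_at_differentiable => //.
  exact: nbhs_singleton gfy.
(* The direction ['D_v f z] varies with z, whereas continuity of the derivative of g is known along
   fixed directions only; hence the expansion in the [e i]. *)
move=> v; have D z : C1_at f z -> C1_at g (f z) ->
    'D_v (g \o f) z = \sum_i c i ('D_v f z) *: 'D_(e i) g (f z).
  move=> /C1_at_differentiable ? /C1_at_differentiable ?.
  by rewrite derive_comp// -derive_sum_dir// -cE.
have gy := nbhs_singleton gfy.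
apply: (@near_eq_continuous_at _ _
  (fun z => \sum_i c i ('D_v f z) *: 'D_(e i) g (f z))); last first.
  apply: continuous_at_sum => i; apply: cvgZ.
    by apply: (@continuous_comp _ _ _ ('D_v f) (c i));
      [exact: C1_at_derive|exact: cc].
  by apply: (@continuous_comp _ _ _ f ('D_(e i) g));
    [exact: C1_at_continuous|exact: C1_at_derive].
near=> z; apply/esym/D; near: z => //; exact: C1_at_near.
Unshelve. all: by end_near. Qed.

Lemma finite_coordinates_R : finite_coordinates (R^o : normedModType R).
Proof.
exists 1%N, (fun=> 1), (fun=> id); split=> [_ x|v]; first exact: cvg_id.
by rewrite big_ord1 /GRing.scale /= mulr1.
Qed.

Lemma finite_coordinates_rV n : finite_coordinates ('rV[R]_n : normedModType R).
Proof.
exists n, (fun i => delta_mx 0 i), (fun i (v : 'rV[R]_n) => v 0 i); split.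
  by move=> i; exact: coord_continuous.
by move=> v; exact: row_sum_delta.
Qed.

Lemma finite_coordinates_prod E F :
  finite_coordinates E -> finite_coordinates F ->
  finite_coordinates (E * F : normedModType R)%type.
Proof.
move=> [m [e [c [cc cE]]]] [n [e' [c' [cc' cE']]]].
exists (m + n)%N, (fun i => match fintype.split i with
                          | inl i => (e i, 0) | inr j => (0, e' j) end),
  (fun i v => match fintype.split i with inl i => c i v.1 | inr j => c' j v.2 end).
split=> [i|[v w]].
  case: (fintype.split i) => j x.
    by apply: continuous_comp; [exact: cvg_fst|exact: cc].
  by apply: continuous_comp; [exact: cvg_snd|exact: cc'].
rewrite big_split_ord /=.
under eq_bigr do rewrite (unsplitK (inl _)).
under [X in _ = _ + X]eq_bigr do rewrite (unsplitK (inr _)).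
rewrite {1}(cE v) {1}(cE' w).
apply: injective_projections => /=.
  rewrite [RHS]/GRing.add/= !(@raddf_sum _ _ (@fst E F)) /=.
  by rewrite [X in _ = _ + X]big1 ?addr0// => i _; rewrite scaler0.
rewrite [RHS]/GRing.add/= !(@raddf_sum _ _ (@snd E F)) /=.
by rewrite [X in _ = X + _]big1 ?add0r// => i _; rewrite scaler0.
Qed.

End C1AtPoint.

(** * Ordinary differential equations *)

Section RowVectorEstimates.
Variable R : realType.

Lemma rV_norm_le n (x : 'rV[R]_n) (K : R) :
  0 <= K -> (forall j, `|x 0 j| <= K) -> `|x| <= K.
Proof.
move=> K0 xK; rewrite [leLHS]/Num.Def.normr/= mx_normrE.
by apply: bigmax_le => // -[i j] _ /=; rewrite ord1.
Qed.

Lemma rV_coord_le n (x : 'rV[R]_n) j : `|x 0 j| <= `|x|.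
Proof.
rewrite [leRHS]/Num.Def.normr/= mx_normrE; exact: (le_bigmax _ _ (0, j)).
Qed.

Lemma is_derive_rV n (F : R^o -> 'rV[R]_n) (t : R^o) (d : 'rV[R]_n) :
  is_derive t 1 F d <->
  forall j, is_derive t 1 (fun s => F s 0 j : R^o) (d 0 j).
Proof.
split=> [[dF Fd] j|H].
  split; first exact: (derivable_mxP F t 1).1.
  by rewrite -Fd derive_mx// mxE.
have dF : derivable F t 1.
  by apply/derivable_mxP => i j; rewrite ord1; have [] := H j.
split=> //; rewrite derive_mx//; apply/rowP => j; rewrite mxE.
by have [_ ->] := H j.
Qed.

(** The norm of a row vector is the maximum over its coordinates, so the scalar mean value theorem
    in each coordinate, each with its own intermediate point, loses no constant. *)
Lemma mean_value_rV n (F dF : R^o -> 'rV[R]_n) (a b K : R) : a <= b ->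
  (forall t, a <= t <= b -> is_derive t 1 F (dF t)) ->
  (forall t, a <= t <= b -> `|dF t| <= K) ->
  `|F b - F a| <= K * (b - a).
Proof.
move=> ab dFt Kt.
have K0 : 0 <= K by apply: le_trans (Kt a _); rewrite ?lexx ?ab.
apply: rV_norm_le => [|j]; first by rewrite mulr_ge0// subr_ge0.
have dj (t : R) : t \in `[a, b]%R ->
    is_derive t 1 (fun s => F s 0 j : R^o) (dF t 0 j).
  by rewrite in_itv/= => /dFt/is_derive_rV; exact.
pose g (t : R) : R := F t 0 j; pose dg (t : R) : R := dF t 0 j.
have Hg : forall t : R, t \in `]a, b[%R -> is_derive t 1 g (dg t).
  move=> t; rewrite in_itv/= => /andP[/ltW at_ /ltW tb].
  by apply: dj; rewrite in_itv/= at_.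
have cg : {within `[a, b], continuous g}.
  by apply: derivable_within_continuous => t /dj[].
have [c cab] := MVT_segment ab Hg cg.
rewrite /g /dg !mxE => ->; rewrite normrM (ger0_norm (x := b - a)) ?subr_ge0//.
by rewrite ler_wpM2r ?subr_ge0// (le_trans (rV_coord_le _ _))// Kt.
Qed.

Lemma is_derive_line (E : normedModType R) (z w : E) (s : R^o) :
  is_derive s 1 (fun s : R^o => s *: w + z) w.
Proof.
have := @is_deriveD _ _ _ (fun s : R^o => s *: w) (cst z) s 1 w 0.
rewrite addr0; apply.
have [d1 d2] := is_diff_scalel s w.
by split; [exact: diff_derivable|rewrite deriveE// d2 scale1r].
Qed.

(** Mean value inequality on the segment from z to y, which stays in the ball by convexity. In the
    constant, the [+ 1] is the room that continuity leaves to the partial derivatives around x. *)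
Lemma C1_at_locally_lipschitz m n (h : 'rV[R]_m -> 'rV[R]_n) x : C1_at h x ->
  exists2 e, 0 < e & exists2 L, 0 <= L &
    forall y z, ball x e y -> ball x e z -> `|h y - h z| <= L * `|y - z|.
Proof.
move=> ch.
pose M := \sum_(i < m) (`|'D_(delta_mx 0 i) h x| + 1).
have hM : \forall y \near x, C1_at h y /\
    forall i, `|'D_(delta_mx 0 i) h y| <= `|'D_(delta_mx 0 i) h x| + 1.
  have H1 := C1_at_near ch; apply: filterI; first exact: H1.
  apply: (@filter_forall _ _ _ (nbhs (x : 'rV[R]_m))) => i.
  have /cvgrPdist_le/(_ 1 ltr01) := C1_at_derive (v := ('e_i : 'rV[R]_m)) ch.
  apply: filterS => y yx.
  rewrite -[leLHS](subrK `|'D_(delta_mx 0 i) h x|) addrC lerD2l.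
  by apply: le_trans (lerB_dist _ _) _; rewrite distrC.
have /nbhs_ballP[e /= e0 He] := hM.
exists e => //; exists M; first by apply: sumr_ge0 => i _; rewrite addr_ge0.
move=> y z yb zb.
have line s : 0 <= s <= 1 -> ball x e (s *: (y - z) + z).
  move=> /andP[s0 s1]; rewrite -ball_normE /=.
  have -> : x - (s *: (y - z) + z) = s *: (x - y) + (1 - s) *: (x - z).
    by apply/rowP => i; rewrite !mxE; ring.
  rewrite (le_lt_trans (ler_normD _ _))// !normrZ.
  have := yb; have := zb; rewrite -!ball_normE /= => zb' yb'.
  rewrite (ger0_norm s0) (ger0_norm (x := 1 - s)) ?subr_ge0//.
  (* The strict inequality comes from the summand with factor s, so s = 0 is treated apart. *)
  have [->|s_gt0] := eqVneq s 0; first by rewrite mul0r add0r subr0 mul1r.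
  rewrite (_ : e = s * e + (1 - s) * e); last by rewrite -mulrDl subrKC mul1r.
  have s_pos : 0 < s by rewrite lt_def s_gt0.
  by rewrite ltr_leD// ?ltr_pM2l// ler_wpM2l ?subr_ge0// ltW.
have := @mean_value_rV n (fun s => h (s *: (y - z) + z))
  (fun s => 'D_(y - z) h (s *: (y - z) + z)) 0 1 (M * `|y - z|) ler01.
rewrite scale1r subrK scale0r add0r subr0 mulr1; apply=> t t01.
  have [ct _] := He _ (line _ t01).
  have [dl Dl] := is_derive_line z (y - z) t.
  have dl' := (derivable1_diffP _ _).1 dl.
  have dh := C1_at_differentiable ct.
  split.
    by apply: diff_derivable; apply: (differentiable_comp (g := h)).
  by rewrite (@derive_comp R R^o _ _ _ h t 1 dl' dh) Dl.
have [ct bt] := He _ (line _ t01).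
have -> : 'D_(y - z) h (t *: (y - z) + z) =
    \sum_i (y - z) 0 i *: 'D_('e_i) h (t *: (y - z) + z).
  by rewrite -(derive_sum_dir _ _ (C1_at_differentiable ct)) -row_sum_delta.
rewrite (le_trans (ler_norm_sum _ _ _))// mulr_suml ler_sum// => i _.
by rewrite normrZ mulrC ler_pM// rV_coord_le.
Unshelve. all: by end_near. Qed.

End RowVectorEstimates.

(** * Truncation of a real number to an interval *)

Section Clip.
Variable R : realType.
Implicit Types a b s t : R.

(** Composition with this retraction extends data given on a segment to the whole line, keeping
    continuity and Lipschitz bounds. *)
Definition clip a b t : R := Num.max a (Num.min t b).

Lemma clip_bounds a b t : a <= b -> a <= clip a b t <= b.
Proof. by move=> ab; rewrite le_max lexx /= ge_max ge_min lexx ab orbT. Qed.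

Lemma clip_id a b t : a <= t <= b -> clip a b t = t.
Proof. by move=> /andP[at_ tb]; rewrite /clip min_l// max_r. Qed.

Lemma clip_dist a b s t : a <= b -> `|clip a b s - clip a b t| <= `|s - t|.
Proof.
rewrite /clip !maxElt !minElt; case: (ltP s b); case: (ltP t b) => tb sb ab;
  do ! case: ifPn; rewrite -?leNgt => *; rewrite ler_norml;
  have := ler_norm (s - t); have := ler_norm (t - s); rewrite (distrC t s);
  set d := `|_| => ? ?; apply/andP; split; lra.
Qed.

Lemma clip_continuous a b : a <= b -> continuous (clip a b).
Proof.
move=> ab t; apply/cvgrPdist_lt => d d0.
have /cvgrPdist_lt/(_ d d0) := @cvg_id _ (nbhs (t : R)).
by apply: filterS => s; apply: le_lt_trans; exact: clip_dist.
Qed.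

End Clip.

(** * Antiderivatives and the Picard-Lindelof theorem *)

Section Ode.
Variable R : realType.

Lemma antiderivative (f : R -> R) (a : R) : continuous f ->
  exists2 F : R^o -> R^o, F a = 0 & forall x, a <= x -> is_derive x 1 F (f x).
Proof.
move=> cf.
pose mu := @lebesgue_measure R.
(* Integrating from a - 1 makes a itself an interior point, so the two-sided derivative exists there
   too. *)
pose F x := (\int[mu]_(t in `[a - 1, x]) f t)%R.
exists (fun x => F x - F a); first by rewrite subrr.
move=> x ax.
have [||||dF Fx] := @continuous_FTC1_closed R f (a - 1) x (x + 1).
- by rewrite ltrDl.
- apply: continuous_compact_integrable; first exact: segment_compact.
  exact: continuous_subspaceT.
- by rewrite (lt_le_trans _ ax)// gtrDl oppr_lt0.
- exact: cf.
rewrite -[f x]subr0 -Fx derive1E.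
by apply: is_deriveB; exact: derivableP.
Qed.

Lemma antiderivative_rV n (f : R -> 'rV[R]_n) (a : R) : continuous f ->
  exists2 F : R^o -> 'rV[R]_n, F a = 0 &
    forall x, a <= x -> is_derive x 1 F (f x).
Proof.
move=> cf.
have /choice[F HF] : forall j, exists F : R^o -> R^o, F a = 0 /\
    forall x, a <= x -> is_derive x 1 F (f x 0 j).
  move=> j; have [|F F0 FD] := @antiderivative (fun x => f x 0 j) a.
    by move=> x; apply: (@continuous_comp _ _ _ f (fun v => v 0 j));
      [exact: cf|exact: coord_continuous].
  by exists F.
exists (fun x => \row_j F j x).
  by apply/rowP => j; rewrite !mxE (HF j).1.
move=> x ax; apply/is_derive_rV => j.
by under eq_fun do rewrite mxE; exact: (HF j).2.
Qed.

Lemma geometric_small (C e : R) : 0 < e -> exists n : nat, C / 2 ^+ n < e.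
Proof.
move=> e0; have e1 : 0 < e / (`|C| + 1) by rewrite divr_gt0// ltr_wpDl.
have [n _ /(_ n (leqnn n)) Hn] := near_infty_natSinv_expn_lt (PosNum e1).
exists n; move: Hn; rewrite /= div1r ltr_pdivlMr ?ltr_wpDl//.
apply: le_lt_trans; rewrite mulrC ler_wpM2l ?invr_ge0 ?exprn_ge0//.
by rewrite (le_trans (ler_norm _))// lerDl.
Qed.

Lemma geometric_cauchy (V : completeNormedModType R) (u : nat -> V) (B : R) :
  0 <= B -> (forall n, `|u n.+1 - u n| <= B / 2 ^+ n) ->
  exists l, forall n, `|l - u n| <= B * 2 / 2 ^+ n.
Proof.
move=> B0 uB.
(* The exact geometric partial sum, rather than the bound 2B / 2^n, lets the induction on k
   close. *)
have uD n k : `|u (n + k)%N - u n| <= B * 2 / 2 ^+ n - B * 2 / 2 ^+ (n + k).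
  elim: k => [|k IHk]; first by rewrite addn0 !subrr normr0.
  rewrite addnS -(subrKA (u (n + k)%N)) (le_trans (ler_normD _ _))//.
  rewrite (le_trans (lerD (uB _) IHk))// exprS.
  have : B * 2 / (2 * 2 ^+ (n + k)) = B / 2 ^+ (n + k).
    by rewrite invfM mulrA mulfK.
  by move=> ->; lra.
have uN n m : (n <= m)%N -> `|u m - u n| <= B * 2 / 2 ^+ n.
  move=> nm; rewrite -(subnKC nm) (le_trans (uD _ _))// gerBl.
  by rewrite divr_ge0 ?mulr_ge0 ?exprn_ge0.
have : cvg (u @ \oo).
  apply/cauchy_cvgP/cauchy_exP => e e0.
  have [n Hn] := geometric_small (B * 2) e0; exists (u n).
  exists n => // m /= /uN nm.
  by rewrite -ball_normE /= distrC (le_lt_trans nm).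
move=> /cvg_ex[l ul]; exists l => n; apply/ler_addgt0Pr => e e0.
have /cvgrPdist_lt/(_ e e0) [m _ Hm] := ul.
have := Hm (maxn m n) (leq_maxl _ _); have := uN n (maxn m n) (leq_maxr _ _).
move=> H1 H2; rewrite -(subrKA (u (maxn m n))) (le_trans (ler_normD _ _))//.
by rewrite addrC lerD// ltW.
Qed.

(** The length e satisfies L e = 1/2, which makes the Picard operator a contraction of ratio 1/2.
    The last clause, a bound on the distance to [x0], is what later keeps the solution inside a
    chart. *)
Lemma picard_lindelof n (f : R -> 'rV[R]_n -> 'rV[R]_n) (L t0 : R)
    (x0 : 'rV[R]_n) :
  0 < L -> (forall x, continuous (f ^~ x)) ->
  (forall t x y, `|f t x - f t y| <= L * `|x - y|) ->
  let e := (2 * L)^-1 in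
  exists x : R^o -> 'rV[R]_n,
    [/\ continuous x,
        forall t, t0 < t < t0 + e -> is_derive t 1 x (f t (x t)) &
        forall C, (forall t y, `|f t y| <= C) -> forall t, `|x t - x0| <= C * e].
Proof.
move=> L0 cf lf e.
have e0 : 0 < e by rewrite invr_gt0 mulr_gt0.
have Le : L * e = 2^-1 by rewrite /e invfM mulrCA mulfV ?mulr1// gt_eqF.
(* Iterates are functions of [c t]: they live on the whole line but take only their values on the
   segment, so uniform bounds are available. *)
pose c := clip t0 (t0 + e).
have t0e : t0 <= t0 + e by rewrite lerDl ltW.
have cI t : t0 <= c t <= t0 + e := clip_bounds t t0e.
have cid t : t0 <= t <= t0 + e -> c t = t := @clip_id R t0 (t0 + e) t.
have cc : continuous c := clip_continuous t0e.
have cfu (u : R -> 'rV[R]_n) : continuous u -> continuous (fun t => f t (u t)).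
  move=> cu t; apply/cvgrPdist_lt => d d0.
  have d2 : 0 < d / 2 by rewrite divr_gt0.
  have dL : 0 < d / 2 / L by rewrite divr_gt0.
  have /cvgrPdist_lt/(_ _ dL) H1 := cu t.
  have /cvgrPdist_lt/(_ _ d2) H2 := cf (u t) t.
  apply: filterS2 H1 H2 => s H1 H2.
  rewrite -(subrKA (f s (u t))) (le_lt_trans (ler_normD _ _))//.
  rewrite (splitr d) ltr_leD// (le_trans (lf _ _ _))//.
  by rewrite -ler_pdivlMl// mulrC ltW.
(* [v] is x0 plus the integral of f(s, u(s)) from t0, frozen outside the segment. *)
pose good (u v : R -> 'rV[R]_n) := exists F : R^o -> 'rV[R]_n,
  [/\ F t0 = 0, forall t, t0 <= t -> is_derive t 1 F (f t (u t)) &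
      forall t, v t = x0 + F (c t)].
have good_cont u v : good u v -> continuous v.
  move=> [F [_ dF vE]]; rewrite (_ : v = fun t => x0 + F (c t)); last first.
    exact/funext.
  move=> t; apply: cvgD; first exact: cvg_cst.
  apply: (@continuous_comp _ _ _ c F); first exact: cc.
  apply: differentiable_continuous; apply/derivable1_diffP.
  by have /andP[h _] := cI t; have [] := dF _ h.
have goodB u u' v v' (K : R) : good u v -> good u' v' ->
    (forall t, `|u t - u' t| <= K) -> forall t, `|v t - v' t| <= K / 2.
  move=> [F [F0 dF vE]] [F' [F0' dF' vE']] uK t.
  have K0 : 0 <= K by apply: le_trans (uK 0).
  have /andP[c1 c2] := cI t.
  have := @mean_value_rV R n (F - F') (fun t => f t (u t) - f t (u' t)) t0 (c t)
    (L * K) c1.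
  have -> : (F - F') (c t) - (F - F') t0 = v t - v' t.
    by rewrite !fctE F0 F0' vE vE' subrr subr0 opprD addrACA subrr add0r.
  move=> /(_ _ _)/le_trans; apply.
  - move=> s /andP[s0 _].
    have := dF s s0; have := dF' s s0 => ? ?; exact: is_deriveB.
  - by move=> s _; rewrite (le_trans (lf _ _ _))// ler_pM2l.
  - rewrite -Le mulrA (mulrC K) ler_wpM2l ?mulr_ge0 ?(ltW L0)//.
    by rewrite lerBlDl.
(* The Picard operator; nothing is claimed at a discontinuous u. *)
have /choice[T HT] : forall u : R -> 'rV[R]_n, exists v : R -> 'rV[R]_n,
    continuous u -> good u v.
  move=> u.
  have [cu|nc] := pselect (continuous u); last by exists u.
  have [F F0 dF] := antiderivative_rV t0 (cfu u cu).
  by exists (fun t => x0 + F (c t)) => _; exists F.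
pose u k := iter k T (cst x0).
have cu k : continuous (u k).
  elim: k => [|k IHk]; first exact: cst_continuous.
  by apply: good_cont (HT _ IHk).
(* The first increment depends on t only through [c t], so the extreme value theorem on the segment
   bounds it everywhere. *)
have [B B0 HB] : exists2 B, 0 <= B & forall t, `|u 1%N t - u 0%N t| <= B.
  have [||b _ Hb] := @EVT_max R (fun t => `|u 1%N t - x0|) t0 (t0 + e).
  - by rewrite lerDl ltW.
  - apply: continuous_subspaceT => t; apply: cvg_norm.
    by apply: cvgB; [exact: cu|exact: cvg_cst].
  exists `|u 1%N b - x0| => // t.
  have [F [_ _ E]] := HT _ (cu 0%N).
  have := Hb (c t); rewrite in_itv/= => /(_ (cI t)).
  by rewrite !E cid.
have uB k t : `|u k.+1 t - u k t| <= B / 2 ^+ k.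
  elim: k t => [|k IHk] t; first by rewrite expr0 divr1.
  rewrite exprSr invfM mulrA.
  by apply: (goodB (u k.+1) (u k)) => //; exact: HT.
have /choice[x Hx] : forall t, exists l, forall k, `|l - u k t| <= B * 2 / 2 ^+ k.
  move=> t; have /choice[l Hl] : forall j, exists l : R, forall k,
      `|l - u k t 0 j| <= B * 2 / 2 ^+ k.
    move=> j; apply: (@geometric_cauchy R^o (fun k => u k t 0 j)) => // k.
    have := rV_coord_le (u k.+1 t - u k t) j; rewrite !mxE => /le_trans; exact.
  exists (\row_j l j) => k; apply: rV_norm_le => [|j]; last by rewrite !mxE.
  by rewrite divr_ge0 ?mulr_ge0 ?exprn_ge0.
have cx : continuous x.
  move=> t; apply/cvgrPdist_lt => d d0.
  have d3 : 0 < d / 3 by rewrite divr_gt0.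
  have [k Hk] := geometric_small (B * 2) d3.
  have /cvgrPdist_lt/(_ _ d3) := cu k t.
  apply: filterS => s Hs.
  have -> : x t - x s = (x t - u k t) + (u k t - u k s) + (u k s - x s).
    by rewrite !subrKA.
  have H1 := le_lt_trans (Hx t k) Hk; have := le_lt_trans (Hx s k) Hk.
  rewrite distrC => H2.
  rewrite (le_lt_trans (ler_normD _ _))// (_ : d = d / 3 + d / 3 + d / 3).
    by rewrite ltrD// (le_lt_trans (ler_normD _ _))// ltrD.
  by lra.
(* Both [T x] and [x] are within a multiple of 2^-k of [u k.+1], for every k. *)
have Tx : T x = x.
  apply/funext => t; apply/eqP; rewrite -subr_eq0 -normr_le0.
  apply/ler_addgt0Pr => d d0; rewrite add0r.
  have [k Hk] := geometric_small (B * 2) d0.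
  rewrite -(subrKA (u k.+1 t)) (le_trans (ler_normD _ _))//.
  have H1 := goodB _ _ _ _ _ (HT _ cx) (HT _ (cu k)) (Hx ^~ k) t.
  have H2 := Hx t k.+1; rewrite distrC in H2.
  move: H2; rewrite exprSr invfM mulrA => H2.
  rewrite (le_trans (lerD H1 H2))//.
  by rewrite -splitr ltW.
exists x; split => //.
  move=> t /andP[t1 t2]; have [F [_ dF E]] := HT _ cx.
  rewrite {1}Tx in E.
  have dt := dF t (ltW t1).
  have D : is_derive t 1 (cst x0 + F) (0 + f t (x t)) by exact: is_deriveD.
  rewrite add0r in D; apply: (near_eq_is_derive _ D).
  have : t \in `]t0, (t0 + e)[ by rewrite in_itv/= t1.
  move=> /near_in_itvoo; apply: filterS => s; rewrite in_itv/= => /andP[s1 s2].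
  by rewrite E cid ?ltW// s1 s2.
move=> C fC t; have [F [F0 dF E]] := HT _ cx; rewrite {1}Tx in E.
have C0 : 0 <= C by apply: le_trans (fC 0 x0).
have /andP[c1 c2] := cI t.
have dF' s : t0 <= s <= c t -> is_derive s 1 F (f s (x s)).
  by move=> /andP[s1 _]; exact: dF.
have := mean_value_rV c1 dF' (fun s _ => fC s (x s)).
rewrite F0 subr0 (_ : x t - x0 = F (c t)); last by rewrite E addrAC subrr add0r.
  move=> /le_trans; apply.
by rewrite ler_wpM2l// lerBlDl.
Qed.

End Ode.

(** * Charts and C^1 curves *)

Lemma continuous_at_pair (T U V : topologicalType) (f : T -> U) (g : T -> V) x :
  {for x, continuous f} -> {for x, continuous g} ->
  {for x, continuous (fun y => (f y, g y))}.
Proof. by move=> cf cg; exact: cvg_pair. Qed.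

Section NearReal.
Variable R : realType.

(* [R] and [R^o] carry convertible topologies through different canonical
   paths; these instances let filter reasoning at [R] use facts at [R^o]. *)
Lemma C1_at_nearR (F : normedModType R) (h : R^o -> F) (t : R) :
  C1_at h t -> \forall s \near t, C1_at h s.
Proof. by move=> /C1_at_near. Qed.

Lemma nearR_join (P : R -> Prop) (t : R) :
  (\forall s \near t, P s) -> \forall s \near t, \forall u \near s, P u.
Proof. by move=> Pt; exact: near_join Pt. Qed.

End NearReal.

Section Charts.
Variable R : realType.
Implicit Types M N Q : manifoldType R.

Lemma chart_exists M (p : M) : exists phi, chart_at p phi.
Proof. by have [phi ? ?] := @atlas_cover R M p; exists phi. Qed.

Lemma cdom_nbhs n (M : topologicalType) (phi : chart R n M) p :
  cdom phi p -> nbhs p (cdom phi).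
Proof. by move=> pp; apply: open_nbhs_nbhs; split=> //; exact: cdom_open. Qed.

Lemma crng_nbhs n (M : topologicalType) (phi : chart R n M) x :
  crng phi x -> nbhs x (crng phi).
Proof. by move=> px; apply: open_nbhs_nbhs; split=> //; exact: crng_open. Qed.

Lemma cmap_crng n (M : topologicalType) (phi : chart R n M) p :
  cdom phi p -> crng phi (cmap phi p).
Proof. by move=> pp; exists p. Qed.

Lemma cinv_cmap n (M : topologicalType) (phi : chart R n M) p :
  cdom phi p -> cinv phi (cmap phi p) = p.
Proof. by move=> /mem_set/cmapK. Qed.

Lemma cinv_cdom n (M : topologicalType) (phi : chart R n M) x :
  crng phi x -> cdom phi (cinv phi x).
Proof. by move=> [p pp <-]; rewrite cinv_cmap. Qed.

Lemma cmap_cinv n (M : topologicalType) (phi : chart R n M) x :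
  crng phi x -> cmap phi (cinv phi x) = x.
Proof. by move=> [p pp <-]; rewrite cinv_cmap. Qed.

Lemma cmap_continuous n (M : topologicalType) (phi : chart R n M) p :
  cdom phi p -> {for p, continuous (cmap phi)}.
Proof. by move=> /mem_set; exact: cmap_cont. Qed.

Lemma cinv_continuous n (M : topologicalType) (phi : chart R n M) x :
  crng phi x -> {for x, continuous (cinv phi)}.
Proof. by move=> /mem_set; exact: cinv_cont. Qed.

Lemma nbhs_chart n (M : topologicalType) (phi : chart R n M) p (A : set M) :
  cdom phi p -> nbhs p A ->
  nbhs (cmap phi p) (crng phi `&` cinv phi @^-1` A).
Proof.
move=> pp pA; apply: filterI; first exact/crng_nbhs/cmap_crng.
by apply: (cinv_continuous (cmap_crng pp)); rewrite cinv_cmap.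
Qed.

Lemma Ckm_continuous (E : normedModType R) M k (W : set E) (g : E -> M) x :
  Ckm k W g -> nbhs x W -> {for x, continuous g}.
Proof. by move=> [cg _] /nbhs_singleton Wx; apply: cg; exact/mem_set. Qed.

Lemma Ckm_chart_nbhs (E : normedModType R) M k (W : set E) (g : E -> M) x
    (phi : chart R (@mdim R M) M) :
  Ckm k W g -> nbhs x W -> cdom phi (g x) ->
  nbhs x (W `&` g @^-1` cdom phi).
Proof.
move=> cg xW /cdom_nbhs gx; apply: filterI => //.
exact: (Ckm_continuous cg xW).
Qed.

Lemma Ck1_nbhs_C1_at (E F : normedModType R) (W : set E) (h : E -> F) x :
  Ck 1 W h -> nbhs x W -> C1_at h x.
Proof.
move=> /Ck1_at H xW; apply: C1_at_intro.
by apply: filterS xW => y /H.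
Qed.

Lemma Ckm1_C1_at (E : normedModType R) M (W : set E) (g : E -> M) x phi :
  Ckm 1 W g -> nbhs x W -> chart_at (g x) phi -> C1_at (cmap phi \o g) x.
Proof.
move=> cg xW [pa pg]; have H := Ckm_chart_nbhs cg xW pg.
by apply: Ck1_nbhs_C1_at H; exact: cg.2.
Qed.

Lemma Ckm2_C1_at (E : normedModType R) M (W : set E) (g : E -> M) x phi v :
  Ckm 2 W g -> nbhs x W -> chart_at (g x) phi ->
  C1_at ('D_v (cmap phi \o g)) x.
Proof.
move=> cg xW [pa pg]; have H := Ckm_chart_nbhs cg xW pg.
apply: Ck1_nbhs_C1_at H; have [_ /(_ phi pa)[_]] := cg; exact.
Qed.

Lemma C1_at_transition M (p : M) phi psi :
  chart_at p phi -> chart_at p psi ->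
  C1_at (cmap psi \o cinv phi) (cmap phi p).
Proof.
move=> [pa pp] [qa qp].
apply: (@Ck1_nbhs_C1_at _ _ (crng phi `&` cinv phi @^-1` cdom psi)).
  exact: atlas_compat.
by apply: nbhs_chart => //; exact: cdom_nbhs.
Qed.

Definition C1_map_at M N (F : M -> N) (p : M) : Prop :=
  {for p, continuous F} /\
  forall phi psi, chart_at p phi -> chart_at (F p) psi ->
    C1_at (cmap psi \o F \o cinv phi) (cmap phi p).

Definition C1_map2_at M N Q (F : M -> N -> Q) (p : M) (q : N) : Prop :=
  {for (p, q), continuous (fun x => F x.1 x.2)} /\
  forall phi phi' psi, chart_at p phi -> chart_at q phi' ->
    chart_at (F p q) psi ->
    C1_at (fun x => cmap psi (F (cinv phi x.1) (cinv phi' x.2)))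
      (cmap phi p, cmap phi' q).

Lemma smooth_on_C1_map_at M N (U : set M) (F : M -> N) p :
  smooth_on U F -> nbhs p U -> C1_map_at F p.
Proof.
move=> sF pU; split=> [|phi psi pc qc].
  have [phi [pa pp]] := chart_exists p.
  have c := Ckm_continuous (sF phi pa 1%N) (nbhs_chart pp pU).
  apply: (@near_eq_continuous_at _ _ ((F \o cinv phi) \o cmap phi)).
    by apply: filterS (cdom_nbhs pp) => q qp /=; rewrite cinv_cmap.
  by apply: continuous_comp; [exact: cmap_continuous|exact: c].
have [pa pp] := pc.
apply: (Ckm1_C1_at (sF phi pa 1%N) (nbhs_chart pp pU)).
by rewrite /= cinv_cmap.
Qed.

Lemma smooth2_nbhs M N (U : set M) (V : set N) p q phi phi' :
  nbhs p U -> nbhs q V -> chart_at p phi -> chart_at q phi' ->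
  nbhs (cmap phi p, cmap phi' q)
    ((crng phi `&` cinv phi @^-1` U) `*` (crng phi' `&` cinv phi' @^-1` V)).
Proof.
move=> pU qV [_ pp] [_ qq].
exists (crng phi `&` cinv phi @^-1` U, crng phi' `&` cinv phi' @^-1` V) => //.
by split; exact: nbhs_chart.
Qed.

Lemma smooth2_on_C1_map2_at M N Q (U : set M) (V : set N) (F : M -> N -> Q) p q :
  smooth2_on U V F -> nbhs p U -> nbhs q V -> C1_map2_at F p q.
Proof.
move=> sF pU qV; split=> [|phi phi' psi pc qc rc].
  have [phi pc] := chart_exists p; have [phi' qc] := chart_exists q.
  have c := Ckm_continuous (sF phi phi' pc.1 qc.1 1%N) (smooth2_nbhs pU qV pc qc).
  apply: (@near_eq_continuous_at _ _
    ((fun x => F (cinv phi x.1) (cinv phi' x.2)) \o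
     (fun x => (cmap phi x.1, cmap phi' x.2)))).
    exists (cdom phi, cdom phi') => /=.
      by split; apply: cdom_nbhs; [exact: pc.2|exact: qc.2].
    by move=> x [/= ? ?]; rewrite !cinv_cmap.
  apply: continuous_comp; last exact: c.
  apply: continuous_at_pair.
    by apply: (@continuous_comp _ _ _ fst (cmap phi));
      [exact: cvg_fst|apply: cmap_continuous; exact: pc.2].
  by apply: (@continuous_comp _ _ _ snd (cmap phi'));
    [exact: cvg_snd|apply: cmap_continuous; exact: qc.2].
apply: (Ckm1_C1_at (sF phi phi' pc.1 qc.1 1%N) (smooth2_nbhs pU qV pc qc)).
by rewrite /= (cinv_cmap pc.2) (cinv_cmap qc.2).
Qed.

Lemma C1_at_pairl (E F : normedModType R) (y : F) (x : E) :
  C1_at (fun x => (x, y)) x.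
Proof. by apply: C1_at_pair; [exact: C1_at_id|exact: C1_at_cst]. Qed.

Lemma C1_at_pairr (E F : normedModType R) (x : E) (y : F) :
  C1_at (fun y => (x, y)) y.
Proof. by apply: C1_at_pair; [exact: C1_at_cst|exact: C1_at_id]. Qed.

Lemma finite_coordinates_rV2 m n :
  finite_coordinates ('rV[R]_m * 'rV[R]_n : normedModType R)%type.
Proof. by apply: finite_coordinates_prod; exact: finite_coordinates_rV. Qed.

Lemma C1_map2_atl M N Q (F : M -> N -> Q) p q :
  C1_map2_at F p q -> C1_map_at (F ^~ q) p.
Proof.
move=> [cF sF]; split=> [|phi psi pc rc].
  apply: (@continuous_comp _ _ _ (fun x => (x, q)) (fun x => F x.1 x.2)).
    by apply: continuous_at_pair; [exact: cvg_id|exact: cvg_cst].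
  exact: cF.
have [phi' qc] := chart_exists q.
apply: (@near_eq_C1_at _ _ _
  ((fun x => cmap psi (F (cinv phi x.1) (cinv phi' x.2))) \o
   (fun x => (x, cmap phi' q)))).
  by near=> x => /=; rewrite cinv_cmap//; exact: qc.2.
apply: C1_at_comp; [exact: finite_coordinates_rV2|exact: C1_at_pairl|exact: sF].
Unshelve. all: by end_near. Qed.

Lemma C1_map2_atr M N Q (F : M -> N -> Q) p q :
  C1_map2_at F p q -> C1_map_at (F p) q.
Proof.
move=> [cF sF]; split=> [|phi' psi qc rc].
  apply: (@continuous_comp _ _ _ (fun x => (p, x)) (fun x => F x.1 x.2)).
    by apply: continuous_at_pair; [exact: cvg_cst|exact: cvg_id].
  exact: cF.
have [phi pc] := chart_exists p.
apply: (@near_eq_C1_at _ _ _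
  ((fun x => cmap psi (F (cinv phi x.1) (cinv phi' x.2))) \o
   (fun x => (cmap phi p, x)))).
  by near=> x => /=; rewrite cinv_cmap//; exact: pc.2.
apply: C1_at_comp; [exact: finite_coordinates_rV2|exact: C1_at_pairr|exact: sF].
Unshelve. all: by end_near. Qed.

End Charts.

(** * Curves of class C^1 in a manifold *)

Section C1Curves.
Variable R : realType.
Implicit Types M N Q : manifoldType R.

(** Convertible to [C1germ] at [Ckm 1], so facts on these curves apply directly to the pieces of a
    piecewise curve. *)
Definition C1_curve_at M (f : R -> M) (t : R) : Prop :=
  exists U : set R^o, [/\ open U, U t & Ckm 1 U (f : R^o -> M)].

Lemma C1_curve_near M (f : R -> M) (t : R) :
  C1_curve_at f t -> \forall s \near t, C1_curve_at f s.
Proof.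
move=> [U [oU Ut cf]]; apply: filterS (open_nbhs_nbhs (conj oU Ut)) => s Us.
by exists U.
Qed.

Lemma C1_curve_continuous M (f : R -> M) (t : R) :
  C1_curve_at f t -> {for t, continuous f}.
Proof. by move=> [U [_ Ut [cf _]]]; apply: cf; exact/mem_set. Qed.

Lemma C1_curve_chart M (f : R -> M) (t : R) phi :
  C1_curve_at f t -> chart_at (f t) phi ->
  C1_at (cmap phi \o f : R^o -> _) (t : R^o).
Proof.
move=> [U [oU Ut cf]] pc; apply: (Ckm1_C1_at cf) pc.
exact: open_nbhs_nbhs.
Qed.

(** [Ckm] tests all charts of the atlas; one chart is enough since transition maps are C^1.
    Continuity is a separate hypothesis because a chart map takes arbitrary values off its
    domain. *)
Lemma C1_curve_intro M (f : R -> M) (t : R) phi :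
  (\forall s \near t, {for s, continuous f}) -> chart_at (f t) phi ->
  C1_at (cmap phi \o f : R^o -> _) (t : R^o) -> C1_curve_at f t.
Proof.
move=> cf [pa pp] c1.
pose A := [set s : R^o | [/\ {for s, continuous f}, cdom phi (f s) &
  C1_at (cmap phi \o f : R^o -> _) s]].
exists (interior A); split.
- exact: open_interior.
- near=> s; split.
  + by near: s.
  + near: s; apply: (nbhs_singleton cf); exact: cdom_nbhs.
  + by near: s; exact: C1_at_nearR.
- split=> [s /set_mem /interior_subset[]//|psi qa].
  apply: C1_at_Ck1 => s [/interior_subset [cs ps c1s] qs].
  apply: (@near_eq_C1_at _ _ _ ((cmap psi \o cinv phi) \o (cmap phi \o f))).
    have : nbhs s (f @^-1` cdom phi) by apply: cs; exact: cdom_nbhs.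
    by apply: filterS => u pu /=; rewrite cinv_cmap.
  apply: C1_at_comp; [exact: finite_coordinates_rV|exact: c1s|].
  exact: C1_at_transition.
Unshelve. all: by end_near. Qed.

Lemma near_eq_C1_curve M (f g : R -> M) t :
  (\forall s \near t, f s = g s) -> C1_curve_at f t -> C1_curve_at g t.
Proof.
move=> fg cf; have [phi pc] := chart_exists (g t).
apply: (C1_curve_intro _ pc).
  near=> s; apply: (@near_eq_continuous_at _ _ f).
    by near: s; exact: nearR_join.
  by apply: C1_curve_continuous; near: s; exact: C1_curve_near.
apply: (@near_eq_C1_at _ _ _ (cmap phi \o f)).
  by apply: filterS fg => s /= ->.
by apply: C1_curve_chart => //; rewrite (nbhs_singleton fg).
Unshelve. all: by end_near. Qed.

Lemma C1_curve_cst M (p : M) (t : R) : C1_curve_at (fun=> p) t.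
Proof.
have [phi pc] := chart_exists p.
apply: (C1_curve_intro _ pc); first by near=> s; exact: cvg_cst.
exact: C1_at_cst.
Unshelve. all: by end_near. Qed.

Lemma C1_curve_reparam M (f : R -> M) (phi : R^o -> R^o) (t : R) :
  C1_at phi t -> C1_curve_at f (phi t) -> C1_curve_at (f \o phi) t.
Proof.
move=> cp cf; have [psi pc] := chart_exists (f (phi t)).
apply: (C1_curve_intro _ pc).
  near=> s; apply: continuous_comp.
    by apply: C1_at_continuous; near: s; exact: C1_at_nearR.
  apply: C1_curve_continuous; near: s.
  by apply: (C1_at_continuous cp); exact: C1_curve_near.
apply: (C1_at_comp (g := cmap psi \o f)); first exact: finite_coordinates_R.
  exact: cp.
exact: C1_curve_chart.
Unshelve. all: by end_near. Qed.

Lemma C1_curve_cinv M (phi : chart R (@mdim R M) M) (x : R^o -> 'rV[R]_(@mdim R M))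
    (t : R) :
  atlas phi -> C1_at x t -> crng phi (x t) -> C1_curve_at (cinv phi \o x) t.
Proof.
move=> pa cx px.
have pc : chart_at ((cinv phi \o x) t) phi by split=> //; exact: cinv_cdom.
have pxn : \forall s \near t, crng phi (x s).
  by apply: (C1_at_continuous cx); exact: crng_nbhs.
apply: (C1_curve_intro _ pc).
  near=> s; apply: continuous_comp.
    by apply: C1_at_continuous; near: s; exact: C1_at_nearR.
  by apply: cinv_continuous; near: s.
apply: near_eq_C1_at cx; apply: filterS pxn => s ps /=.
by rewrite cmap_cinv.
Unshelve. all: by end_near. Qed.

Lemma C1_curve_map M N (F : M -> N) (f : R -> M) (t : R) :
  (\forall p \near f t, C1_map_at F p) -> C1_curve_at f t ->
  C1_curve_at (F \o f) t.
Proof.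
move=> sF cf; have [psi pc] := chart_exists (F (f t)).
have [phi qc] := chart_exists (f t).
have sFt : \forall s \near t, C1_map_at F (f s).
  exact: (C1_curve_continuous cf).
apply: (C1_curve_intro _ pc).
  near=> s; apply: continuous_comp.
    by apply: C1_curve_continuous; near: s; exact: C1_curve_near.
  by suff [] : C1_map_at F (f s) by []; near: s.
apply: (@near_eq_C1_at _ _ _ ((cmap psi \o F \o cinv phi) \o (cmap phi \o f))).
  have : nbhs t (f @^-1` cdom phi).
    by apply: (C1_curve_continuous cf); apply: cdom_nbhs; exact: qc.2.
  by apply: filterS => s ps /=; rewrite cinv_cmap.
apply: C1_at_comp; [exact: finite_coordinates_rV|exact: C1_curve_chart|].
by have [_] := nbhs_singleton sF; apply.
Unshelve. all: by end_near. Qed.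

Lemma C1_curve_map2 M N Q (F : M -> N -> Q) (f : R -> M) (g : R -> N) (t : R) :
  (\forall p \near f t & q \near g t, C1_map2_at F p q) ->
  C1_curve_at f t -> C1_curve_at g t ->
  C1_curve_at (fun s => F (f s) (g s)) t.
Proof.
move=> sF cf cg; have [psi pc] := chart_exists (F (f t) (g t)).
have [phi fc] := chart_exists (f t); have [phi' gc] := chart_exists (g t).
have cfg : {for t, continuous (fun s => (f s, g s))}.
  by apply: continuous_at_pair; exact: C1_curve_continuous.
have sFt : \forall s \near t, C1_map2_at F (f s) (g s) by exact: cfg sF.
apply: (C1_curve_intro _ pc).
  near=> s.
  apply: (@continuous_comp _ _ _ (fun s => (f s, g s)) (fun x => F x.1 x.2)).
    apply: continuous_at_pair; apply: C1_curve_continuous; near: s; exact: C1_curve_near.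
  by suff [] : C1_map2_at F (f s) (g s) by []; near: s.
apply: (@near_eq_C1_at _ _ _
  ((fun x => cmap psi (F (cinv phi x.1) (cinv phi' x.2))) \o
   (fun s => (cmap phi (f s), cmap phi' (g s))))).
  have : nbhs t (f @^-1` cdom phi).
    by apply: (C1_curve_continuous cf); apply: cdom_nbhs; exact: fc.2.
  have : nbhs t (g @^-1` cdom phi').
    by apply: (C1_curve_continuous cg); apply: cdom_nbhs; exact: gc.2.
  by apply: filterS2 => s ps ps' /=; rewrite !cinv_cmap.
apply: C1_at_comp; [exact: finite_coordinates_rV2| |].
  by apply: C1_at_pair; exact: C1_curve_chart.
by have [_] := nbhs_singleton sFt; apply.
Unshelve. all: by end_near. Qed.

End C1Curves.

(** * Velocities and the connection form *)

Section Velocity.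
Variable R : realType.
Implicit Types M N Q : manifoldType R.

Lemma derive_pairl (E F : normedModType R) (x v : E) (y : F) :
  'D_v (fun x => (x, y)) x = (v, 0).
Proof.
have dx : differentiable id x by [].
rewrite (@derive_pair R E E F id (cst y) x v dx (differentiable_cst _ _)).
by rewrite derive_id derive_cst.
Qed.

Lemma derive_pairr (E F : normedModType R) (x : E) (y v : F) :
  'D_v (fun y => (x, y)) y = (0, v).
Proof.
have dx : differentiable id y by [].
rewrite (@derive_pair R F E F (cst x) id y v (differentiable_cst _ _) dx).
by rewrite derive_id derive_cst.
Qed.

Lemma tangent_ext M (p : M) (v w : tangent p) :
  (forall phi, v phi = w phi) -> v = w.
Proof.
case: v w => [v v1 v2] [w w1 w2] /= /funext vw.
by rewrite -vw in w1 w2 *; congr Tangent; exact: Prop_irrelevance.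
Qed.

Lemma tangent_chart_ext M (p : M) (v w : tangent p) phi :
  chart_at p phi -> v phi = w phi -> v = w.
Proof.
move=> pc vw; apply: tangent_ext => psi.
have [qc|nqc] := pselect (chart_at p psi); last by rewrite !tcoord_out.
by rewrite !(tcoord_trans _ pc qc) vw.
Qed.

(** The base point is an index of its own, tied to [f t] by an equation, so that velocities at
    points that are equal without being convertible, such as (k t)^-1 (k t) and 1, can be compared.
    Continuity is demanded because chart maps are arbitrary off their domains. *)
Definition velocity_at M (f : R -> M) (t : R) (p : M) (v : tangent p) : Prop :=
  [/\ f t = p, {for t, continuous f} & forall phi, chart_at p phi ->
      is_derive (t : R^o) 1 (cmap phi \o f : R^o -> _) (v phi)].

Lemma velocity_unique M (f : R -> M) t p (v w : tangent p) :
  velocity_at f t v -> velocity_at f t w -> v = w.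
Proof.
move=> [_ _ fv] [_ _ fw]; have [phi pc] := chart_exists p.
apply: (tangent_chart_ext pc).
by have [_ <-] := fv _ pc; have [_ <-] := fw _ pc.
Qed.

Lemma near_eq_velocity M (f g : R -> M) t p (v : tangent p) :
  (\forall s \near t, f s = g s) -> velocity_at f t v -> velocity_at g t v.
Proof.
move=> fg [ft cf fv]; split; first by rewrite -(nbhs_singleton fg).
  exact: near_eq_continuous_at fg cf.
move=> phi pc; apply: near_eq_is_derive (fv phi pc).
by apply: filterS fg => s /= ->.
Qed.

Lemma near_chart M (f : R -> M) (t : R) (phi : chart R (@mdim R M) M) :
  {for t, continuous f} -> cdom phi (f t) ->
  \forall s \near t, cinv phi (cmap phi (f s)) = f s.
Proof.
move=> cf pp; have : nbhs t (f @^-1` cdom phi) by apply: cf; exact: cdom_nbhs.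
by apply: filterS => s ps; rewrite cinv_cmap.
Qed.

(** The derivatives in the various charts form one tangent vector: the transition law is the chain
    rule. *)
Lemma velocity_exists M (f : R -> M) (t : R) : {for t, continuous f} ->
  (forall phi, chart_at (f t) phi ->
     derivable (cmap phi \o f : R^o -> _) (t : R^o) 1) ->
  exists v : tangent (f t), velocity_at f t v.
Proof.
move=> cf df.
pose v phi : 'rV[R]_(@mdim R M) :=
  if pselect (chart_at (f t) phi) is left _
  then 'D_1 (cmap phi \o f : R^o -> _) (t : R^o) else 0.
have vE phi : chart_at (f t) phi ->
    v phi = 'D_1 (cmap phi \o f : R^o -> _) (t : R^o).
  by rewrite /v; case: pselect.
have v1 phi psi : chart_at (f t) phi -> chart_at (f t) psi ->
    v psi = 'D_(v phi) (cmap psi \o cinv phi) (cmap phi (f t)).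
  move=> pc qc; rewrite (vE _ pc) (vE _ qc).
  have dpf := (derivable1_diffP _ _).1 (df _ pc).
  have dpp := C1_at_differentiable (C1_at_transition pc qc).
  rewrite -(@derive_comp R R^o _ _ _ _ (t : R^o) 1 dpf dpp).
  apply: near_eq_derive; have := near_chart cf pc.2.
  by apply: filterS => s /= ->.
have v2 phi : ~ chart_at (f t) phi -> v phi = 0.
  by rewrite /v; case: pselect.
exists (Tangent v1 v2); split=> // phi pc; rewrite /= vE//.
exact/derivableP/df.
Qed.

Lemma C1_curve_velocity M (f : R -> M) (t : R) :
  C1_curve_at f t -> exists v : tangent (f t), velocity_at f t v.
Proof.
move=> cf; apply: velocity_exists; first exact: C1_curve_continuous.
move=> phi pc; apply/derivable1_diffP; apply: C1_at_differentiable.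
exact: C1_curve_chart.
Qed.

Lemma velocity_differentiable M (f : R -> M) (t : R) p (v : tangent p) phi :
  velocity_at f t v -> chart_at p phi ->
  differentiable (cmap phi \o f : R^o -> _) (t : R^o).
Proof.
by move=> [_ _ fv] /fv [] /derivable1_diffP.
Qed.

Lemma velocity_derive M (f : R -> M) (t : R) p (v : tangent p) phi :
  velocity_at f t v -> chart_at p phi ->
  'D_1 (cmap phi \o f : R^o -> _) (t : R^o) = v phi.
Proof. by move=> [_ _ fv] /fv []. Qed.

Lemma velocity_push M N (F : M -> N) (f : R -> M) (t : R) p (v : tangent p) :
  C1_map_at F p -> velocity_at f t v ->
  exists w : tangent (F p), velocity_at (F \o f) t w /\ is_push F v w.
Proof.
move=> [cF sF] fv; have [ft cf _] := fv; move: ft v fv cF sF => <- v fv cF sF.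
have D phi psi : chart_at (f t) phi -> chart_at (F (f t)) psi ->
    is_derive (t : R^o) 1 (cmap psi \o (F \o f) : R^o -> _)
      ('D_(v phi) (cmap psi \o F \o cinv phi) (cmap phi (f t))).
  move=> pc qc; have dpf := velocity_differentiable fv pc.
  have dF := C1_at_differentiable (sF _ _ pc qc).
  have E : \forall s \near (t : R^o), ((cmap psi \o F \o cinv phi) \o
      (cmap phi \o f)) s = (cmap psi \o (F \o f)) s.
    by have := near_chart cf pc.2; apply: filterS => s /= ->.
  apply: (near_eq_is_derive E); split.
    exact/derivable1_diffP/differentiable_comp.
  by rewrite (@derive_comp R R^o _ _ _ _ (t : R^o) 1 dpf dF)
    (velocity_derive fv pc).
have [phi0 pc0] := chart_exists (f t).
have [||w Fw] := @velocity_exists _ (F \o f) t.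
- exact: continuous_comp cf cF.
- by move=> psi qc; have [] := D phi0 psi pc0 qc.
exists w; split=> //; split=> // phi psi pc qc.
by rewrite -(velocity_derive Fw qc); have [_ ->] := D phi psi pc qc.
Qed.

(** The direction (v, w) splits as (v, 0) + (0, w), and each summand is seen by F with the other
    variable frozen. *)
Lemma velocity_product M N Q (F : M -> N -> Q) (f : R -> M) (g : R -> N) (t : R)
    p q (v : tangent p) (w : tangent q) :
  C1_map2_at F p q -> velocity_at f t v -> velocity_at g t w ->
  exists u u1 u2 : tangent (F p q),
    [/\ velocity_at (fun s => F (f s) (g s)) t u,
        velocity_at (fun s => F (f s) q) t u1 /\ is_push (F ^~ q) v u1,
        velocity_at (fun s => F p (g s)) t u2 /\ is_push (F p) w u2 &
        forall psi, u psi = u1 psi + u2 psi].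
Proof.
move=> cF fv gw.
have [u1 [Fu1 Pu1]] := velocity_push (C1_map2_atl cF) fv.
have [u2 [Fu2 Pu2]] := velocity_push (C1_map2_atr cF) gw.
have [ft cf _] := fv; have [gt cg _] := gw; subst p q.
have D psi : chart_at (F (f t) (g t)) psi ->
    is_derive (t : R^o) 1 (cmap psi \o (fun s => F (f s) (g s)) : R^o -> _)
      (u1 psi + u2 psi).
  move=> rc; have [phi pc] := chart_exists (f t).
  have [phi' qc] := chart_exists (g t).
  have df := velocity_differentiable fv pc.
  have dg := velocity_differentiable gw qc.
  pose Phi (x : 'rV[R]_(@mdim R M) * 'rV[R]_(@mdim R N)) :=
    cmap psi (F (cinv phi x.1) (cinv phi' x.2)).
  have dPhi : differentiable Phi (cmap phi (f t), cmap phi' (g t)).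
    by apply: C1_at_differentiable; have [_] := cF; apply.
  have E : \forall s \near (t : R^o),
      (Phi \o (fun s : R^o => ((cmap phi \o f) s, (cmap phi' \o g) s))) s =
      (cmap psi \o (fun s => F (f s) (g s))) s.
    have := near_chart cf pc.2; have := near_chart cg qc.2.
    by apply: filterS2 => s; rewrite /Phi /= => -> ->.
  have dfg := differentiable_pair df dg.
  apply: (near_eq_is_derive E); split.
    exact/derivable1_diffP/differentiable_comp.
  rewrite (@derive_comp R R^o _ _ _ _ (t : R^o) 1 dfg dPhi).
  rewrite (@derive_pair R R^o _ _ _ _ (t : R^o) 1 df dg)
    (velocity_derive fv pc) (velocity_derive gw qc).
  have -> : (v phi, w phi') = (v phi, 0) + (0, w phi').
    by apply: injective_projections; rewrite /= ?addr0 ?add0r.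
  rewrite (deriveE _ dPhi) linearD -!(deriveE _ dPhi); congr (_ + _).
    rewrite (Pu1.2 phi psi pc rc).
    transitivity ('D_(v phi) (Phi \o (fun x => (x, cmap phi' (g t))))
                    (cmap phi (f t))).
      have dl := C1_at_differentiable (C1_at_pairl (cmap phi' (g t)) (cmap phi (f t))).
      by rewrite (@derive_comp R _ _ _ _ Phi _ (v phi) dl dPhi) derive_pairl.
    apply: near_eq_derive; near=> x.
    by rewrite /Phi /= (cinv_cmap qc.2).
  rewrite (Pu2.2 phi' psi qc rc).
  transitivity ('D_(w phi') (Phi \o (fun x => (cmap phi (f t), x)))
                  (cmap phi' (g t))).
    have dl := C1_at_differentiable (C1_at_pairr (cmap phi (f t)) (cmap phi' (g t))).
    by rewrite (@derive_comp R _ _ _ _ Phi _ (w phi') dl dPhi) derive_pairr.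
  apply: near_eq_derive; near=> x.
  by rewrite /Phi /= (cinv_cmap pc.2).
have [||u Fu] := @velocity_exists _ (fun s => F (f s) (g s)) t.
- apply: (@continuous_comp _ _ _ (fun s => (f s, g s)) (fun x => F x.1 x.2)).
    exact: continuous_at_pair.
  exact: cF.1.
- by move=> psi /D[].
exists u, u1, u2; split=> // psi.
have [rc|nrc] := pselect (chart_at (F (f t) (g t)) psi); last first.
  by rewrite !tcoord_out// addr0.
by rewrite -(velocity_derive Fu rc); have [_ ->] := D psi rc.
Unshelve. all: by end_near. Qed.

Lemma velocity_reparam M (f : R -> M) (phi : R^o -> R^o) (s : R) (d : R)
    p (v : tangent p) :
  is_derive (s : R^o) 1 phi d -> velocity_at f (phi s) v ->
  exists w : tangent p, velocity_at (f \o phi) s w /\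
    forall psi, w psi = d *: v psi.
Proof.
move=> [dphi Dphi] fv; have [ft cf _] := fv; subst p.
have dphi' : differentiable phi (s : R^o) by exact/derivable1_diffP.
have D psi : chart_at (f (phi s)) psi ->
    is_derive (s : R^o) 1 (cmap psi \o (f \o phi) : R^o -> _) (d *: v psi).
  move=> pc; have df := velocity_differentiable fv pc.
  split; first exact/derivable1_diffP/(differentiable_comp dphi' df).
  rewrite (@derive_comp R R^o _ _ _ _ (s : R^o) 1 dphi' df) Dphi.
  rewrite -(velocity_derive fv pc) !(deriveE _ df) -linearZ; congr ('d _ _ _).
  by rewrite /GRing.scale /= mulr1.
have [||w Fw] := @velocity_exists _ (f \o phi) s.
- exact: continuous_comp (differentiable_continuous dphi') cf.
- by move=> psi /D[].
exists w; split=> // psi.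
have [rc|nrc] := pselect (chart_at (f (phi s)) psi); last first.
  by rewrite !tcoord_out// scaler0.
by rewrite -(velocity_derive Fw rc); have [_ ->] := D psi rc.
Qed.

Lemma C1_curve_chart_line M (p : M) phi (c : 'rV[R]_(@mdim R M)) :
  chart_at p phi ->
  C1_curve_at (cinv phi \o (fun s : R^o => s *: c + cmap phi p)) 0.
Proof.
move=> pc; apply: C1_curve_cinv; first exact: pc.1.
  apply: C1_at_intro; near=> s; have [ds Ds] := is_derive_line (cmap phi p) c s.
  split=> [|v]; first exact/derivable1_diffP.
  rewrite (_ : 'D_v _ = cst (v *: c)); first exact: cst_continuous.
  apply/funext => u; have [du Du] := is_derive_line (cmap phi p) c u.
  have du' := (derivable1_diffP _ _).1 du.
  by rewrite (deriveE _ du') -[v in 'd _ _ v]mulr1 linearZ -(deriveE _ du') Du.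
by rewrite scale0r add0r; exact: cmap_crng pc.2.
Unshelve. all: by end_near. Qed.

(** A straight line in the chart realizes any coordinate vector; as a velocity, it obeys the
    transition law automatically. *)
Lemma chart_line_velocity M (p : M) phi (c : 'rV[R]_(@mdim R M)) :
  chart_at p phi -> exists v : tangent p,
    velocity_at (cinv phi \o (fun s : R^o => s *: c + cmap phi p)) 0 v /\
    v phi = c.
Proof.
move=> pc; have [v fv] := C1_curve_velocity (C1_curve_chart_line c pc).
have E : (cinv phi \o (fun s : R^o => s *: c + cmap phi p)) 0 = p.
  by rewrite /= scale0r add0r cinv_cmap//; exact: pc.2.
move: v fv; rewrite E => v fv; exists v; split=> //.
rewrite -(velocity_derive fv pc).
have [d0 D1] := is_derive_line (cmap phi p) c (0 : R^o).
rewrite -[RHS]D1; apply: near_eq_derive.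
have : \forall s \near (0 : R^o), crng phi (s *: c + cmap phi p).
  have c0 := differentiable_continuous ((derivable1_diffP _ _).1 d0).
  by apply: c0; rewrite scale0r add0r; apply/crng_nbhs/cmap_crng; exact: pc.2.
by apply: filterS => s ps /=; rewrite cmap_cinv.
Qed.

Lemma tangent_with_coordinates M (p : M) phi (c : 'rV[R]_(@mdim R M)) :
  chart_at p phi -> exists v : tangent p, v phi = c.
Proof. by move=> /(chart_line_velocity c)[v [_ vE]]; exists v. Qed.

Lemma tangent_is_velocity M (p : M) (v : tangent p) :
  exists f : R -> M, velocity_at f 0 v.
Proof.
have [phi pc] := chart_exists p.
have [w [fw wE]] := chart_line_velocity (v phi) pc.
rewrite -(tangent_chart_ext pc wE).
by exists (cinv phi \o (fun s : R^o => s *: v phi + cmap phi p)).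
Qed.

Lemma tangent0_exists M (p : M) : exists v : tangent p, forall phi, v phi = 0.
Proof.
have [phi pc] := chart_exists p.
have [v v0] := tangent_with_coordinates 0 pc.
exists v => psi; have [qc|nqc] := pselect (chart_at p psi).
  by rewrite (tcoord_trans _ pc qc) v0 derive0.
exact: tcoord_out.
Qed.

Lemma tangent_sum_exists M (p : M) n (c : 'I_n -> R) (u : 'I_n -> tangent p) :
  exists w : tangent p, forall phi, w phi = \sum_i c i *: u i phi.
Proof.
have [phi pc] := chart_exists p.
have [w wE] := tangent_with_coordinates (\sum_i c i *: u i phi) pc.
exists w => psi; have [qc|nqc] := pselect (chart_at p psi); last first.
  by rewrite tcoord_out// big1// => i _; rewrite tcoord_out// scaler0.
rewrite (tcoord_trans _ pc qc) wE derive_sum_dir.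
  by apply: eq_bigr => i _; rewrite (tcoord_trans _ pc qc).
exact: C1_at_differentiable (C1_at_transition pc qc).
Qed.

(** These are the vector fields that [cform_smooth] tests; off the chart domain any vector will
    do. *)
Lemma coordinate_field M phi (c : 'rV[R]_(@mdim R M)) : (@atlas R M) phi ->
  exists X : forall p : M, tangent p, forall p, cdom phi p -> X p phi = c.
Proof.
move=> pa; suff H : forall p : M, exists v : tangent p, cdom phi p -> v phi = c.
  by exists (fun p => sval (cid (H p))) => p; exact: svalP (cid (H p)).
move=> p; have [pp|npp] := pselect (cdom phi p).
  by have [v vE] := @tangent_with_coordinates M p phi c (conj pa pp); exists v.
by have [v _] := tangent0_exists p; exists v.
Qed.

Lemma is_push_fun M N (F : M -> N) (p : M) (q : N) (v : tangent p)
    (w w' : tangent q) : is_push F v w -> is_push F v w' -> w = w'.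
Proof.
move=> [_ wE] [_ wE']; have [phi pc] := chart_exists p.
have [psi qc] := chart_exists q.
by apply: (tangent_chart_ext qc); rewrite (wE _ _ pc qc) (wE' _ _ pc qc).
Qed.

End Velocity.

(** * The connection form along a curve *)

Section ConnectionForm.
Variables (R : realType) (G : lieGroupType R) (P M : manifoldType R).
Variables (B : principal_bundle G P M) (A : connection B).

Lemma cform0 (p : P) (v : tangent p) :
  (forall phi, v phi = 0) -> forall psi, cform A v psi = 0.
Proof.
(* A zero vector satisfies v = 1 v + v, so its value under A is twice itself. *)
move=> v0 psi; have := @cform_linear _ _ _ _ _ A p 1 v v v _ psi.
rewrite scale1r => H; apply: (@addrI _ (cform A v psi)); rewrite addr0 -H//.
by move=> phi; rewrite v0 scaler0 addr0.
Qed.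

Lemma cformZ (p : P) (a : R) (v w : tangent p) :
  (forall phi, w phi = a *: v phi) ->
  forall psi, cform A w psi = a *: cform A v psi.
Proof.
move=> wv psi; have [z z0] := tangent0_exists p.
rewrite (@cform_linear _ _ _ _ _ A p a v z w) ?(cform0 z0) ?addr0// => phi.
by rewrite wv z0 addr0.
Qed.

Lemma cformD (p : P) (u v w : tangent p) :
  (forall phi, w phi = u phi + v phi) ->
  forall psi, cform A w psi = cform A u psi + cform A v psi.
Proof.
move=> wE psi; rewrite (@cform_linear _ _ _ _ _ A p 1 u v w) ?scale1r// => phi.
by rewrite scale1r.
Qed.

Lemma cform_sum (p : P) n (c : 'I_n -> R) (u : 'I_n -> tangent p)
    (w : tangent p) : (forall phi, w phi = \sum_i c i *: u i phi) ->
  forall psi, cform A w psi = \sum_i c i *: cform A (u i) psi.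
Proof.
elim: n c u w => [|n IHn] c u w wE psi.
  by rewrite big_ord0 cform0// => phi; rewrite wE big_ord0.
have [w' wE'] := tangent_sum_exists (fun i => c (lift ord0 i))
  (fun i => u (lift ord0 i)).
rewrite big_ord_recl -(IHn _ _ _ wE').
by apply: cform_linear => phi; rewrite wE big_ord_recl wE'.
Qed.

(** A velocity is only an existential witness at each parameter; [a] collects the values of A on
    them into one function. Expanding the velocity in coordinate fields reduces its continuity to
    that of f' and of the coefficients of A. *)
Lemma cform_curve_continuous (f : R -> P) (t0 : R) psi : C1_curve_at f t0 ->
  chart_at (1%g : G) psi ->
  exists a : R -> 'rV[R]_(@mdim R G),
    (\forall t \near t0, {for t, continuous a}) /\
    \forall t \near t0, forall p (v : tangent p),
      velocity_at f t v -> cform A v psi = a t.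
Proof.
move=> cf qc; have [phi [pa pp]] := chart_exists (f t0).
pose m := @mdim R P.
have X (i : 'I_m) := coordinate_field ('e_i : 'rV[R]_m) pa.
have {X} [X XE] : exists X : 'I_m -> forall p : P, tangent p,
    forall i p, cdom phi p -> X i p phi = 'e_i.
  by exists (fun i => sval (cid (X i))) => i; exact: svalP (cid (X i)).
pose a (t : R) := \sum_(i < m) ('D_1 (cmap phi \o f : R^o -> _) (t : R^o)) 0 i
                   *: cform A (X i (f t)) psi.
have cdom_f : \forall t \near t0, cdom phi (f t).
  by apply: (C1_curve_continuous cf); exact: cdom_nbhs.
exists a; split.
  near=> t.
  have pt : cdom phi (f t) by near: t.
  have ct : C1_curve_at f t by near: t; exact: C1_curve_near.
  apply: continuous_at_sum => i; apply: cvgZ.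
    apply: (@continuous_comp _ _ _ ('D_1 (cmap phi \o f : R^o -> _))
      (fun v => v 0 i)); last exact: coord_continuous.
    by apply: (C1_at_derive (v := (1 : R^o))); exact: C1_curve_chart.
  apply: (@near_eq_continuous_at _ _ ((fun x => cform A (X i (cinv phi x)) psi)
    \o (cmap phi \o f))).
    have := near_chart (C1_curve_continuous ct) pt.
    by apply: filterS => s /= ->.
  apply: continuous_comp.
    by apply: continuous_comp; [exact: C1_curve_continuous|exact: cmap_continuous].
  have := @cform_smooth _ _ _ _ _ A phi psi 'e_i (X i) pa qc (XE i) 0%N.
  by apply; apply/mem_set; exact: cmap_crng.
near=> t => p v fv; have pt : cdom phi (f t) by near: t.
have [ft _ _] := fv; subst p.
have pc : chart_at (f t) phi by [].
apply: cform_sum => chi.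
have [rc|nrc] := pselect (chart_at (f t) chi); last first.
  by rewrite tcoord_out// big1// => i _; rewrite tcoord_out// scaler0.
rewrite (tcoord_trans _ pc rc) (velocity_derive fv pc) [in LHS](row_sum_delta (v phi)).
rewrite derive_sum_dir; last exact: C1_at_differentiable (C1_at_transition pc rc).
by apply: eq_bigr => i _; rewrite (tcoord_trans _ pc rc) XE.
Unshelve. all: by end_near. Qed.

End ConnectionForm.

(** * A differential equation on a Lie group *)

Section GroupOde.
Variables (R : realType) (G : lieGroupType R).

Lemma mulg_C1 (x y : G) : C1_map2_at (fun x y : G => (x * y)%g) x y.
Proof.
by apply: (smooth2_on_C1_map2_at (@mulg_smooth R G)); exact: filterT.
Qed.

Lemma invg_C1 (x : G) : C1_map_at (fun x : G => x^-1%g) x.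
Proof. by apply: (smooth_on_C1_map_at (@invg_smooth R G)); exact: filterT. Qed.

(** [Y] is the left logarithmic derivative k^-1 k' at t, an element of the Lie algebra. *)
Lemma left_translation_velocity (k : R -> G) (t : R) (w : tangent (k t)) :
  velocity_at k t w ->
  exists Y : tangent (1%g : G),
    [/\ velocity_at (fun s => (k t)^-1 * k s)%g t Y,
        is_push (fun x : G => (k t)^-1 * x)%g w Y &
        is_push (fun x : G => k t * x)%g Y w].
Proof.
move=> kw.
have [Y [vY pY]] := velocity_push (C1_map2_atr (mulg_C1 (k t)^-1%g (k t))) kw.
move: Y vY pY; rewrite mulVg => Y vY pY; exists Y; split=> //.
have [w' [vw' pw']] := velocity_push (C1_map2_atr (mulg_C1 (k t) 1%g)) vY.
move: w' vw' pw'; rewrite mulg1 => w' vw' pw'.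
suff -> : w = w' by [].
apply: (velocity_unique kw); apply: near_eq_velocity vw'.
by near=> s; rewrite /= mulVKg.
Unshelve. all: by end_near. Qed.

Lemma C1_at_of_derive (F : normedModType R) (x dx : R^o -> F) (t : R) :
  (\forall s \near t, is_derive (s : R^o) 1 x (dx s) /\ {for s, continuous dx}) ->
  C1_at x t.
Proof.
move=> H; apply: C1_at_intro; near=> s.
have Hs : is_derive (s : R^o) 1 x (dx s) /\ {for s, continuous dx}.
  by near: s.
have HH : \forall u \near (s : R^o), is_derive (u : R^o) 1 x (dx u).
  have : \forall u \near s, is_derive (u : R^o) 1 x (dx u) /\ {for u, continuous dx}.
    by near: s; exact: nearR_join.
  by apply: filterS => u [].
have D u : is_derive (u : R^o) 1 x (dx u) -> differentiable x u.
  by move=> [/derivable1_diffP].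
split; first by apply: D; case: Hs.
move=> v; apply: (@near_eq_continuous_at _ _ (fun u => v *: dx u)).
  apply: filterS HH => u du; have dxu := D _ du; have [_ <-] := du.
  rewrite !(deriveE _ dxu) -linearZ; congr ('d _ _ _).
  by rewrite /GRing.scale /= mulr1.
by apply: cvgZl_tmp; case: Hs.
Unshelve. all: by end_near. Qed.

(** The contraction argument wants a right-hand side defined and bounded for all times; truncating
    the time provides one that is unchanged near [t0]. *)
Lemma clip_extension (V : normedModType R) (a : R -> V) (t0 : R) :
  (\forall t \near t0, {for t, continuous a}) ->
  exists (b : R -> V) (d K : R), [/\ 0 < d, 0 <= K, continuous b,
    forall t, `|b t| <= K & forall t, `|t - t0| <= d -> b t = a t].
Proof.
move=> ca; have [r /= r0 Hr] := (nbhs_ballP _ _).1 ca.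
pose d := r / 2; have d0 : 0 < d by rewrite divr_gt0.
have dd : t0 - d <= t0 + d by rewrite lerD2l ge0_cp// ltW.
pose b t := a (clip (t0 - d) (t0 + d) t).
have cb : continuous b.
  move=> t; apply: continuous_comp; first exact: clip_continuous.
  apply: Hr; rewrite -ball_normE /=; have /andP[h1 h2] := clip_bounds t dd.
  apply: (@le_lt_trans _ _ d); last by rewrite ltr_pdivrMr// ltr_pMr// ltr1n.
  by rewrite distrC ler_distl h1 h2.
have [|u _ Hu] := @EVT_max R (fun t => `|b t|) _ _ dd.
  by apply: continuous_subspaceT => t; apply: cvg_norm; exact: cb.
exists b, d, `|b u|; split=> // t.
  have := Hu (clip (t0 - d) (t0 + d) t).
  by rewrite in_itv/= /b (clip_id (clip_bounds t dd)); apply; exact: clip_bounds.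
by rewrite ler_distl /b => /clip_id ->.
Qed.

(** Balls of row vectors are cubes, so truncating each coordinate is a 1-Lipschitz retraction onto
    the cube of half the radius. *)
Lemma clip_rV_exists n (x0 : 'rV[R]_n) (r : R) : 0 < r ->
  exists c : 'rV[R]_n -> 'rV[R]_n,
    [/\ forall x, ball x0 r (c x),
        forall x, `|x - x0| <= r / 2 -> c x = x &
        forall x y, `|c x - c y| <= `|x - y|].
Proof.
move=> r0; have r2 : 0 < r / 2 by rewrite divr_gt0.
exists (fun x => \row_j clip (x0 0 j - r / 2) (x0 0 j + r / 2) (x 0 j)).
have le j : x0 0 j - r / 2 <= x0 0 j + r / 2 by lra.
split=> [x|x xr|x y].
- rewrite -ball_normE /=; apply: (@le_lt_trans _ _ (r / 2)); last first.
    by rewrite ltr_pdivrMr// ltr_pMr// ltr1n.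
  apply: rV_norm_le => [|j]; first exact: ltW.
  rewrite !mxE; have /andP[? ?] := clip_bounds (x 0 j) (le j).
  by rewrite ler_norml; apply/andP; split; lra.
- apply/rowP => j; rewrite !mxE clip_id//.
  have := le_trans (rV_coord_le (x - x0) j) xr.
  by rewrite !mxE ler_norml => /andP[? ?]; apply/andP; split; lra.
- apply: rV_norm_le => // j; rewrite !mxE.
  apply: le_trans (clip_dist _ _ (le j)) _.
  by have := rV_coord_le (x - y) j; rewrite !mxE.
Qed.

(* With V_i(x) the derivative of right multiplication by exp(s e_i) at x, the
   equation k' = k . a reads x' = \sum_i a_i(t) V_i(x) in the chart psi. *)
Lemma local_group_ode (a : R -> 'rV[R]_(@mdim R G)) (t0 : R) psi :
  (\forall t \near t0, {for t, continuous a}) -> chart_at (1%g : G) psi ->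
  exists k : R -> G, \forall t \near t0, C1_curve_at k t /\
    exists Y : tangent (1%g : G),
      velocity_at (fun s => (k t)^-1 * k s)%g t Y /\ Y psi = a t.
Proof.
move=> ca qc; have [qa q1] := qc.
pose n := @mdim R G.
pose m (x : 'rV[R]_n * 'rV[R]_n) := cmap psi (cinv psi x.1 * cinv psi x.2)%g.
pose x0 := cmap psi 1%g.
have m11 : (cinv psi x0 * cinv psi x0 = 1)%g by rewrite cinv_cmap// mulg1.
have nb : nbhs (x0, x0) ((crng psi `&` cinv psi @^-1` [set: G]) `*`
    (crng psi `&` cinv psi @^-1` [set: G])).
  by apply: smooth2_nbhs => //; exact: filterT.
have sm k := @mulg_smooth R G psi psi qa qa k.
have mC1 : C1_at m (x0, x0).
  by apply: (Ckm1_C1_at (sm 1%N) nb); rewrite /= m11.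
pose V i (x : 'rV[R]_n) := 'D_((0, 'e_i) : 'rV[R]_n * 'rV[R]_n) m (x, x0).
(* Forming [V i] costs one derivative, so multiplication is used at order 2; C^1 then makes [V i]
   locally Lipschitz. *)
have VC1 i : C1_at (V i) x0.
  apply: (C1_at_comp (g := 'D_((0, 'e_i) : 'rV[R]_n * 'rV[R]_n) m)).
  - exact: finite_coordinates_rV2.
  - exact: C1_at_pairl.
  - by apply: (Ckm2_C1_at _ (sm 2%N) nb); rewrite /= m11.
have good : \forall x \near x0, C1_at m (x, x0) /\ crng psi x.
  apply: filterI; last exact/crng_nbhs/cmap_crng.
  have cpair : {for x0, continuous (fun x => (x, x0))}.
    exact: C1_at_continuous (C1_at_pairl x0 x0).
  exact: (cpair _ (C1_at_near mC1)).
have [r1 /= r10 Hr1] := (nbhs_ballP _ _).1 good.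
have /choice[r Hr] : forall i, exists r, 0 < r /\ exists2 L, 0 <= L &
    forall y z, ball x0 r y -> ball x0 r z -> `|V i y - V i z| <= L * `|y - z|.
  by move=> i; have [r r0 [L L0 H]] := C1_at_locally_lipschitz (VC1 i);
    exists r; split=> //; exists L.
have [rr [rr0 rr1 rri]] : exists rr, [/\ 0 < rr, rr <= r1 & forall i, rr <= r i].
  exists (\big[Num.min/r1]_i r i); split.
  - by apply: lt_bigmin => // i _; case: (Hr i).
  - exact: bigmin_le_id.
  - by move=> i; exact: bigmin_le.
have /choice[L HL] : forall i, exists L, 0 <= L /\
    forall y z, ball x0 rr y -> ball x0 rr z -> `|V i y - V i z| <= L * `|y - z|.
  move=> i; have [_ [L L0 H]] := Hr i; exists L; split=> // y z yr zr.
  by apply: H; exact: (le_ball (rri i)).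
have [cl [cl1 cl2 cl3]] := clip_rV_exists x0 rr0.
have [b [d [K [d0 K0 cb HK ba]]]] := clip_extension ca.
(* Time is truncated through [b] and space through [cl], which makes the right-hand side globally
   bounded and Lipschitz. *)
pose f (t : R) (x : 'rV[R]_n) : 'rV[R]_n := \sum_i b t 0 i *: V i (cl x).
pose S := \sum_i K * L i; pose C := \sum_i K * (`|V i x0| + L i * rr).
have S0 : 0 <= S by apply: sumr_ge0 => i _; rewrite mulr_ge0//; case: (HL i).
have C0 : 0 <= C.
  apply: sumr_ge0 => i _; rewrite mulr_ge0// addr_ge0// mulr_ge0//.
    by case: (HL i).
  exact: ltW.
have bK t i : `|b t 0 i| <= K by apply: le_trans (rV_coord_le _ _) (HK t).
(* Each term has its duty: [S] is the Lipschitz bound; [C / rr] gives C e <= rr / 2, so the solution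
   stays where [cl] is the identity; [d^-1] gives e <= d, so that [b] is [a] on the time interval; 1
   ensures positivity. *)
pose Lp := 1 + S + C / rr + d^-1.
have Crr : 0 <= C / rr by rewrite divr_ge0// ltW.
have di : 0 < d^-1 by rewrite invr_gt0.
have Lp0 : 0 < Lp by rewrite /Lp; lra.
have f_lip t x y : `|f t x - f t y| <= Lp * `|x - y|.
  apply: (@le_trans _ _ (S * `|x - y|)); last first.
    by rewrite ler_wpM2r// /Lp; lra.
  rewrite /f -sumrB (le_trans (ler_norm_sum _ _ _))// mulr_suml ler_sum// => i _.
  rewrite -scalerBr normrZ -mulrA ler_pM//.
  have [L0 Hi] := HL i.
  by rewrite (le_trans (Hi _ _ (cl1 _) (cl1 _)))// ler_wpM2l.
have f_bnd t x : `|f t x| <= C.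
  rewrite /f (le_trans (ler_norm_sum _ _ _))// ler_sum// => i _.
  rewrite normrZ ler_pM//; have [L0 Hi] := HL i.
  rewrite -(subrK (V i x0) (V i (cl x))) addrC (le_trans (ler_normD _ _))//.
  rewrite lerD2l (le_trans (Hi _ _ (cl1 _) (ballxx _ rr0)))// ler_wpM2l//.
  by have := cl1 x; rewrite -ball_normE /= distrC => /ltW.
have f_cont x : continuous (f ^~ x).
  move=> t; apply: (@continuous_at_sum _ _ _ _ (fun i t => b t 0 i *: V i (cl x))).
  move=> i; apply: (@cvgZr_tmp _ _ _ _ _ (fun t => b t 0 i)).
  by apply: (@continuous_comp _ _ _ b (fun v => v 0 i));
    [exact: cb|exact: coord_continuous].
pose e := (2 * Lp)^-1.
have e0 : 0 < e by rewrite invr_gt0 mulr_gt0.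
(* The solution exists to the right of its starting time, so it is started at t0 - e / 2 to have t0
   in the middle. *)
have [x [cx dx x_bnd]] := @picard_lindelof R n f Lp (t0 - e / 2) x0 Lp0 f_cont f_lip.
have {}x_bnd t : `|x t - x0| <= rr / 2.
  apply: le_trans (x_bnd C f_bnd t) _.
  rewrite -/e /e invfM mulrA ler_pdivrMr// -mulrA mulrCA mulrC.
  by rewrite ler_pM2l ?invr_gt0// mulrC -ler_pdivrMr// /Lp; lra.
have xr t : ball x0 rr (x t) by rewrite -(cl2 _ (x_bnd t)).
have good_x t : C1_at m (x t, x0) /\ crng psi (x t).
  by apply: Hr1; exact: le_ball rr1 _ (xr t).
have ed : e <= d.
  by rewrite /e -[leRHS]invrK lef_pV2 ?posrE ?mulr_gt0// /Lp; lra.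
pose g t := \sum_i b t 0 i *: V i (x t).
have Vx i t : {for t, continuous (fun t => V i (x t))}.
  apply: (@continuous_comp _ _ _ x (V i)); first exact: cx.
  apply: (@continuous_comp _ _ _ (fun y => (y, x0))
    ('D_((0, 'e_i) : 'rV[R]_n * 'rV[R]_n) m)).
    exact: C1_at_continuous (C1_at_pairl x0 (x t)).
  by apply: C1_at_derive; exact: (good_x t).1.
have cg : continuous g.
  move=> t; apply: (@continuous_at_sum _ _ _ _ (fun i t => b t 0 i *: V i (x t))).
  move=> i; apply: cvgZ; last exact: Vx.
  by apply: (@continuous_comp _ _ _ b (fun v => v 0 i));
    [exact: cb|exact: coord_continuous].
have dxg t : ball t0 (e / 2) t -> is_derive (t : R^o) 1 x (g t).
  rewrite -ball_normE /= ltr_norml => /andP[h1 h2].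
  have -> : g t = f t (x t) by rewrite /g /f cl2.
  by apply: dx; rewrite -/e; apply/andP; split; lra.
have e2 : 0 < e / 2 by rewrite divr_gt0.
have nt : \forall t \near t0, ball t0 (e / 2) t by exact: nbhsx_ballx.
have x_C1 : \forall t \near t0, C1_at (x : R^o -> _) t.
  near=> t; apply: (@C1_at_of_derive _ x g); near=> s; split; last exact: cg.
  apply: dxg; near: s; near: t; exact: nearR_join.
exists (cinv psi \o x); near=> t.
have xt : C1_at (x : R^o -> _) t by near: t.
have bt : ball t0 (e / 2) t by near: t.
have {}ba : b t = a t.
  apply: ba; have : `|t - t0| < e / 2 by move: bt; rewrite -ball_normE /= distrC.
  by move=> /ltW/le_trans; apply; lra.
have kC1 : C1_curve_at (cinv psi \o x) t.
  by apply: C1_curve_cinv => //; exact: (good_x t).2.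
split=> //; set k := cinv psi \o x in kC1 *.
have [w kw] := C1_curve_velocity kC1.
have [Y [vY pY _]] := left_translation_velocity kw.
exists Y; split=> //.
have [Z ZE] := tangent_with_coordinates (a t) qc.
suff -> : Y = Z by [].
have kc : chart_at (k t) psi by split=> //; exact: cinv_cdom (good_x t).2.
have [z vz] := tangent_is_velocity Z.
(* [Y = Z] is checked after left translation by [k t]: the translate [w'] of [Z] is shown to be the
   velocity [w] of k, and both are then translated back to 1. *)
have [w' [vw' pw']] := velocity_push (C1_map2_atr (mulg_C1 (k t) 1%g)) vz.
move: w' vw' pw'; rewrite mulg1 => w' vw' pw'.
have ww' : w = w'.
  apply: (tangent_chart_ext kc).
  rewrite (pw'.2 _ _ qc kc) ZE -(velocity_derive kw kc).
  transitivity (g t).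
    have [_ <-] := dxg t bt; apply: near_eq_derive; near=> s.
    by rewrite /k /= cmap_cinv//; exact: (good_x s).2.
  have dm := C1_at_differentiable (good_x t).1.
  have dl := C1_at_differentiable (C1_at_pairr (x t) x0).
  transitivity ('D_(a t) (m \o (fun y => (x t, y))) x0).
    rewrite (@derive_comp R _ _ _ _ m _ (a t) dl dm) derive_pairr.
    have -> : ((0, a t) : 'rV[R]_n * 'rV[R]_n) =
        \sum_i a t 0 i *: ((0, 'e_i) : 'rV[R]_n * 'rV[R]_n).
      apply: injective_projections => /=.
        rewrite (raddf_sum (@fst _ _)) big1// => i _ /=.
        by rewrite scaler0.
      rewrite (raddf_sum (@snd _ _)) /=; exact: row_sum_delta.
    rewrite (derive_sum_dir _ _ dm) /g; apply: eq_bigr => i _; congr (_ *: _).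
    by rewrite ba.
  by apply: near_eq_derive; near=> y.
have [y' [vy' py']] := velocity_push (C1_map2_atr (mulg_C1 (k t)^-1%g (k t))) vw'.
move: y' vy' py'; rewrite mulVg => y' vy' py'.
have -> : Z = y'.
  apply: (velocity_unique vz); apply: near_eq_velocity vy'.
  by near=> s; rewrite /= mulKg.
by rewrite -ww' in py'; exact: is_push_fun pY py'.
Unshelve. all: by end_near. Qed.

End GroupOde.

(** * Horizontality at one parameter, and local horizontal lifts *)

Section HorizontalCurves.
Variables (R : realType) (G : lieGroupType R) (P M : manifoldType R).
Variables (B : principal_bundle G P M) (A : connection B).

Lemma bact_C1 (p : P) (g : G) : C1_map2_at (bact B) p g.
Proof.
by apply: (smooth2_on_C1_map2_at (@bact_smooth _ _ _ _ B)); exact: filterT.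
Qed.

Lemma bact_C1l (g : G) (p : P) : C1_map_at (bact B ^~ g) p.
Proof. exact: C1_map2_atl (bact_C1 p g). Qed.

Lemma bproj_C1 (p : P) : C1_map_at (bproj B) p.
Proof.
by apply: (smooth_on_C1_map_at (@bproj_smooth _ _ _ _ B)); exact: filterT.
Qed.

(** Here the velocity must exist, unlike in [horizontal], which says nothing at parameters without
    one. *)
Definition horizontal_at (f : R -> P) (t : R) : Prop :=
  exists p (v : tangent p), velocity_at f t v /\
    forall psi, cform A v psi = 0.

Lemma near_eq_horizontal (f g : R -> P) (t : R) :
  (\forall s \near t, f s = g s) -> horizontal_at f t -> horizontal_at g t.
Proof.
move=> fg [p [v [fv v0]]]; exists p, v; split=> //.
exact: near_eq_velocity fg fv.
Qed.

Lemma horizontal_velocity (f : R -> P) (t : R) p (v : tangent p) :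
  horizontal_at f t -> velocity_at f t v -> forall psi, cform A v psi = 0.
Proof.
move=> [q [w [fw w0]]] fv; have [E _ _] := fw; have [E' _ _] := fv.
move: v fv; rewrite -E' E => v fv.
by rewrite (velocity_unique fv fw).
Qed.

Lemma horizontal_at_translate (f : R -> P) (t : R) (g : G) :
  horizontal_at f t -> horizontal_at (fun s => bact B (f s) g) t.
Proof.
move=> [p [v [fv v0]]].
have [w [fw pw]] := velocity_push (bact_C1l g p) fv.
exists (bact B p g), w; split=> // psi.
have [_ H] := @cform_equivariant _ _ _ _ _ A p g v w pw.
have [phi pc] := chart_exists (1%g : G).
have [qc|nqc] := pselect (chart_at (1%g : G) psi); last exact: tcoord_out.
by rewrite (H phi psi pc qc) v0 derive0.
Qed.

Lemma horizontal_at_reparam (f : R -> P) (phi : R^o -> R^o) (s d : R) :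
  is_derive (s : R^o) 1 phi d -> horizontal_at f (phi s) ->
  horizontal_at (f \o phi) s.
Proof.
move=> dphi [p [v [fv v0]]].
have [w [fw wv]] := velocity_reparam dphi fv.
by exists p, w; split=> // psi; rewrite (cformZ A wv) v0 scaler0.
Qed.

(* A((c k)') = Ad(k^-1) A(c') + k^-1 k' *)
Lemma cform_product (c : R -> P) (k : R -> G) (t : R)
    (v : tangent (c t)) (w : tangent (k t)) :
  velocity_at c t v -> velocity_at k t w ->
  exists (u u1 : tangent (bact B (c t) (k t))) (Y : tangent (1%g : G)),
    [/\ velocity_at (fun s => bact B (c s) (k s)) t u,
        velocity_at (fun s => bact B (c s) (k t)) t u1,
        velocity_at (fun s => (k t)^-1 * k s)%g t Y,
        is_push (fun x : G => k t * x)%g Y w &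
        forall psi, cform A u psi = cform A u1 psi + Y psi].
Proof.
move=> cv kw.
have [u [u1 [u2 [fu [fu1 _] [fu2 _] uE]]]] :=
  velocity_product (bact_C1 (c t) (k t)) cv kw.
have [Y [vY _ pY]] := left_translation_velocity kw.
exists u, u1, Y; split=> // psi.
(* Since c(t) k(s) = (c(t) k(t)) (k(t)^-1 k(s)), the second summand of the product rule is the
   fundamental vertical vector of [Y], on which A takes the value [Y]. *)
have [w2 [fw2 pw2]] :=
  velocity_push (C1_map2_atr (bact_C1 (bact B (c t) (k t)) 1%g)) vY.
move: w2 fw2 pw2; rewrite bact1 => w2 fw2 pw2.
have -> : Y = cform A w2 by apply/esym; exact: cform_vertical pw2.
apply: cformD => chi; rewrite uE; congr (_ + _).
congr (tcoord _ chi); apply: (velocity_unique fu2).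
apply: near_eq_velocity fw2; near=> s.
by rewrite /= -bactM mulVKg.
Unshelve. all: by end_near. Qed.

Lemma tangent_chart0 (N : manifoldType R) (p : N) (v : tangent p) phi psi :
  chart_at p phi -> v phi = 0 -> v psi = 0.
Proof.
move=> pc v0; have [qc|nqc] := pselect (chart_at p psi); last exact: tcoord_out.
by rewrite (tcoord_trans _ pc qc) v0 derive0.
Qed.

(** In A((c k)') = Ad(k^-1) A(c') + k^-1 k' both terms in A vanish, hence so does the logarithmic
    derivative of k. *)
Lemma horizontal_same_fiber (c : R -> P) (k : R -> G) (t : R)
    (w : tangent (k t)) :
  horizontal_at c t -> horizontal_at (fun s => bact B (c s) (k s)) t ->
  velocity_at k t w -> forall psi, w psi = 0.
Proof.
move=> hc hck kw; have hc' := hc; move: hc' => [p [v [cv _]]].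
have [ct _ _] := cv; subst p.
have [u [u1 [Y [fu fu1 vY pY E]]]] := cform_product cv kw.
have Y0 psi : Y psi = 0.
  have := E psi; rewrite (horizontal_velocity hck fu).
  by rewrite (horizontal_velocity (horizontal_at_translate (k t) hc) fu1) add0r.
have [phi pc] := chart_exists (1%g : G); have [psi qc] := chart_exists (k t).
move=> chi; apply: (tangent_chart0 _ qc).
by rewrite (pY.2 _ _ pc qc) Y0 derive0.
Qed.

Lemma local_horizontal_lift (g : R -> M) (t0 : R) : C1_curve_at g t0 ->
  exists f : R -> P, \forall t \near t0,
    [/\ C1_curve_at f t, bproj B (f t) = g t & horizontal_at f t].
Proof.
move=> cg; have [U [oU Ug [triv [tinv [_ stinv tinvK _ _]]]]] :=
  bundle_trivial B (g t0).
have Unear : \forall t \near t0, U (g t).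
  by apply: (C1_curve_continuous cg); apply: open_nbhs_nbhs.
pose p (t : R) := tinv (g t) 1%g.
have cp : \forall t \near t0, C1_curve_at p t.
  near=> t; apply: (C1_curve_map2 (F := tinv)); last exact: C1_curve_cst.
    have Ut : nbhs (g t) U by apply: open_nbhs_nbhs; split=> //; near: t.
    exists (interior U, setT) => /=.
      by split; [exact: nbhs_interior|exact: filterT].
    move=> [x y] [/= Ux _]; apply: (smooth2_on_C1_map2_at stinv) => //.
    exact: filterT.
  by near: t; exact: C1_curve_near.
have [psi qc] := chart_exists (1%g : G).
have [a [ca aE]] := cform_curve_continuous A (nbhs_singleton cp) qc.
have [k Hk] := local_group_ode ca qc.
pose c t := bact B (p t) (k t)^-1%g.
exists c; near=> t.
have pt : C1_curve_at p t by near: t.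
have [kt [Y [vY YE]]] : C1_curve_at k t /\ exists Y : tangent (1%g : G),
    velocity_at (fun s => (k t)^-1 * k s)%g t Y /\ Y psi = a t by near: t.
have aEt q (v : tangent q) : velocity_at p t v -> cform A v psi = a t.
  by move: q v; near: t.
have kVt : C1_curve_at (fun s => (k s)^-1%g) t.
  apply: (C1_curve_map (F := fun x : G => x^-1%g)) kt.
  by apply: nearW => x; exact: invg_C1.
have ct : C1_curve_at c t.
  apply: (@C1_curve_map2 _ _ _ _ (bact B) p (fun s => (k s)^-1%g) t) pt kVt.
  exists (setT, setT) => /=; first by split; exact: filterT.
  by move=> [x y] _; exact: bact_C1.
split=> //.
  by rewrite /c bproj_act; apply: (tinvK _ _ _).1; near: t.
have [v cv] := C1_curve_velocity ct; have [w kw] := C1_curve_velocity kt.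
(* The product formula is applied to p = c k rather than to c = p k^-1, so the derivative of k^-1 is
   never computed. *)
have [u [u1 [Y' [fu fu1 vY' _ E]]]] := cform_product cv kw.
have {}fu : velocity_at p t u.
  by apply: near_eq_velocity fu; near=> s; rewrite /c -bactM mulVg bact1.
rewrite (velocity_unique vY' vY) in E.
have u10 chi : cform A u1 chi = 0.
  apply: (tangent_chart0 _ qc); have := E psi; rewrite YE.
  by rewrite (aEt _ _ fu) -[LHS]add0r => /addIr.
(* With k(t) frozen, c k(t) is horizontal at t; translating by k(t)^-1 gives the claim for [c]. *)
have : horizontal_at (fun s => bact B (c s) (k t)) t.
  by exists (bact B (c t) (k t)), u1.
move=> /(horizontal_at_translate (k t)^-1%g); apply: near_eq_horizontal.
by near=> s; rewrite -bactM mulgV bact1.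
Unshelve. all: by end_near. Qed.

End HorizontalCurves.

(** * Piecewise C^1 curves *)

Section IntervalInduction.
Variable R : realType.

(** Let m be the supremum of the x with [Q a x]. The condition to the left of m gives [Q a m], and
    the one to its right would pass beyond m unless m = b. *)
Lemma interval_induction (a b : R) (Q : R -> R -> Prop) : a <= b ->
  (forall x y z, a <= x -> x <= y -> y <= z -> z <= b -> Q x y -> Q y z -> Q x z) ->
  (forall t, a <= t -> t <= b -> \forall u \near t,
     (a <= u -> u <= t -> Q u t) /\ (u <= b -> t <= u -> Q t u)) ->
  Q a b.
Proof.
move=> ab Qtrans Qloc.
pose S := [set x | [/\ a <= x, x <= b & Q a x]].
have Sa : S a.
  split=> //; have [H _] := nbhs_singleton (Qloc a (lexx _) ab); exact: H.
have Sb : ubound S b by move=> x [].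
have supS : has_sup S by split; [exists a|exists b].
pose m := sup S.
have am : a <= m by apply: ub_le_sup => //; exists b.
have mb : m <= b by apply: ge_sup => //; exists a.
have [e /= e0 He] := (nbhs_ballP _ _).1 (Qloc m am mb).
have Qam : Q a m.
  have [x [ax xb Qax] mx] := sup_adherent e0 supS.
  have xm : x <= m by apply: ub_le_sup => //; exists b.
  apply: (Qtrans a x m) => //.
  have [|H _] := He x; last exact: H.
  by rewrite -ball_normE /= ger0_norm ?subr_ge0// ltrBlDr -ltrBlDl.
have [mb'|bm] := ltP m b; last first.
  by have -> : b = m by apply/eqP; rewrite eq_le bm mb.
pose y := Num.min b (m + e / 2).
have my : m < y by rewrite lt_min mb' ltrDl divr_gt0.
have yb : y <= b by rewrite ge_min lexx.
suff : S y by move=> /(ub_le_sup (ex_intro _ b Sb)); rewrite leNgt my.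
split=> //; first exact: le_trans am (ltW my).
apply: (Qtrans a m y) => //; first exact: ltW.
have [|_ H] := He y; last by apply: H => //; exact: ltW.
rewrite -ball_normE /= distrC ger0_norm ?subr_ge0 ?(ltW my)// ltrBlDl.
rewrite (@le_lt_trans _ _ (m + e / 2))//; first by rewrite ge_min lexx orbT.
by rewrite ltrD2l ltr_pdivrMr// ltr_pMr// ltr1n.
Qed.

End IntervalInduction.

(** * A partition-free description of piecewise C^1 maps *)

Section PiecewiseLocal.
Variables (R : realType) (T : Type) (C1 : set R -> (R -> T) -> Prop).
Implicit Types (f g : R -> T) (a b t : R).

Definition C1germ g t : Prop := exists U : set R, [/\ open U, U t & C1 U g].

Definition left_C1 f t : Prop :=
  exists2 g, C1germ g t & \forall u \near t, u <= t -> f u = g u.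

Definition right_C1 f t : Prop :=
  exists2 g, C1germ g t & \forall u \near t, t <= u -> f u = g u.

(** Equivalent to [piecewise] by compactness of [a, b]. Phrased by one-sided germs, it spares the
    closure properties below all handling of partitions. *)
Definition locally_piecewise a b f : Prop :=
  [/\ a <= b, forall t, a < t -> t <= b -> left_C1 f t &
      forall t, a <= t -> t < b -> right_C1 f t].

Definition C1_piece f a b : Prop :=
  exists (U : set R) (g : R -> T),
    [/\ open U, `[a, b]%classic `<=` U, C1 U g & {in `[a, b]%classic, f =1 g}].

Fixpoint C1_pieces f a (s : seq R) : Prop :=
  if s is x :: s' then C1_piece f a x /\ C1_pieces f x s' else True.

Lemma C1_piecesP f a b (s : seq R) :
  (forall i, (i < size s)%N ->
    let J := `[nth b (a :: s) i, nth b s i]%classic in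
    exists (U : set R) (g : R -> T),
      [/\ open U, J `<=` U, C1 U g & {in J, g =1 f}]) <-> C1_pieces f a s.
Proof.
elim: s a => [|x s IHs] a /=; first by split.
split=> [H|[[U [g [oU JU cU fg]]] /IHs H] [_|i]].
- split; last by apply/IHs => i si; exact: (H i.+1).
  have [//|U [g [oU JU cU fg]]] := H 0%N.
  by exists U, g; split=> // u uJ; rewrite fg.
- by exists U, g; split=> // u uJ /=; rewrite fg.
- exact: H.
Qed.

Lemma C1_pieces_cat f a s s' :
  C1_pieces f a (s ++ s') <-> C1_pieces f a s /\ C1_pieces f (last a s) s'.
Proof.
elim: s a => [|x s IHs] a /=; first by split=> [|[]].
split=> [[H /IHs[H1 H2]]|[[H H1] H2]]; first by [].
by split=> //; apply/IHs.
Qed.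

Lemma piecewiseP a b f : piecewise C1 a b f <->
  a <= b /\ exists2 s, itv_partition a b s & C1_pieces f a s.
Proof.
split=> [[ab [s ps H]]|[ab [s ps H]]]; split=> //; exists s => //.
  by apply/C1_piecesP; exact: H.
by move/C1_piecesP : H; exact.
Qed.

Lemma C1_piece_left f a b t : C1_piece f a b -> a < t -> t <= b -> left_C1 f t.
Proof.
move=> [U [g [oU JU cU fg]]] at_ tb; exists g.
  by exists U; split=> //; apply: JU; rewrite /= in_itv/= (ltW at_) tb.
near=> u => ut; apply: fg; apply/mem_set; rewrite /= in_itv/= (le_trans ut tb) andbT.
by apply/ltW; near: u; exact: lt_nbhsr.
Unshelve. all: by end_near. Qed.

Lemma C1_piece_right f a b t : C1_piece f a b -> a <= t -> t < b -> right_C1 f t.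
Proof.
move=> [U [g [oU JU cU fg]]] at_ tb; exists g.
  by exists U; split=> //; apply: JU; rewrite /= in_itv/= (ltW tb) at_.
near=> u => tu; apply: fg; apply/mem_set; rewrite /= in_itv/= (le_trans at_ tu).
by apply/ltW; near: u; exact: lt_nbhsl.
Unshelve. all: by end_near. Qed.

Lemma piecewise_local a b f : piecewise C1 a b f -> locally_piecewise a b f.
Proof.
move=> /piecewiseP[_ [s ps H]].
elim: s a ps H => [|x s IHs] a [] /=.
  move=> _ /eqP <- _; split=> // t /lt_le_trans h /h; by rewrite ?ltxx.
move=> /andP[ax px] lx [pax /(IHs _ (conj px lx))[xb Hl Hr]].
split; first by rewrite (le_trans (ltW ax)).
  move=> t at_ tb; have [tx|xt] := leP t x; last exact: Hl.
  exact: C1_piece_left pax at_ tx.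
move=> t at_ tb; have [tx|xt] := ltP t x; last exact: Hr.
exact: C1_piece_right pax at_ tx.
Qed.

Lemma left_C1_piece f t : left_C1 f t ->
  \forall x \near t, x <= t -> C1_piece f x t.
Proof.
move=> [g [U [oU Ut cU]] fg].
have Un : nbhs t U by exact: open_nbhs_nbhs.
have [e /= e0 He] := (nbhs_ballP _ _).1 (filterI Un fg).
near=> x => xt; exists U, g.
have H u : u \in `[x, t]%classic -> U u /\ f u = g u.
  move=> /set_mem; rewrite /= in_itv/= => /andP[xu ut].
  have [|Uu fgu] := He u; last by split=> //; exact: fgu.
  rewrite -ball_normE /= ger0_norm ?subr_ge0// (@le_lt_trans _ _ (t - x))//.
    by rewrite lerD2l lerN2.
  rewrite ltrBlDr -ltrBlDl; near: x; apply: lt_nbhsr; by rewrite gtrBl.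
by split=> // u; [move=> /mem_set/H[]|move=> /H[]].
Unshelve. all: by end_near. Qed.

Lemma right_C1_piece f t : right_C1 f t ->
  \forall x \near t, t <= x -> C1_piece f t x.
Proof.
move=> [g [U [oU Ut cU]] fg].
have Un : nbhs t U by exact: open_nbhs_nbhs.
have [e /= e0 He] := (nbhs_ballP _ _).1 (filterI Un fg).
near=> x => tx; exists U, g.
have H u : u \in `[t, x]%classic -> U u /\ f u = g u.
  move=> /set_mem; rewrite /= in_itv/= => /andP[tu ux].
  have [|Uu fgu] := He u; last by split=> //; exact: fgu.
  rewrite -ball_normE /= distrC ger0_norm ?subr_ge0// (@le_lt_trans _ _ (x - t))//.
    by rewrite lerD2r.
  rewrite ltrBlDl; near: x; apply: lt_nbhsl; by rewrite ltrDl.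
by split=> // u; [move=> /mem_set/H[]|move=> /H[]].
Unshelve. all: by end_near. Qed.

(** Interval induction on the existence of a partition: germs give one-piece partitions near each
    point, and concatenation of partitions is the transitivity. *)
Lemma local_piecewise a b f : locally_piecewise a b f -> piecewise C1 a b f.
Proof.
move=> [ab Hl Hr]; apply/piecewiseP; split=> //.
pose Q x y := exists2 s, itv_partition x y s & C1_pieces f x s.
have Qone x y : x <= y -> C1_piece f x y -> Q x y.
  rewrite le_eqVlt => /predU1P[->|xy] H; first by exists [::] => //; split=> /=.
  by exists [:: y] => //=; split=> //=; rewrite xy.
apply: (@interval_induction _ a b Q ab).
  move=> x y z _ _ _ _ [s ps Hs] [s' ps' Hs'].
  exists (s ++ s'); first exact: itv_partition_cat ps ps'.
  by apply/C1_pieces_cat; split=> //; case: ps => _ /eqP ->.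
have Qxx x : Q x x by exists [::] => //; split=> /=.
move=> t at_ tb; apply: filterI.
  move: at_; rewrite le_eqVlt => /predU1P[<-|at_].
    by near=> u => au ua; have -> : u = a by apply/eqP; rewrite eq_le au ua.
  have := left_C1_piece (Hl t at_ tb).
  by apply: filterS => u Hu _ ut; apply: Qone => //; exact: Hu.
move: tb; rewrite le_eqVlt => /predU1P[->|tb].
  by near=> u => ub bu; have -> : u = b by apply/eqP; rewrite eq_le bu ub.
have := right_C1_piece (Hr t at_ tb).
by apply: filterS => u Hu _ ut; apply: Qone => //; exact: Hu.
Unshelve. all: by end_near. Qed.

Lemma piecewise_off_finite a b f : piecewise C1 a b f ->
  exists s : seq R, forall t, a < t -> t < b -> t \notin s ->
    exists2 g, C1germ g t & \forall u \near t, f u = g u.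
Proof.
move=> /piecewiseP[_ [s ps H]]; exists s.
elim: s a ps H => [|x s IHs] a [] /=.
  by move=> _ /eqP <- _ t at_ ta; have := lt_trans at_ ta; rewrite ltxx.
move=> /andP[ax px] lx [[U [g [oU JU cU fg]]] /(IHs _ (conj px lx)) H] t at_ tb.
rewrite inE negb_or => /andP[tx ts].
have [xt|tx'] := ltP x t; first exact: H.
have {}tx : t < x by rewrite lt_neqAle tx.
exists g.
  by exists U; split=> //; apply: JU; rewrite /= in_itv/= !ltW.
near=> u; apply: fg; apply/mem_set; rewrite /= in_itv/=; apply/andP; split.
  by apply/ltW; near: u; exact: lt_nbhsr.
by apply/ltW; near: u; exact: lt_nbhsl.
Unshelve. all: by end_near. Qed.

Lemma locally_piecewise_congr a b f f' :
  (forall t, a <= t -> t <= b -> f t = f' t) ->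
  locally_piecewise a b f -> locally_piecewise a b f'.
Proof.
move=> ff' [ab Hl Hr]; split=> // t at_ tb.
  have [g cg fg] := Hl t at_ tb; exists g => //.
  near=> u => ut; rewrite -ff'; last exact: le_trans ut tb.
    by move: ut; near: u.
  by apply/ltW; near: u; exact: lt_nbhsr.
have [g cg fg] := Hr t at_ tb; exists g => //.
near=> u => tu; rewrite -ff'; first by move: tu; near: u.
  exact: le_trans at_ tu.
by apply/ltW; near: u; exact: lt_nbhsl.
Unshelve. all: by end_near. Qed.

Lemma locally_piecewise_cat a b c f : locally_piecewise a b f ->
  locally_piecewise b c f -> locally_piecewise a c f.
Proof.
move=> [ab Hl Hr] [bc Hl' Hr']; split; first exact: le_trans bc.
  move=> t at_ tc; have [tb|bt] := leP t b; [exact: Hl|exact: Hl'].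
by move=> t at_ tc; have [tb|bt] := ltP t b; [exact: Hr|exact: Hr'].
Qed.

Lemma locally_piecewise_germ a b f : a <= b ->
  (forall t, a <= t -> t <= b -> C1germ f t) -> locally_piecewise a b f.
Proof.
move=> ab H; split=> // t at_ tb; exists f; [|by near=> u| |by near=> u];
  by apply: H => //; exact: ltW.
Unshelve. all: by end_near. Qed.

Lemma locally_piecewise_point a f : locally_piecewise a a f.
Proof.
by split=> // t; [move=> /lt_le_trans h /h|move=> /le_lt_trans h /h];
  rewrite ltxx.
Qed.

End PiecewiseLocal.

(** * Images, shifts and reversals of piecewise C^1 maps *)

Section PiecewiseTransport.
Variable R : realType.

Lemma locally_piecewise_map (T T' : Type) (C1 : set R -> (R -> T) -> Prop)
    (C1' : set R -> (R -> T') -> Prop) (F : T -> T') (a b : R) (f : R -> T) :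
  (forall g t, C1germ C1 g t -> C1germ C1' (F \o g) t) ->
  locally_piecewise C1 a b f -> locally_piecewise C1' a b (F \o f).
Proof.
move=> FC [ab Hl Hr]; split=> // t at_ tb.
  have [g cg fg] := Hl t at_ tb; exists (F \o g); first exact: FC.
  by apply: filterS fg => u fg /fg /= ->.
have [g cg fg] := Hr t at_ tb; exists (F \o g); first exact: FC.
by apply: filterS fg => u fg /fg /= ->.
Qed.

Lemma near_shift_real (t d : R) (P : R -> Prop) :
  (\forall u \near t + d, P u) -> \forall u \near t, P (u + d).
Proof.
have c : {for t, continuous (fun u : R => u + d)}.
  by apply: continuousD; [exact: cvg_id|exact: cvg_cst].
exact: c.
Qed.

Lemma near_reverse_real (t d : R) (P : R -> Prop) :
  (\forall u \near d - t, P u) -> \forall u \near t, P (d - u).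
Proof.
have c : {for t, continuous (fun u : R => d - u)}.
  by apply: continuousB; [exact: cvg_cst|exact: cvg_id].
exact: c.
Qed.

Variables (T : Type) (C1 : set R -> (R -> T) -> Prop).
Variables (a b d : R) (f : R -> T).

Lemma locally_piecewise_shift :
  (forall g t, C1germ C1 g (t + d) -> C1germ C1 (fun u => g (u + d)) t) ->
  locally_piecewise C1 (a + d) (b + d) f ->
  locally_piecewise C1 a b (fun u => f (u + d)).
Proof.
move=> FC [ab Hl Hr]; split=> [|t at_ tb|t at_ tb]; first by rewrite lerD2r in ab.
  have [||g cg fg] := Hl (t + d); [by rewrite ltrD2r|by rewrite lerD2r|].
  exists (fun u => g (u + d)); first exact: FC.
  by apply: filterS (near_shift_real fg) => u fg' ut; apply: fg'; rewrite lerD2r.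
have [||g cg fg] := Hr (t + d); [by rewrite lerD2r|by rewrite ltrD2r|].
exists (fun u => g (u + d)); first exact: FC.
by apply: filterS (near_shift_real fg) => u fg' ut; apply: fg'; rewrite lerD2r.
Qed.

Lemma locally_piecewise_reverse :
  (forall g t, C1germ C1 g (d - t) -> C1germ C1 (fun u => g (d - u)) t) ->
  locally_piecewise C1 (d - b) (d - a) f ->
  locally_piecewise C1 a b (fun u => f (d - u)).
Proof.
move=> FC [ab Hl Hr]; split=> [|t at_ tb|t at_ tb]; first by rewrite lerD2l lerN2 in ab.
  have [||g cg fg] := Hr (d - t);
    [by rewrite lerD2l lerN2|by rewrite ltrD2l ltrN2|].
  exists (fun u => g (d - u)); first exact: FC.
  by apply: filterS (near_reverse_real fg) => u fg' ut; apply: fg';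
    rewrite lerD2l lerN2.
have [||g cg fg] := Hl (d - t);
  [by rewrite ltrD2l ltrN2|by rewrite lerD2l lerN2|].
exists (fun u => g (d - u)); first exact: FC.
by apply: filterS (near_reverse_real fg) => u fg' ut; apply: fg';
  rewrite lerD2l lerN2.
Qed.

End PiecewiseTransport.

(** * Concatenation and reversal of piecewise C^1 curves *)

Section PiecewiseC1Curves.
Variables (R : realType) (M : manifoldType R).

Local Notation C1M := (fun U g => Ckm 1 (U : set R^o) (g : R^o -> M)).

Lemma C1_at_affine (s d t : R^o) : C1_at (fun u : R^o => u * s + d : R^o) t.
Proof.
have := C1_atD (C1_atZ s (C1_at_id (t : R^o))) (C1_at_cst d (t : R^o)).
by apply: near_eq_C1_at; near=> u; rewrite /= /GRing.scale /= mulrC.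
Unshelve. all: by end_near. Qed.

Lemma C1germ_shift (d : R) (g : R -> M) t :
  C1germ C1M g (t + d) -> C1germ C1M (fun u => g (u + d)) t.
Proof.
move=> cg; apply: (@C1_curve_reparam R M g (fun u : R^o => u + d : R^o) t) => //.
apply: near_eq_C1_at (C1_at_affine 1 d t); near=> u; by rewrite mulr1.
Unshelve. all: by end_near. Qed.

Lemma C1germ_reverse (d : R) (g : R -> M) t :
  C1germ C1M g (d - t) -> C1germ C1M (fun u => g (d - u)) t.
Proof.
move=> cg; apply: (@C1_curve_reparam R M g (fun u : R^o => d - u : R^o) t) => //.
by apply: near_eq_C1_at (C1_at_affine (-1) d t); near=> u;
  rewrite mulrN1 addrC.
Unshelve. all: by end_near. Qed.

Lemma pc1P (c : curve R M) :
  pc1 c <-> locally_piecewise C1M (ca c) (cb c) (cf c).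
Proof. by split; [exact: piecewise_local|exact: local_piecewise]. Qed.

Lemma pc1_le (c : curve R M) : pc1 c -> ca c <= cb c.
Proof. by case. Qed.

Lemma pc1_congr (c c' : curve R M) : ca c = ca c' -> cb c = cb c' ->
  (forall t, ca c <= t <= cb c -> cf c t = cf c' t) -> pc1 c -> pc1 c'.
Proof.
move=> ac bc fc /pc1P; rewrite ac bc => H; apply/pc1P.
apply: locally_piecewise_congr H => t at_ tb.
by apply: fc; rewrite ac bc at_.
Qed.

Lemma pc1_cat (c d : curve R M) : pc1 c -> pc1 d -> cend c = cstart d ->
  pc1 (ccat c d).
Proof.
move=> /pc1P pc /pc1P pd cd; have [cab _ _] := pc; have [dab _ _] := pd.
apply/pc1P; apply: (@locally_piecewise_cat _ _ _ _ (cb c)).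
  by apply: locally_piecewise_congr pc => t at_ tb /=; rewrite tb.
have := @locally_piecewise_shift R M C1M (cb c) (cb c + (cb d - ca d))
  (ca d - cb c) (cf d) (C1germ_shift (d := _)).
have -> : cb c + (ca d - cb c) = ca d by ring.
have -> : cb c + (cb d - ca d) + (ca d - cb c) = cb d by ring.
move=> /(_ pd).
apply: locally_piecewise_congr => t bt te /=.
have [tb|_] := leP t (cb c); last by congr cf; ring.
(* At the joint [ccat] takes the first branch, and the two curves agree there by hypothesis. *)
have -> : t = cb c by apply/eqP; rewrite eq_le tb bt.
by rewrite -/(cend c) cd subrKC.
Qed.

Lemma pc1_rev (c : curve R M) : pc1 c -> pc1 (crev c).
Proof.
move=> /pc1P pc; apply/pc1P.
apply: (@locally_piecewise_reverse R M C1M (ca c) (cb c) (ca c + cb c) (cf c)).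
  by move=> g t; exact: C1germ_reverse.
by rewrite addrK addrC addKr.
Qed.

End PiecewiseC1Curves.

(** * Uniqueness and existence of horizontal lifts *)

Section OneSided.
Variables (R : realType).

(** Values of a curve outside its interval are irrelevant, so at the ends continuity can only be
    one-sided. *)
Definition left_continuous_at (T : topologicalType) (f : R -> T) (t : R) : Prop :=
  forall A, nbhs (f t) A -> \forall u \near t, u <= t -> A (f u).

Definition right_continuous_at (T : topologicalType) (f : R -> T) (t : R) : Prop :=
  forall A, nbhs (f t) A -> \forall u \near t, t <= u -> A (f u).

Lemma left_C1_continuous (M : manifoldType R) (f : R -> M) t :
  left_C1 (fun U g => Ckm 1 (U : set R^o) (g : R^o -> M)) f t ->
  left_continuous_at f t.
Proof.
move=> [g cg fg] A; rewrite (nbhs_singleton fg (lexx t)) => gA.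
have := C1_curve_continuous cg gA.
by apply: filterS2 fg => u fg Agu ut; rewrite fg.
Qed.

Lemma right_C1_continuous (M : manifoldType R) (f : R -> M) t :
  right_C1 (fun U g => Ckm 1 (U : set R^o) (g : R^o -> M)) f t ->
  right_continuous_at f t.
Proof.
move=> [g cg fg] A; rewrite (nbhs_singleton fg (lexx t)) => gA.
have := C1_curve_continuous cg gA.
by apply: filterS2 fg => u fg Agu ut; rewrite fg.
Qed.

Lemma off_finite (s : seq R) (t : R) :
  \forall u \near t, u != t -> u \notin s.
Proof.
elim: s => [|x s IHs]; first by near=> u.
have [->|xt] := eqVneq x t.
  by apply: filterS IHs => u us ut; rewrite inE negb_or ut us.
have d0 : 0 < `|x - t| by rewrite normr_gt0 subr_eq0.
have /cvgrPdist_lt/(_ _ d0) := @cvg_id _ (nbhs (t : R)).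
apply: filterS2 IHs => u us ux ut; rewrite inE negb_or us// andbT.
by apply/eqP => uE; move: ux; rewrite uE distrC ltxx.
Unshelve. all: by end_near. Qed.

(** k is constant on each gap of s, and at an exceptional point its value is the one-sided limit of
    that constant, unique in a Hausdorff space. *)
Lemma locally_constant_off_finite (T : topologicalType) (k : R -> T) (a b : R)
    (s : seq R) : hausdorff_space T -> a <= b ->
  (forall t, a < t -> t <= b -> left_continuous_at k t) ->
  (forall t, a <= t -> t < b -> right_continuous_at k t) ->
  (forall t, a < t -> t < b -> t \notin s -> \forall u \near t, k u = k t) ->
  k a = k b.
Proof.
move=> hT ab kl kr kc.
have const x y : a < x -> x <= y -> y < b ->
    (forall t, x <= t -> t <= y -> t \notin s) -> k x = k y.
  move=> ax xy yb xys; apply: (@interval_induction _ x y (fun x y => k x = k y)) => //.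
    by move=> ? ? ? _ _ _ _ -> ->.
  move=> t xt ty; have := kc t (lt_le_trans ax xt) (le_lt_trans ty yb) (xys t xt ty).
  by apply: filterS => u ->.
apply: (@interval_induction _ a b (fun x y => k x = k y)) => //.
  by move=> ? ? ? _ _ _ _ -> ->.
move=> t at_ tb.
have [e /= e0 He] := (nbhs_ballP _ _).1 (off_finite s t).
have Hs u : u != t -> `|t - u| < e -> u \notin s.
  by move=> ut tu; apply: He => //; rewrite -ball_normE.
apply: filterI.
  move: at_; rewrite le_eqVlt => /predU1P[<-|at_].
    by near=> u => au ua; congr k; apply/eqP; rewrite eq_le ua au.
  near=> x => ax; rewrite le_eqVlt => /predU1P[->//|xt].
  apply: hT => A C kxA ktC.
  have [r /= r0 Hr] := (nbhs_ballP _ _).1 (kl t at_ tb C ktC).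
  (* [y] lies between x and t, so [k y = k x], and is close enough to t for [k y] to be in [C]: the
     neighbourhoods [A] and [C] meet. *)
  pose y := Num.max ((x + t) / 2) (t - r / 2).
  have yt : y < t.
    by rewrite gt_max; apply/andP; split; lra.
  have xy : x < y by rewrite lt_max; apply/orP; left; lra.
  have yr : t - r < y by rewrite lt_max; apply/orP; right; lra.
  have xe : t - e < x by near: x; apply: lt_nbhsr; rewrite gtrBl.
  have ax' : a < x by near: x; exact: lt_nbhsr.
  exists (k x); split; first exact: nbhs_singleton.
  rewrite (const x y) ?(ltW xy)//; last first.
  - move=> u xu uy; apply: Hs; first by rewrite lt_eqF// (le_lt_trans uy).
    by rewrite ger0_norm; lra.
  - exact: lt_le_trans yt tb.
  apply: Hr; last exact: ltW.
  by rewrite -ball_normE /= ger0_norm; lra.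
move: tb; rewrite le_eqVlt => /predU1P[->|tb].
  by near=> u => ub bu; congr k; apply/eqP; rewrite eq_le ub bu.
near=> x => bx; rewrite le_eqVlt => /predU1P[->//|tx].
apply/esym; apply: hT => A C kxA ktC.
have [r /= r0 Hr] := (nbhs_ballP _ _).1 (kr t at_ tb C ktC).
pose y := Num.min ((x + t) / 2) (t + r / 2).
have yt : t < y.
  by rewrite lt_min; apply/andP; split; lra.
have xy : y < x by rewrite gt_min; apply/orP; left; lra.
have yr : y < t + r by rewrite gt_min; apply/orP; right; lra.
have xe : x < t + e by near: x; apply: lt_nbhsl; rewrite ltrDl.
have ax' : x < b by near: x; exact: lt_nbhsl.
exists (k x); split; first exact: nbhs_singleton.
rewrite -(const y x) ?(ltW xy)//; last first.
- move=> u xu uy; apply: Hs; first by rewrite gt_eqF// (lt_le_trans yt).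
  by rewrite distrC ger0_norm; lra.
- exact: le_lt_trans at_ yt.
apply: Hr; last exact: ltW.
by rewrite -ball_normE /= distrC ger0_norm; lra.
Unshelve. all: by end_near. Qed.

(** Either derivative is already the limit of the difference quotients with negative increment, and
    these coincide for small increments. *)
Lemma left_derivative_unique (V : normedModType R) (f g : R^o -> V) (t : R)
    (v w : V) : is_derive (t : R^o) 1 f v -> is_derive (t : R^o) 1 g w ->
  (\forall u \near t, u <= t -> f u = g u) -> v = w.
Proof.
move=> [df <-] [dg <-] fg.
have Q (h : R^o -> V) : derivable h (t : R^o) 1 -> forall d, 0 < d ->
    exists2 r : R, 0 < r & forall x : R, `|x| < r -> x != 0 ->
      `|'D_1 h (t : R^o) - x^-1 *: (h (x + t) - h t)| < d.
  move=> dh d d0; have /cvgrPdist_lt/(_ _ d0)[r /= r0 Hr] := dh.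
  exists r => // x xr x0; have := Hr x; rewrite /ball_ /= sub0r normrN.
  by rewrite /GRing.scale /= mulr1; apply.
move: ('D_1 f _) (Q f df) ('D_1 g _) (Q g dg) => Df Qf Dg Qg.
apply/eqP; rewrite -subr_eq0 -normr_le0.
apply/ler_addgt0Pr => d d0; rewrite add0r.
have d2 : 0 < d / 2 by rewrite divr_gt0.
have [rf rf0 Hf] := Qf _ d2; have [rg rg0 Hg] := Qg _ d2.
have [r /= r0 Hr] := (nbhs_ballP _ _).1 fg.
pose h := - (Num.min r (Num.min rf rg) / 2).
have m0 : 0 < Num.min r (Num.min rf rg) by rewrite !lt_min r0 rf0 rg0.
have h0 : h < 0 by rewrite /h oppr_lt0 divr_gt0.
have nh : `|h| < Num.min r (Num.min rf rg).
  by rewrite ltr0_norm// /h opprK ltr_pdivrMr// ltr_pMr// ltr1n.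
have [hr hrf hrg] : [/\ `|h| < r, `|h| < rf & `|h| < rg].
  by move: nh; rewrite !lt_min => /andP[-> /andP[-> ->]].
have hn0 : h != 0 by rewrite lt_eqF.
have {}Hf := Hf h hrf hn0; have := Hg h hrg hn0.
have <- : f t = g t := nbhs_singleton fg (lexx t).
have <- : f (h + t) = g (h + t).
  apply: Hr; first by rewrite -ball_normE /= opprD addrCA subrr addr0 normrN.
  by rewrite gerDr ltW.
move: Hf; set q := h^-1 *: _ => Hf; rewrite distrC => Hg'.
by rewrite (splitr d) ltW// -(subrKA q) (le_lt_trans (ler_normD _ _))// ltrD.
Qed.

End OneSided.

(** * Uniqueness of horizontal curves over a given curve *)

Section WeaklyHorizontal.
Variables (R : realType) (G : lieGroupType R) (P M : manifoldType R).
Variables (B : principal_bundle G P M) (A : connection B).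

Local Notation C1P := (fun U g => Ckm 1 (U : set R^o) (g : R^o -> P)).

(** The element of G that moves p to q in a fiber is (triv p)^-1 (triv q), an expression that is C^1
    in both points. *)
Lemma bundle_local_triv (x : M) : exists U : set M, [/\ open U, U x &
  exists triv : P -> G, [/\ forall p, U (bproj B p) -> C1_map_at triv p,
    forall p g, U (bproj B p) -> triv (bact B p g) = (triv p * g)%g &
    forall p q, U (bproj B p) -> bproj B p = bproj B q ->
      q = bact B p ((triv p)^-1 * triv q)%g]].
Proof.
have [U [oU Ux [triv [tinv [striv _ tinvK trivK tact]]]]] := bundle_trivial B x.
exists U; split=> //; exists triv; split=> // [p Up|p q Up pq].
  apply: (smooth_on_C1_map_at striv).
  by apply: (bproj_C1 B p).1; exact: open_nbhs_nbhs.
rewrite -[LHS]trivK -?pq// -[RHS]trivK ?bproj_act//.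
by rewrite tact// mulVKg.
Qed.

Lemma bact_transitive (p q : P) : bproj B p = bproj B q ->
  exists g, q = bact B p g.
Proof.
move=> pq; have [U [_ Up [triv [_ _ H]]]] := bundle_local_triv (bproj B p).
by exists ((triv p)^-1 * triv q)%g; exact: H.
Qed.

Lemma bact_inj (p : P) (g h : G) : bact B p g = bact B p h -> g = h.
Proof.
move=> gh; have [U [_ Up [triv [_ tact _]]]] := bundle_local_triv (bproj B p).
by apply: (mulgI (triv p)); rewrite -!tact// gh.
Qed.

Lemma bact_free (p : P) (g : G) : bact B p g = p -> g = 1%g.
Proof. by move=> pg; apply: (@bact_inj p); rewrite pg bact1. Qed.

(* The part of horizontality that survives a piecewise C^1 reparametrization
   with vanishing derivatives. *)
Definition weakly_horizontal (f : R -> P) (a b : R) : Prop :=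
  [/\ forall t, a < t -> t <= b -> left_continuous_at f t,
      forall t, a <= t -> t < b -> right_continuous_at f t &
      exists s : seq R, forall t, a < t -> t < b -> t \notin s ->
        horizontal_at A f t].

(** In a chart around [k t] the coordinates of k have derivative 0, and the mean value inequality
    applies with constant 0. *)
Lemma velocity_constant (k : R -> G) (a b : R) :
  (forall t, a < t -> t < b -> exists w : tangent (k t), velocity_at k t w /\
     forall phi, w phi = 0) ->
  forall t, a < t -> t < b -> \forall u \near t, k u = k t.
Proof.
move=> H t at_ tb; have [phi pc] := chart_exists (k t).
have [w [kw _]] := H t at_ tb; have [_ ck _] := kw.
have phin : \forall u \near t, cdom phi (k u).
  by apply: ck; apply: cdom_nbhs; exact: pc.2.
have abn : \forall u \near t, a < u /\ u < b.
  by near=> u; split; near: u; [exact: lt_nbhsr|exact: lt_nbhsl].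
have [e /= e0 He] := (nbhs_ballP _ _).1 (filterI phin abn).
have const x y : x <= y -> ball t e x -> ball t e y -> k x = k y.
  move=> xy xe ye.
  have inb u : x <= u <= y -> ball t e u.
    move: xe ye; rewrite -!ball_normE /= !ltr_distl => /andP[? ?] /andP[? ?] /andP[? ?].
    by apply/andP; split; lra.
  have D u : x <= u <= y -> is_derive (u : R^o) 1 (cmap phi \o k : R^o -> _) 0.
    move=> /inb/He[pu [au ub]]; have [v [kv v0]] := H u au ub.
    by rewrite -(v0 phi); have [_ _] := kv; apply; split=> //; exact: pc.1.
  have : `|(cmap phi \o k) y - (cmap phi \o k) x| <= 0 * (y - x).
    by apply: (mean_value_rV xy D) => u _; rewrite normr0.
  rewrite mul0r normr_le0 subr_eq0 => /eqP/= E.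
  rewrite -[LHS](@cinv_cmap _ _ _ phi); last exact: (He _ xe).1.
  rewrite -[RHS](@cinv_cmap _ _ _ phi); last exact: (He _ ye).1.
  by rewrite E.
have bt := ballxx t e0.
near=> u.
have bu : ball t e u by near: u; exact: nbhsx_ballx.
by have [ut|/ltW tu] := leP u t; [exact: const|apply/esym; exact: const].
Unshelve. all: by end_near. Qed.

Lemma velocity_mulg_inv (f1 f2 : R -> P) (triv : P -> G) (t : R) p1 p2
    (v1 : tangent p1) (v2 : tangent p2) :
  C1_map_at triv p1 -> C1_map_at triv p2 ->
  velocity_at f1 t v1 -> velocity_at f2 t v2 ->
  exists w : tangent ((triv p1)^-1 * triv p2)%g,
    velocity_at (fun s => (triv (f1 s))^-1 * triv (f2 s))%g t w.
Proof.
move=> c1 c2 fv1 fv2.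
have [w1 [fw1 _]] := velocity_push c1 fv1.
have [w2 [fw2 _]] := velocity_push c2 fv2.
have [w1' [fw1' _]] := velocity_push (invg_C1 (triv p1)) fw1.
have [u [_ [_ [fu _ _ _]]]] := velocity_product (mulg_C1 _ _) fw1' fw2.
by exists u.
Qed.

Lemma left_continuous_at_comp (T U : topologicalType) (F : T -> U) (f : R -> T) t :
  {for f t, continuous F} -> left_continuous_at f t -> left_continuous_at (F \o f) t.
Proof. by move=> cF cf C /cF /cf. Qed.

Lemma right_continuous_at_comp (T U : topologicalType) (F : T -> U) (f : R -> T) t :
  {for f t, continuous F} -> right_continuous_at f t ->
  right_continuous_at (F \o f) t.
Proof. by move=> cF cf C /cF /cf. Qed.

Lemma left_continuous_at_pair (T U : topologicalType) (f : R -> T) (g : R -> U) t :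
  left_continuous_at f t -> left_continuous_at g t ->
  left_continuous_at (fun u => (f u, g u)) t.
Proof.
move=> cf cg C [[C1 C2] [/= /cf fC1 /cg gC2] CC].
by apply: filterS2 fC1 gC2 => u H1 H2 ut; apply: CC; split; [exact: H1|exact: H2].
Qed.

Lemma right_continuous_at_pair (T U : topologicalType) (f : R -> T) (g : R -> U) t :
  right_continuous_at f t -> right_continuous_at g t ->
  right_continuous_at (fun u => (f u, g u)) t.
Proof.
move=> cf cg C [[C1 C2] [/= /cf fC1 /cg gC2] CC].
by apply: filterS2 fC1 gC2 => u H1 H2 ut; apply: CC; split; [exact: H1|exact: H2].
Qed.

Lemma mulg_inv_continuous (triv : P -> G) (p1 p2 : P) :
  C1_map_at triv p1 -> C1_map_at triv p2 ->
  {for (p1, p2), continuous (fun x => (triv x.1)^-1 * triv x.2)%g}.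
Proof.
move=> [c1 _] [c2 _].
apply: (@continuous_comp _ _ _ (fun x => ((triv x.1)^-1, triv x.2)%g)
  (fun x => x.1 * x.2)%g); last exact: (mulg_C1 _ _).1.
apply: continuous_at_pair.
  apply: (@continuous_comp _ _ _ (fun x => triv x.1) (fun x : G => x^-1)%g);
    last exact: (invg_C1 _).1.
  by apply: (@continuous_comp _ _ _ fst triv); [exact: cvg_fst|exact: c1].
by apply: (@continuous_comp _ _ _ snd triv); [exact: cvg_snd|exact: c2].
Qed.

(* Two lifts differ by k : [a, b] -> G, and k^-1 k' = 0 off a finite set. *)
Lemma weakly_horizontal_unique (f1 f2 : R -> P) (a b : R) : a <= b ->
  weakly_horizontal f1 a b -> weakly_horizontal f2 a b ->
  (forall t, a <= t -> t <= b -> bproj B (f1 t) = bproj B (f2 t)) ->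
  f1 a = f2 a -> f1 b = f2 b.
Proof.
move=> ab [l1 r1 [s1 h1]] [l2 r2 [s2 h2]] E12 Ea.
(* On [a, b] this is the unique k with f2 = f1 k; the value 1 is a default for other parameters. *)
pose k t := xget 1%g [set g | f2 t = bact B (f1 t) g].
have kE t : a <= t -> t <= b -> f2 t = bact B (f1 t) (k t).
  move=> at_ tb; have [g gE] := bact_transitive (E12 t at_ tb).
  by rewrite /k; case: xgetP => [h _ //|/(_ g)]; exact.
(* The formula in a local trivialization gives one-sided continuity and velocities to k, which was
   defined by choice. *)
have kloc t (triv : P -> G) (U : set M) : a <= t -> t <= b ->
    (forall p q, U (bproj B p) -> bproj B p = bproj B q ->
      q = bact B p ((triv p)^-1 * triv q)%g) ->
    U (bproj B (f1 t)) -> k t = ((triv (f1 t))^-1 * triv (f2 t))%g.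
  move=> at_ tb H Ut; apply: (@bact_inj (f1 t)); rewrite -kE//.
  by apply: H => //; exact: E12.
suff kab : k a = k b.
  rewrite (kE b ab (lexx b)) -kab.
  have -> : k a = 1%g by apply: (@bact_free (f1 a)); rewrite -kE.
  by rewrite bact1.
have Unear_l t (U : set M) : a < t -> t <= b -> open U -> U (bproj B (f1 t)) ->
    \forall u \near t, u <= t -> U (bproj B (f1 u)).
  move=> at_ tb oU Ut.
  apply: (left_continuous_at_comp (bproj_C1 B (f1 t)).1 (l1 t at_ tb)).
  exact: open_nbhs_nbhs.
have Unear_r t (U : set M) : a <= t -> t < b -> open U -> U (bproj B (f1 t)) ->
    \forall u \near t, t <= u -> U (bproj B (f1 u)).
  move=> at_ tb oU Ut.
  apply: (right_continuous_at_comp (bproj_C1 B (f1 t)).1 (r1 t at_ tb)).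
  exact: open_nbhs_nbhs.
apply: (@locally_constant_off_finite R G k a b (s1 ++ s2)) => //.
- exact: manifold_hausdorff.
- move=> t at_ tb C.
  have [U [oU Ut [triv [ctriv _ H]]]] := bundle_local_triv (bproj B (f1 t)).
  rewrite (kloc t triv U (ltW at_) tb H Ut) => kC.
  have c1 := ctriv _ Ut.
  have c2 : C1_map_at triv (f2 t) by apply: ctriv; rewrite -E12// ltW.
  have := left_continuous_at_comp (F := fun x => ((triv x.1)^-1 * triv x.2)%g)
    (mulg_inv_continuous c1 c2) (left_continuous_at_pair (l1 t at_ tb) (l2 t at_ tb)) kC.
  move=> H1; near=> u => ut.
  have au : a < u by near: u; exact: lt_nbhsr.
  rewrite (kloc u triv U (ltW au) (le_trans ut tb) H).
    by move: ut; near: u.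
  by move: ut; near: u; exact: Unear_l.
- move=> t at_ tb C.
  have [U [oU Ut [triv [ctriv _ H]]]] := bundle_local_triv (bproj B (f1 t)).
  rewrite (kloc t triv U at_ (ltW tb) H Ut) => kC.
  have c1 := ctriv _ Ut.
  have c2 : C1_map_at triv (f2 t) by apply: ctriv; rewrite -E12// ltW.
  have := right_continuous_at_comp (F := fun x => ((triv x.1)^-1 * triv x.2)%g)
    (mulg_inv_continuous c1 c2) (right_continuous_at_pair (r1 t at_ tb) (r2 t at_ tb)) kC.
  move=> H1; near=> u => tu.
  have ub : u < b by near: u; exact: lt_nbhsl.
  rewrite (kloc u triv U (le_trans at_ tu) (ltW ub) H).
    by move: tu; near: u.
  by move: tu; near: u; exact: Unear_r.
move=> t at_ tb ts.
have [e /= e0 He] := (nbhs_ballP _ _).1 (off_finite (s1 ++ s2) t).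
(* Around a non-exceptional t there is an open interval free of exceptional parameters, on all of
   which the velocity of k is 0. *)
apply: (@velocity_constant k (Num.max a (t - e)) (Num.min b (t + e))); last 2 first.
- by rewrite gt_max at_ gtrBl.
- by rewrite lt_min tb ltrDl.
move=> u; rewrite gt_max lt_min => /andP[au eu] /andP[ub ue].
have us : u \notin s1 ++ s2.
  have [->//|ut] := eqVneq u t; apply: He => //.
  by rewrite -ball_normE /= ltr_distlC eu ue.
move: us; rewrite mem_cat negb_or => /andP[us1 us2].
have [U [oU Uu [triv [ctriv _ H]]]] := bundle_local_triv (bproj B (f1 u)).
have c1 := ctriv _ Uu.
have c2 : C1_map_at triv (f2 u) by apply: ctriv; rewrite -E12// ltW.
have hu1 := h1 u au ub us1; have hu2 := h2 u au ub us2.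
have abn : \forall x \near u, a < x /\ x < b.
  by near=> x; split; near: x; [exact: lt_nbhsr|exact: lt_nbhsl].
have [w kw] : exists w : tangent (k u), velocity_at k u w.
  have [p1 [v1 [fv1 _]]] := hu1; have [p2 [v2 [fv2 _]]] := hu2.
  have [E1 cf1 _] := fv1; have [E2 _ _] := fv2; subst p1 p2.
  have [w kw] := velocity_mulg_inv c1 c2 fv1 fv2.
  rewrite (kloc u triv U (ltW au) (ltW ub) H Uu); exists w.
  apply: near_eq_velocity kw.
  have Un : \forall x \near u, U (bproj B (f1 x)).
    apply: (@continuous_comp _ _ _ f1 (bproj B) u cf1 (bproj_C1 B (f1 u)).1).
    exact: open_nbhs_nbhs.
  by apply: filterS2 abn Un => x [ax xb] Ux; rewrite (kloc x triv U)// ltW.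
exists w; split=> //; apply: (horizontal_same_fiber hu1 _ kw).
apply: near_eq_horizontal hu2.
by apply: filterS abn => x [ax xb]; rewrite kE// ltW.
Unshelve. all: by end_near. Qed.

End WeaklyHorizontal.

(** * Existence of horizontal lifts, and operations on horizontal curves *)

Section HorizontalLifts.
Variables (R : realType) (G : lieGroupType R) (P M : manifoldType R).
Variables (B : principal_bundle G P M) (A : connection B).

Local Notation C1P := (fun U g => Ckm 1 (U : set R^o) (g : R^o -> P)).
Local Notation C1M := (fun U g => Ckm 1 (U : set R^o) (g : R^o -> M)).

Lemma horizontal_weakly (c : curve R P) : horizontal A c ->
  weakly_horizontal A (cf c) (ca c) (cb c).
Proof.
move=> [pc hc]; have [_ Hl Hr] := (pc1P c).1 pc.
split=> [t at_ tb|t at_ tb|].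
- exact: left_C1_continuous (Hl t at_ tb).
- exact: right_C1_continuous (Hr t at_ tb).
have [s Hs] := piecewise_off_finite pc; exists s => t at_ tb ts.
have [g cg fg] := Hs t at_ tb ts.
have cft : C1_curve_at (cf c) t.
  by apply: near_eq_C1_curve cg; apply: filterS fg.
have [v fv] := C1_curve_velocity cft.
exists (cf c t), v; split=> //; apply: hc; first by rewrite at_.
by have [_ _] := fv.
Qed.

(** A of the velocity is continuous along the C^1 germ g, and it vanishes at parameters arbitrarily
    close to t on the left, where g coincides with f. *)
Lemma cform_germ_left (f g : R -> P) (a t : R) (s : seq R) : a < t ->
  C1_curve_at g t -> (\forall u \near t, u <= t -> f u = g u) ->
  (forall u, a < u -> u < t -> u \notin s -> horizontal_at A f u) ->
  horizontal_at A g t.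
Proof.
move=> at_ cg fg hf; have [v gv] := C1_curve_velocity cg.
exists (g t), v; split=> //.
have [psi qc] := chart_exists (1%g : G).
have [k [ck kE]] := cform_curve_continuous A cg qc.
suff kt0 : k t = 0.
  move=> chi; apply: (tangent_chart0 _ qc).
  by rewrite (nbhs_singleton kE _ _ gv).
apply/eqP; rewrite -normr_le0; apply/ler_addgt0Pr => d d0; rewrite add0r.
have /cvgrPdist_lt/(_ d d0) kd := nbhs_singleton ck.
have [e /= e0 He] := (nbhs_ballP _ _).1
  (filterI (filterI kd kE) (filterI (nearR_join fg) (off_finite s t))).
pose u := Num.max ((a + t) / 2) (t - e / 2).
have ut : u < t by rewrite gt_max; apply/andP; split; lra.
have au : a < u by rewrite lt_max; apply/orP; left; lra.
have ue : t - e < u by rewrite lt_max; apply/orP; right; lra.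
have [|[ku kEu] [fgu us]] := He u.
  by rewrite -ball_normE /= ger0_norm; lra.
have hu : horizontal_at A g u.
  apply: near_eq_horizontal (hf u au ut (us _)); last by rewrite lt_eqF.
  near=> x; have xt : x <= t by apply/ltW; near: x; exact: lt_nbhsl.
  by move: xt; near: x.
have [p [w [gw w0]]] := hu.
have ku0 : k u = 0 by rewrite -(kEu _ _ gw) w0.
by move: ku; rewrite ku0 subr0 => /ltW.
Unshelve. all: by end_near. Qed.

(* At a break point the velocity, if it exists, is the limit from the left of
   horizontal velocities. *)
Lemma weakly_horizontal_horizontal (c : curve R P) (s : seq R) : pc1 c ->
  (forall t, ca c < t -> t < cb c -> t \notin s -> horizontal_at A (cf c) t) ->
  horizontal A c.
Proof.
move=> pc hs; split=> // t /andP[at_ tb] v fv.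
have [_ Hl _] := (pc1P c).1 pc; have [g cg fg] := Hl t at_ (ltW tb).
have hg : horizontal_at A g t.
  apply: (cform_germ_left (s := s) at_ cg fg) => u au ut us.
  by apply: hs => //; exact: lt_trans ut tb.
have [p [w [gw w0]]] := hg; have [gt _ gD] := gw.
have E : cf c t = p by rewrite (nbhs_singleton fg (lexx t)).
move: w gw w0 gD; rewrite -E => w gw w0 gD.
have [phi pch] := chart_exists (cf c t).
(* [v] is the derivative of the curve and [w] that of the C^1 extension of its left piece; both are
   limits of the same left difference quotients. *)
suff -> : v = w by [].
apply: (tangent_chart_ext pch).
apply: (@left_derivative_unique _ _ (cmap phi \o cf c) (cmap phi \o g) t).
- exact: fv.
- exact: gD.
- by apply: filterS fg => u fg ut /=; rewrite fg.
Qed.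

Lemma lift_exists (c : curve R M) (p : P) : pc1 c -> bproj B p = cstart c ->
  exists d : curve R P, [/\ horizontal A d, ca d = ca c, cb d = cb c,
    cstart d = p & forall t, ca c <= t <= cb c -> bproj B (cf d t) = cf c t].
Proof.
move=> pc pE; have [ab Hl Hr] := (pc1P c).1 pc.
(* The start point is quantified inside [Q], so that a second piece can be started where the first
   one ends. *)
pose Q x y := forall p, bproj B p = cf c x -> exists f : R -> P,
  [/\ f x = p, forall t, x <= t -> t <= y -> bproj B (f t) = cf c t,
      locally_piecewise C1P x y f &
      exists s : seq R, forall t, x < t -> t < y -> t \notin s ->
        horizontal_at A f t].
have Qxx x : Q x x.
  move=> q qE; exists (fun=> q); split=> //.
  - by move=> t xt tx; have -> : t = x by apply/eqP; rewrite eq_le xt tx.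
  - exact: locally_piecewise_point.
  - by exists [::] => t xt /(lt_trans xt); rewrite ltxx.
have Qgood x y f : x <= y -> (forall t, x <= t <= y ->
    [/\ C1_curve_at f t, bproj B (f t) = cf c t & horizontal_at A f t]) -> Q x y.
  move=> xy H q qE.
  have [|_ fx _] := H x; first by rewrite lexx.
  have [h hE] : exists h, q = bact B (f x) h
    by apply: (bact_transitive (B := B)); rewrite fx.
  exists (fun t => bact B (f t) h); split=> [//|t xt ty||].
  - by rewrite bproj_act; have [|_ ->] := H t; rewrite ?xt.
  - apply: locally_piecewise_germ => // t xt ty.
    have [|cft _ _] := H t; first by rewrite xt.
    apply: (@C1_curve_map _ _ _ (bact B ^~ h) f t _ cft).
    by apply: nearW => z; exact: bact_C1l.
  - exists [::] => t xt ty _; apply: horizontal_at_translate.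
    by have [|] := H t; rewrite ?ltW.
have : Q (ca c) (cb c).
  apply: (@interval_induction _ _ _ Q ab).
    move=> x y z _ xy yz _ Qxy Qyz q qE.
    have [f [fx fE fp [s fs]]] := Qxy q qE.
    have [f' [fy fE' fp' [s' fs']]] := Qyz (f y) (fE y xy (lexx y)).
    exists (fun t => if t <= y then f t else f' t); split.
    - by rewrite xy.
    - move=> t xt tz; case: leP => ty; first exact: fE.
      by apply: fE' => //; exact: ltW.
    - apply: (@locally_piecewise_cat _ _ _ _ y).
        by apply: locally_piecewise_congr fp => t xt ->.
      apply: locally_piecewise_congr fp' => t yt tz.
      by case: leP => // ty; have -> : t = y by apply/eqP; rewrite eq_le ty yt.
    (* The junction joins the exceptional set, as the two velocities may differ there. *)
    - exists (y :: s ++ s') => t xt tz.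
      rewrite inE mem_cat !negb_or => /andP[ty /andP[ts ts']].
      have [lty|gty] := ltP t y.
        apply: near_eq_horizontal (fs t xt lty ts); near=> u.
        rewrite ifT//; apply/ltW; near: u; exact: lt_nbhsl.
      have {}gty : y < t by rewrite lt_neqAle eq_sym ty.
      apply: near_eq_horizontal (fs' t gty tz ts'); near=> u.
      by rewrite ifF//; apply/negbTE; rewrite -ltNge; near: u; exact: lt_nbhsr.
  move=> t at_ tb; apply: filterI.
    move: at_; rewrite le_eqVlt => /predU1P[<-|at_].
      by near=> u => au ua; have -> : u = ca c by apply/eqP; rewrite eq_le ua au.
    have [g cg fg] := Hl t at_ tb.
    have [f Hf] := local_horizontal_lift A cg.
    have [e /= e0 He] := (nbhs_ballP _ _).1 (filterI Hf fg).
    near=> u => au ut; apply: (Qgood u t f ut) => x /andP[ux xt].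
    have [|[cx px hx] fgx] := He x; last by split=> //; rewrite px fgx.
    rewrite -ball_normE /= ger0_norm ?subr_ge0// (@le_lt_trans _ _ (t - u))//.
      by rewrite lerD2l lerN2.
    by rewrite ltrBlDr -ltrBlDl; near: u; apply: lt_nbhsr; rewrite gtrBl.
  move: tb; rewrite le_eqVlt => /predU1P[->|tb].
    by near=> u => ub bu; have -> : u = cb c by apply/eqP; rewrite eq_le ub bu.
  have [g cg fg] := Hr t at_ tb.
  have [f Hf] := local_horizontal_lift A cg.
  have [e /= e0 He] := (nbhs_ballP _ _).1 (filterI Hf fg).
  near=> u => ub tu; apply: (Qgood t u f tu) => x /andP[tx xu].
  have [|[cx px hx] fgx] := He x; last by split=> //; rewrite px fgx.
  rewrite -ball_normE /= distrC ger0_norm ?subr_ge0// (@le_lt_trans _ _ (u - t))//.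
    by rewrite lerD2r.
  by rewrite ltrBlDl; near: u; apply: lt_nbhsl; rewrite ltrDl.
move=> /(_ p pE)[f [fa fE fp [s fs]]].
exists (Curve (ca c) (cb c) f); split=> //.
  by apply: (weakly_horizontal_horizontal (s := s)) => //; exact/pc1P.
by move=> t /andP[at_ tb]; exact: fE.
Unshelve. all: by end_near. Qed.

Definition is_lift (d : curve R P) (c : curve R M) : Prop :=
  [/\ horizontal A d, ca d = ca c, cb d = cb c &
      forall t, ca c <= t <= cb c -> bproj B (cf d t) = cf c t].

(** [weakly_horizontal_unique] compares end values only, so it is applied on each interval from
    [ca c] to t. *)
Lemma is_lift_unique (c : curve R M) (d d' : curve R P) :
  is_lift d c -> is_lift d' c -> cstart d = cstart d' ->
  forall t, ca c <= t <= cb c -> cf d t = cf d' t.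
Proof.
move=> [hd da db dE] [hd' da' db' dE'] E t /andP[at_ tb].
have [l1 r1 [s1 h1]] := horizontal_weakly hd.
have [l2 r2 [s2 h2]] := horizontal_weakly hd'.
rewrite /cstart da da' in E.
apply: (@weakly_horizontal_unique _ _ _ _ B A _ _ (ca c) t) => //.
- split; [| |exists s1]; rewrite -da => x ax xt; [apply: l1|apply: r1|
    move=> xs; apply: h1] => //; rewrite db.
  + exact: le_trans xt tb.
  + exact: lt_le_trans xt tb.
  + exact: lt_le_trans xt tb.
- split; [| |exists s2]; rewrite -da' => x ax xt; [apply: l2|apply: r2|
    move=> xs; apply: h2] => //; rewrite db'.
  + exact: le_trans xt tb.
  + exact: lt_le_trans xt tb.
  + exact: lt_le_trans xt tb.
- by move=> x ax xt; rewrite dE ?dE'// ax (le_trans xt tb).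
Qed.

Lemma is_derive_affine (s d t : R) :
  is_derive (t : R^o) 1 (fun u : R^o => s * u + d : R^o) s.
Proof.
have dI : is_derive (t : R^o) 1 (s \*: (id : R^o -> R^o)) (s *: (1 : R^o)).
  exact: is_deriveZ.
have := @is_deriveD R R^o R^o _ (cst d) t 1 _ 0 dI (is_derive_cst _ _ _).
by rewrite addr0 /GRing.scale /= mulr1; exact.
Qed.

(** The two curves may happen to match to first order at the joint; that the velocity is horizontal
    even then is supplied by [weakly_horizontal_horizontal]. *)
Lemma horizontal_cat (c d : curve R P) : horizontal A c -> horizontal A d ->
  cend c = cstart d -> horizontal A (ccat c d).
Proof.
move=> hc hd cd; have [_ _ [s hs]] := horizontal_weakly hc.
have [_ _ [s' hs']] := horizontal_weakly hd.
pose r := cb c - ca d.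
apply: (weakly_horizontal_horizontal (s := cb c :: s ++ [seq x + r | x <- s'])).
  by apply: pc1_cat => //; [case: hc|case: hd].
move=> t /= at_ tb; rewrite inE mem_cat !negb_or => /andP[tc /andP[ts ts']].
have [lt|gt] := ltP t (cb c).
  apply: near_eq_horizontal (hs t at_ lt ts); near=> u.
  by rewrite /= ifT//; apply/ltW; near: u; exact: lt_nbhsl.
have {}gt : cb c < t by rewrite lt_neqAle eq_sym tc.
have hd' : horizontal_at A (cf d) (1 * t - r).
  apply: hs'; rewrite /r mul1r; [lra|lra|].
  by apply: contra ts' => tr; apply/mapP; exists (t - r); rewrite ?subrK.
apply: near_eq_horizontal (horizontal_at_reparam (is_derive_affine 1 (- r) t) hd').
near=> u; rewrite /= ifF; last first.
  by apply/negbTE; rewrite -ltNge; near: u; exact: lt_nbhsr.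
by rewrite /r; congr cf; ring.
Unshelve. all: by end_near. Qed.

Lemma horizontal_rev (c : curve R P) : horizontal A c -> horizontal A (crev c).
Proof.
move=> hc; have [_ _ [s hs]] := horizontal_weakly hc.
pose r := ca c + cb c.
apply: (weakly_horizontal_horizontal (s := [seq r - x | x <- s])).
  by apply: pc1_rev; case: hc.
move=> t /= at_ tb ts.
have hc' : horizontal_at A (cf c) (-1 * t + r).
  apply: hs; rewrite /r mulN1r; [lra|lra|].
  apply: contra ts => tr; apply/mapP; exists (- t + r); rewrite //.
  by rewrite opprD addrCA opprK subrr addr0.
apply: near_eq_horizontal (horizontal_at_reparam (is_derive_affine (-1) r t) hc').
by near=> u; rewrite /= /r; congr cf; ring.
Unshelve. all: by end_near. Qed.

Lemma pc1_comp (N N' : manifoldType R) (F : N -> N') (c : curve R N) :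
  (forall x, C1_map_at F x) -> pc1 c -> pc1 (ccomp F c).
Proof.
move=> cF /pc1P pc; apply/pc1P.
apply: (locally_piecewise_map (F := F)) pc => g t cg.
by apply: (@C1_curve_map _ _ _ F g t _ cg); exact: nearW.
Qed.

Lemma horizontal_translate (c : curve R P) (g : G) : horizontal A c ->
  horizontal A (ccomp (bact B ^~ g) c).
Proof.
move=> hc; have [_ _ [s hs]] := horizontal_weakly hc.
apply: (weakly_horizontal_horizontal (s := s)).
  by apply: pc1_comp; [exact: bact_C1l|case: hc].
by move=> t at_ tb ts; apply: horizontal_at_translate; exact: hs.
Qed.

End HorizontalLifts.

(** * Backtrack equivalence *)

(** If y were missed, the truth value of phi t < y would be locally constant on either side, hence
    equal at a and b by interval induction. *)
Lemma one_sided_ivt (R : realType) (phi : R -> R) (a b y : R) : a <= b ->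
  (forall t, a < t -> t <= b -> left_continuous_at phi t) ->
  (forall t, a <= t -> t < b -> right_continuous_at phi t) ->
  phi a <= y -> y <= phi b -> exists2 t, a <= t <= b & phi t = y.
Proof.
move=> ab Hl Hr ay yb; apply: contrapT => nex.
have neq t : a <= t -> t <= b -> phi t != y.
  by move=> at_ tb; apply/eqP => ty; apply: nex; exists t => //; rewrite at_.
suff : (phi a < y) = (phi b < y).
  by rewrite lt_neqAle ay neq// => /esym; rewrite ltNge yb.
apply: (@interval_induction _ a b (fun x z => (phi x < y) = (phi z < y))) => //.
  by move=> x x' z _ _ _ _ -> ->.
move=> t at_ tb.
have side : nbhs (phi t) [set z | (z < y) = (phi t < y)].
  have := neq t at_ tb; rewrite neq_lt => /orP[ty|yt].
    by near=> z => /=; rewrite ty; near: z; exact: lt_nbhsl.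
  near=> z => /=; rewrite (ltNge (phi t)) (ltW yt) ltNge; apply/negbF/ltW.
  by near: z; exact: lt_nbhsr.
apply: filterI.
  move: at_; rewrite le_eqVlt => /predU1P[<-|at_].
    by near=> u => au ua; have -> : u = a by apply/eqP; rewrite eq_le ua au.
  by apply: filterS (Hl t at_ tb _ side) => u H _ /H.
move: tb; rewrite le_eqVlt => /predU1P[->|tb].
  by near=> u => ub bu; have -> : u = b by apply/eqP; rewrite eq_le ub bu.
by apply: filterS (Hr t at_ tb _ side) => u H _ /H.
Unshelve. all: by end_near. Qed.

Lemma left_C1_real_continuous (R : realType) (phi : R -> R) (t : R) :
  left_C1 (fun U g => Ck 1 (U : set R^o) (g : R^o -> R^o)) phi t ->
  left_continuous_at phi t.
Proof.
move=> [g cg fg] S; rewrite (nbhs_singleton fg (lexx t)) => gS.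
have := C1_at_continuous cg gS.
by apply: filterS2 fg => u fg Sgu ut; rewrite fg.
Qed.

Lemma right_C1_real_continuous (R : realType) (phi : R -> R) (t : R) :
  right_C1 (fun U g => Ck 1 (U : set R^o) (g : R^o -> R^o)) phi t ->
  right_continuous_at phi t.
Proof.
move=> [g cg fg] S; rewrite (nbhs_singleton fg (lexx t)) => gS.
have := C1_at_continuous cg gS.
by apply: filterS2 fg => u fg Sgu ut; rewrite fg.
Qed.

(** * Reparametrization and backtrack equivalence as congruences for concatenation *)

Section BacktrackCalculus.
Variables (R : realType) (M : manifoldType R).
Implicit Types c d e : curve R M.

Local Notation C1R := (fun U g => Ck 1 (U : set R^o) (g : R^o -> R^o)).

Lemma reparam_ends c1 c2 (phi : R -> R) :
  ca c1 <= cb c1 -> ca c2 <= cb c2 ->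
  {in `[ca c2, cb c2]%classic &, {homo phi : s t / s < t}} ->
  phi @` `[ca c2, cb c2]%classic = `[ca c1, cb c1]%classic ->
  phi (ca c2) = ca c1 /\ phi (cb c2) = cb c1.
Proof.
move=> ab1 ab2 mono img.
have inI (c : curve R M) t : (t \in `[ca c, cb c]%classic) = (ca c <= t <= cb c).
  by apply/idP/idP => [/set_mem|H]; [|apply/mem_set]; rewrite /= in_itv.
have le s t : ca c2 <= s <= cb c2 -> ca c2 <= t <= cb c2 -> s <= t ->
    phi s <= phi t.
  move=> sI tI; rewrite le_eqVlt => /predU1P[->//|st].
  by apply/ltW/mono => //; rewrite inI.
have a2 : ca c2 <= ca c2 <= cb c2 by rewrite lexx.
have b2 : ca c2 <= cb c2 <= cb c2 by rewrite lexx ab2.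
have im t : ca c2 <= t <= cb c2 -> ca c1 <= phi t <= cb c1.
  move=> tI; suff : `[ca c1, cb c1]%classic (phi t) by rewrite /= in_itv.
  by rewrite -img; exists t => //; rewrite /= in_itv.
have ex y : ca c1 <= y <= cb c1 -> exists2 t, ca c2 <= t <= cb c2 & phi t = y.
  move=> yI; have : (phi @` `[ca c2, cb c2]%classic) y by rewrite img /= in_itv.
  by move=> [t]; rewrite /= in_itv/= => tI <-; exists t.
split; apply/eqP; rewrite eq_le; apply/andP; split.
- have [|t tI <-] := ex (ca c1); first by rewrite lexx.
  by apply: le => //; case/andP: tI.
- by have /andP[] := im _ a2.
- by have /andP[] := im _ b2.
- have [|t tI <-] := ex (cb c1); first by rewrite lexx ab1.
  by apply: le => //; case/andP: tI.
Qed.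

(* The conditions at the endpoints replace surjectivity, by the intermediate
   value theorem. *)
Lemma reparamP c1 c2 : reparam c1 c2 <-> [/\ pc1 c1, pc1 c2 & exists phi : R -> R,
  [/\ locally_piecewise C1R (ca c2) (cb c2) phi,
      forall s t, ca c2 <= s -> s < t -> t <= cb c2 -> phi s < phi t,
      phi (ca c2) = ca c1, phi (cb c2) = cb c1 &
      forall t, ca c2 <= t -> t <= cb c2 -> cf c2 t = cf c1 (phi t)]].
Proof.
split=> [[pc1 pc2 [phi [pp mono img E]]]|[pc1 pc2 [phi [pp mono pa pb E]]]].
  split=> //; exists phi.
  have [pa pb] := reparam_ends (pc1_le pc1) (pc1_le pc2) mono img.
  split=> //; first exact: piecewise_local.
    move=> s t as_ st tb; apply: mono => //; apply/mem_set; rewrite /= in_itv/=.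
      by rewrite as_ (le_trans (ltW st) tb).
    by rewrite (le_trans as_ (ltW st)) tb.
  by move=> t at_ tb; apply: E; apply/mem_set; rewrite /= in_itv/= at_.
split=> //; exists phi; split.
- exact: local_piecewise.
- move=> s t /set_mem; rewrite /= in_itv/= => /andP[as_ _] /set_mem.
  by rewrite /= in_itv/= => /andP[_ tb] st; exact: mono.
- have mono_le s t : ca c2 <= s -> s <= t -> t <= cb c2 -> phi s <= phi t.
    move=> as_; rewrite le_eqVlt => /predU1P[->//|st] tb.
    by apply/ltW/mono.
  apply/seteqP; split=> [y [t]|y]; rewrite /= !in_itv/=.
    move=> /andP[at_ tb] <-; rewrite -pa -pb.
    by rewrite !mono_le// ?pc1_le.
  move=> /andP[ay yb].
  have [_ Hl Hr] := pp.
  have [||||t tI ty] := @one_sided_ivt R phi (ca c2) (cb c2) y (pc1_le pc2).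
  + by move=> t at_ tb; exact: left_C1_real_continuous (Hl t at_ tb).
  + by move=> t at_ tb; exact: right_C1_real_continuous (Hr t at_ tb).
  + by rewrite pa.
  + by rewrite pb.
  + by exists t; rewrite //= in_itv.
- by move=> t /set_mem; rewrite /= in_itv/= => /andP[at_ tb]; exact: E.
Qed.

Lemma reparam_shift (r : R) c c' : pc1 c -> pc1 c' ->
  ca c = ca c' + r -> cb c = cb c' + r ->
  (forall t, ca c' <= t -> t <= cb c' -> cf c' t = cf c (t + r)) ->
  reparam c c'.
Proof.
move=> pc pc' ac bc E; apply/reparamP; split=> //.
exists (fun t => t + r); split=> //.
  apply: locally_piecewise_germ; first exact: pc1_le.
  move=> t _ _; apply: near_eq_C1_at (C1_at_affine 1 r t).
  by near=> u; rewrite mulr1.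
by move=> s t _ st _; rewrite ltrD2r.
Unshelve. all: by end_near. Qed.

(** Equality of curves as records would also compare the values outside the interval; this is the
    equality that matters. *)
Lemma reparam_congr c c' : pc1 c -> ca c = ca c' -> cb c = cb c' ->
  (forall t, ca c <= t <= cb c -> cf c t = cf c' t) -> reparam c c'.
Proof.
move=> pc ac bc E; apply: (@reparam_shift 0) => //; rewrite ?addr0//.
  exact: pc1_congr pc.
by move=> t at_ tb; rewrite addr0 E// ac bc at_.
Qed.

Lemma same_path_step c c' : reparam c c' -> same_path c c'.
Proof. exact: rst_step. Qed.

Lemma same_path_refl c : same_path c c.
Proof. exact: rst_refl. Qed.

Lemma same_path_sym c c' : same_path c c' -> same_path c' c.
Proof. exact: rst_sym. Qed.

Lemma same_path_trans c d e : same_path c d -> same_path d e -> same_path c e.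
Proof. exact: rst_trans. Qed.

Lemma cstart_cat c d : pc1 c -> cstart (ccat c d) = cstart c.
Proof. by move=> /pc1_le ab; rewrite /cstart /= ab. Qed.

Lemma cend_cat c d : pc1 d -> cend c = cstart d -> cend (ccat c d) = cend d.
Proof.
move=> /pc1_le ab cd; rewrite /cend /= gerDl subr_le0.
have [ba|_] := leP (cb d) (ca d); last by congr cf; ring.
have E : ca d = cb d by apply/eqP; rewrite eq_le ab ba.
by rewrite -E subrr addr0 -/(cend c) cd.
Qed.

Lemma cstart_rev c : cstart (crev c) = cend c.
Proof. by rewrite /cstart /cend /= (_ : ca c + cb c - ca c = cb c)//; ring. Qed.

Lemma cend_rev c : cend (crev c) = cstart c.
Proof. by rewrite /cend /= addrK. Qed.

Lemma reparam_pc1 c c' : reparam c c' -> [/\ pc1 c, pc1 c',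
  cstart c = cstart c' & cend c = cend c'].
Proof.
move=> /reparamP[pc pc' [phi [_ _ pa pb E]]]; split=> //.
  by rewrite /cstart E ?lexx ?pc1_le// pa.
by rewrite /cend E ?lexx ?pc1_le// pb.
Qed.

(** [pc1] appears as an equivalence because the reflexive closure also relates curves that are not
    piecewise C^1 to themselves. *)
Lemma same_path_inv c c' : same_path c c' ->
  [/\ pc1 c <-> pc1 c', cstart c = cstart c' & cend c = cend c'].
Proof.
elim=> [x y /reparam_pc1[px py sE eE]|x|
  x y _ [h1 h2 h3]|x y z _ [h1 h2 h3] _ [h4 h5 h6]].
- by split.
- by split.
- by split=> //; exact: iff_sym.
- by split; [exact: iff_trans h4|rewrite h2|rewrite h3].
Qed.

Lemma reparam_catl c c' e : reparam c c' -> pc1 e -> cend c = cstart e ->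
  reparam (ccat c e) (ccat c' e).
Proof.
move=> cc' pe ce; have [pc pc' sE eE] := reparam_pc1 cc'.
move: cc' => /reparamP[_ _ [phi [pp mono pa pb E]]].
have ab := pc1_le pc; have ab' := pc1_le pc'; have abe := pc1_le pe.
have ep : 0 <= cb e - ca e by rewrite subr_ge0.
apply/reparamP; split; [exact: pc1_cat|by apply: pc1_cat => //; rewrite -eE|].
(* The second halves differ by a translation, the parameter of [e] being merely shifted by the end
   of the first curve. *)
pose psi t := if t <= cb c' then phi t else t + (cb c - cb c').
have psil t : t <= cb c' -> psi t = phi t by rewrite /psi => ->.
have psir t : cb c' <= t -> psi t = t + (cb c - cb c').
  rewrite /psi le_eqVlt => /predU1P[<-|ct]; first by rewrite lexx pb; ring.
  by rewrite leNgt ct.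
exists psi; split=> /=.
- apply: (@locally_piecewise_cat _ _ _ _ (cb c')).
    by apply: locally_piecewise_congr pp => t at_ tb; rewrite psil.
  apply: (@locally_piecewise_congr _ _ _ _ _ (fun t => t + (cb c - cb c'))).
    by move=> t at_ tb; rewrite psir.
  apply: locally_piecewise_germ; first by rewrite lerDl.
  move=> t _ _; apply: near_eq_C1_at (C1_at_affine 1 (cb c - cb c') t).
  by near=> u; rewrite mulr1.
- move=> s t as_ st te; have [tc|ct] := leP t (cb c').
    by rewrite !psil ?(le_trans (ltW st))//; exact: mono.
  have [sc|cs] := leP s (cb c'); last by rewrite (psir _ (ltW cs)) (psir _ (ltW ct))
    ltrD2r.
  rewrite psil// (psir _ (ltW ct)); apply: (@le_lt_trans _ _ (cb c)).
    rewrite -pb; move: sc; rewrite le_eqVlt => /predU1P[->//|sc].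
    by apply/ltW/mono.
  by lra.
- by rewrite psil// pa.
- by rewrite psir ?lerDl//; ring.
- move=> t at_ te; have [tc|ct] := leP t (cb c').
    rewrite psil// E//; rewrite ifT// -pb.
    move: tc; rewrite le_eqVlt => /predU1P[->//|tc].
    by apply/ltW/mono.
  rewrite (psir _ (ltW ct)) ifF; last by apply/negbTE; rewrite -ltNge; lra.
  by congr cf; ring.
Unshelve. all: by end_near. Qed.

Lemma C1R_shift (r : R) (g : R -> R) t :
  C1germ C1R g (t + r) -> C1germ C1R (fun u => g (u + r)) t.
Proof.
move=> cg.
have ca : C1_at (fun u : R^o => u + r : R^o) (t : R^o).
  by apply: near_eq_C1_at (C1_at_affine 1 r t); near=> u; rewrite mulr1.
exact: (@C1_at_comp R R^o R^o R^o (fun u => u + r) g t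
  (@finite_coordinates_R R) ca cg).
Unshelve. all: by end_near. Qed.

Lemma C1R_addr (r : R) (g : R -> R) t :
  C1germ C1R g t -> C1germ C1R ((fun u => u + r) \o g) t.
Proof.
move=> cg; have := C1_atD cg (C1_at_cst (r : R^o) (t : R^o)).
by apply: near_eq_C1_at; near=> u.
Unshelve. all: by end_near. Qed.

Lemma reparam_catr c c' e : reparam c c' -> pc1 e -> cend e = cstart c ->
  reparam (ccat e c) (ccat e c').
Proof.
move=> cc' pe ce; have [pc pc' sE eE] := reparam_pc1 cc'.
move: cc' => /reparamP[_ _ [phi [pp mono pa pb E]]].
have ab := pc1_le pc; have ab' := pc1_le pc'; have abe := pc1_le pe.
have ep : 0 <= cb c' - ca c' by rewrite subr_ge0.
have ep' : 0 <= cb c - ca c by rewrite subr_ge0.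
apply/reparamP; split; [exact: pc1_cat|by apply: pc1_cat => //; rewrite -sE|].
(* Inside [ccat e _] the parameters of [c'] and [c] are shifted, by [- r] and [r']; phi is
   conjugated accordingly. *)
pose r := ca c' - cb e; pose r' := cb e - ca c.
pose psi t := if t <= cb e then t else phi (t + r) + r'.
have psil t : t <= cb e -> psi t = t by rewrite /psi => ->.
have psir t : cb e <= t -> psi t = phi (t + r) + r'.
  rewrite /psi le_eqVlt => /predU1P[<-|ct].
    by rewrite lexx /r /r' subrKC pa; ring.
  by rewrite leNgt ct.
have phi_lt t : cb e < t -> t <= cb e + (cb c' - ca c') -> ca c < phi (t + r).
  by move=> et te; rewrite -pa; apply: mono; rewrite /r; lra.
exists psi; split=> /=.
- apply: (@locally_piecewise_cat _ _ _ _ (cb e)).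
    apply: (@locally_piecewise_congr _ _ _ _ _ id).
      by move=> t at_ tb; rewrite psil.
    by apply: locally_piecewise_germ => // t _ _; exact: C1_at_id.
  apply: (@locally_piecewise_congr _ _ _ _ _ (fun t => phi (t + r) + r')).
    by move=> t at_ tb; rewrite psir.
  apply: (locally_piecewise_map (F := fun u => u + r') (C1R_addr r')).
  apply: locally_piecewise_shift; first by move=> g t; exact: C1R_shift.
  have -> : cb e + r = ca c' by rewrite /r; ring.
  by have -> : cb e + (cb c' - ca c') + r = cb c' by rewrite /r; ring.
- move=> s t as_ st te; have [tc|ct] := leP t (cb e).
    by rewrite !psil ?(le_trans (ltW st)).
  have [sc|cs] := leP s (cb e).
    rewrite psil// (psir _ (ltW ct)); apply: le_lt_trans sc _.
    by have := phi_lt t ct te; rewrite /r'; lra.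
  by rewrite (psir _ (ltW cs)) (psir _ (ltW ct)) ltrD2r; apply: mono; rewrite /r; lra.
- by rewrite psil.
- rewrite psir ?lerDl//.
  have -> : cb e + (cb c' - ca c') + r = cb c' by rewrite /r; ring.
  by rewrite pb /r'; ring.
- move=> t at_ te; have [tc|ct] := leP t (cb e); first by rewrite psil// tc.
  have H := phi_lt t ct te.
  rewrite (psir _ (ltW ct)) ifF; last by apply/negbTE; rewrite -ltNge /r'; lra.
  have -> : ca c' + (t - cb e) = t + r by rewrite /r; ring.
  have -> : ca c + (phi (t + r) + r' - cb e) = phi (t + r) by rewrite /r'; ring.
  by apply: E; rewrite /r; lra.
Qed.

Lemma same_path_catl c c' e : same_path c c' -> pc1 e -> cend c = cstart e ->
  same_path (ccat c e) (ccat c' e).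
Proof.
move=> cc' pe; elim: cc' => [x y xy ce|x ce|x y xy IH ce|x y z xy IH1 yz IH2 ce].
- by apply: same_path_step; exact: reparam_catl.
- exact: same_path_refl.
- by apply: same_path_sym; apply: IH; have [_ _ ->] := same_path_inv xy.
- apply: same_path_trans (IH1 ce) (IH2 _).
  by have [_ _ <-] := same_path_inv xy.
Qed.

Lemma same_path_catr c c' e : same_path c c' -> pc1 e -> cend e = cstart c ->
  same_path (ccat e c) (ccat e c').
Proof.
move=> cc' pe; elim: cc' => [x y xy ce|x ce|x y xy IH ce|x y z xy IH1 yz IH2 ce].
- by apply: same_path_step; exact: reparam_catr.
- exact: same_path_refl.
- by apply: same_path_sym; apply: IH; have [_ -> _] := same_path_inv xy.
- apply: same_path_trans (IH1 ce) (IH2 _).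
  by have [_ <- _] := same_path_inv xy.
Qed.

(** [ccat] adds lengths instead of rescaling, so both bracketings give the same values on the same
    interval. *)
Lemma same_path_catA c d e : pc1 c -> pc1 d -> pc1 e -> cend c = cstart d ->
  cend d = cstart e -> same_path (ccat (ccat c d) e) (ccat c (ccat d e)).
Proof.
move=> pc pd pe cd de; apply: same_path_step; apply: reparam_congr.
- by apply: pc1_cat => //; [exact: pc1_cat|rewrite cend_cat].
- by [].
- by rewrite /=; ring.
move=> t /= /andP[at_ te]; have abd := pc1_le pd.
have [tc|ct] := leP t (cb c); first by rewrite ifT//; lra.
have [td|dt] := leP t (cb c + (cb d - ca d)).
  by rewrite ifT//; lra.
rewrite ifF; last by apply/negbTE; rewrite -ltNge; lra.
by congr cf; ring.
Qed.

Lemma same_path_cat_point c x : pc1 c -> cend c = x ->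
  same_path (ccat c (Defs.cpoint R x)) c.
Proof.
move=> pc cx; apply: same_path_step; apply: reparam_congr => /=.
- by apply: pc1_cat => //; exact: pc1_point.
- by [].
- by rewrite subrr addr0.
by move=> t; rewrite subrr addr0 => /andP[_ ->].
Qed.

Lemma same_path_point_cat c x : pc1 c -> cstart c = x ->
  same_path (ccat (Defs.cpoint R x) c) c.
Proof.
move=> pc cx; apply: same_path_sym; apply: same_path_step.
apply: (@reparam_shift (ca c)) => //=.
- by apply: pc1_cat => //; exact: pc1_point.
- by rewrite add0r.
- by rewrite add0r subrK.
move=> t t0 _; rewrite subr0; case: leP => tt; last by rewrite addrC.
by have -> : t = 0; [apply/eqP; rewrite eq_le tt t0|rewrite add0r -cx].
Qed.

(** Reparametrization is not by itself a generator of [bt_equiv]; a backtrack along a one-point path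
    absorbs it. *)
Lemma same_path_bt c c' : pc1 c -> same_path c c' -> bt_equiv c c'.
Proof.
move=> pc cc'; apply: rst_step; pose x := Defs.cpoint R (cend c).
have px : pc1 x by exact: pc1_point.
have [pcc' _ _] := same_path_inv cc'.
have cx : same_path (ccat c x) c by exact: same_path_cat_point.
have ecx : cend (ccat c x) = cend c by rewrite cend_cat.
have pcx : pc1 (ccat c x) by exact: pc1_cat.
have prx : pc1 (crev x) by exact: pc1_rev.
have erx : cend c = cstart (crev x) by [].
exists c, x, x; split=> //; split; [by []|exact/pcc'|left; split].
  have step d : pc1 d -> cend d = cend c -> same_path d (ccat d x).
    by move=> pd ed; apply: same_path_sym; exact: same_path_cat_point.
  have rx : crev x = x by [].
  rewrite rx; have p1 : pc1 (ccat (ccat c x) x) by apply: pc1_cat.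
  have e1 : cend (ccat (ccat c x) x) = cend c by rewrite cend_cat.
  apply: same_path_trans (step _ pc erefl) _.
  apply: same_path_trans (step _ pcx ecx) _.
  exact: step.
apply: same_path_trans (same_path_sym cc') _; exact: same_path_sym.
Qed.

Lemma pc1_long a b d : pc1 a -> pc1 b -> pc1 d -> cend a = cstart d ->
  cend a = cstart b -> [/\ pc1 (ccat (ccat a d) (crev d)),
    cend (ccat (ccat a d) (crev d)) = cstart b &
    pc1 (ccat (ccat (ccat a d) (crev d)) b)].
Proof.
move=> pa pb pd ad ab.
have pr := pc1_rev pd; have p1 : pc1 (ccat a d) by exact: pc1_cat.
have e1 : cend (ccat a d) = cstart (crev d) by rewrite cend_cat// cstart_rev.
have p2 : pc1 (ccat (ccat a d) (crev d)) by exact: pc1_cat.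
have e2 : cend (ccat (ccat a d) (crev d)) = cstart b.
  by rewrite cend_cat// cend_rev -ad.
by split=> //; exact: pc1_cat.
Qed.

Lemma elem_backtrack_inv c c' : elem_backtrack c c' ->
  [/\ pc1 c, pc1 c', cstart c = cstart c' & cend c = cend c'].
Proof.
move=> [a [b [d [[pa pb pd] ad ab [pc pc' H]]]]].
have [p1 e1 p2] := pc1_long pa pb pd ad ab.
have p3 : pc1 (ccat a d) by exact: pc1_cat.
have sl : cstart (ccat (ccat (ccat a d) (crev d)) b) = cstart (ccat a b).
  by rewrite !cstart_cat.
have el : cend (ccat (ccat (ccat a d) (crev d)) b) = cend (ccat a b).
  by rewrite (cend_cat pb e1) (cend_cat pb ab).
by split=> //; case: H => -[/same_path_inv[_ s1 s2] /same_path_inv[_ s3 s4]];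
  rewrite ?s1 ?s2 ?s3 ?s4.
Qed.

Lemma bt_equiv_inv c c' : bt_equiv c c' ->
  [/\ pc1 c <-> pc1 c', cstart c = cstart c' & cend c = cend c'].
Proof.
elim=> [x y /elem_backtrack_inv[px py sE eE]|x|
  x y _ [h1 h2 h3]|x y z _ [h1 h2 h3] _ [h4 h5 h6]].
- by split.
- by split.
- by split=> //; exact: iff_sym.
- by split; [exact: iff_trans h4|rewrite h2|rewrite h3].
Qed.

(** A curve appended at the end is absorbed by the last factor: a d d^-1 b e is a backtrack with [b]
    replaced by b e. *)
Lemma bt_catl c c' e : bt_equiv c c' -> pc1 e -> cend c = cstart e ->
  bt_equiv (ccat c e) (ccat c' e).
Proof.
move=> cc' pe; elim: cc' => [x y xy ce|x ce|x y xy IH ce|x y z xy IH1 yz IH2 ce].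
- apply: rst_step; have [px py sE eE] := elem_backtrack_inv xy.
  have [a [b [d [[pa pb pd] ad ab [_ _ H]]]]] := xy.
  have [p1 e1 p2] := pc1_long pa pb pd ad ab.
  have eb : cend b = cstart e.
    rewrite -ce; case: H => -[/same_path_inv[_ _ ->] _]; by rewrite cend_cat.
  have long z : cend z = cstart e ->
      same_path z (ccat (ccat (ccat a d) (crev d)) b) ->
      same_path (ccat z e) (ccat (ccat (ccat a d) (crev d)) (ccat b e)).
    move=> ze zl; apply: same_path_trans (same_path_catl zl pe ze) _.
    exact: same_path_catA.
  have short z : cend z = cstart e -> same_path z (ccat a b) ->
      same_path (ccat z e) (ccat a (ccat b e)).
    move=> ze zl; apply: same_path_trans (same_path_catl zl pe ze) _.
    exact: same_path_catA.
  have ye : cend y = cstart e by rewrite -eE.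
  exists a, (ccat b e), d; split=> //.
  + by split=> //; exact: pc1_cat.
  + by rewrite cstart_cat.
  split; [exact: pc1_cat|exact: pc1_cat|].
  by case: H => -[h1 h2]; [left|right]; split; do ?[exact: long|exact: short].
- exact: rst_refl.
- by apply: rst_sym; apply: IH; have [_ _ ->] := bt_equiv_inv xy.
- apply: rst_trans (IH1 ce) (IH2 _).
  by have [_ _ <-] := bt_equiv_inv xy.
Qed.

(** Symmetrically, a curve put in front is absorbed by the first factor, with [a] replaced by e
    a. *)
Lemma bt_catr c c' e : bt_equiv c c' -> pc1 e -> cend e = cstart c ->
  bt_equiv (ccat e c) (ccat e c').
Proof.
move=> cc' pe; elim: cc' => [x y xy ce|x ce|x y xy IH ce|x y z xy IH1 yz IH2 ce].
- apply: rst_step; have [px py sE eE] := elem_backtrack_inv xy.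
  have [a [b [d [[pa pb pd] ad ab [_ _ H]]]]] := xy.
  have [p1 e1 p2] := pc1_long pa pb pd ad ab.
  have pr := pc1_rev pd; have p3 : pc1 (ccat a d) by exact: pc1_cat.
  have e3 : cend (ccat a d) = cstart (crev d) by rewrite cend_cat// cstart_rev.
  have ea : cend e = cstart a.
    by rewrite ce; case: H => -[/same_path_inv[_ -> _] _]; rewrite !cstart_cat.
  have pea : pc1 (ccat e a) by exact: pc1_cat.
  have eea : cend (ccat e a) = cend a by rewrite cend_cat.
  have long z : cend e = cstart z ->
      same_path z (ccat (ccat (ccat a d) (crev d)) b) ->
      same_path (ccat e z) (ccat (ccat (ccat (ccat e a) d) (crev d)) b).
    move=> ez zl; apply: same_path_trans (same_path_catr zl pe ez) _.
    have q1 : cend e = cstart (ccat a d) by rewrite cstart_cat.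
    have q2 : cend e = cstart (ccat (ccat a d) (crev d)) by rewrite cstart_cat.
    apply: same_path_trans (same_path_sym (same_path_catA pe p1 pb q2 e1)) _.
    apply: same_path_catl => //; last by rewrite cend_cat.
    apply: same_path_trans (same_path_sym (same_path_catA pe p3 pr q1 e3)) _.
    apply: same_path_catl => //; last by rewrite cend_cat.
    exact/same_path_sym/same_path_catA.
  have short z : cend e = cstart z -> same_path z (ccat a b) ->
      same_path (ccat e z) (ccat (ccat e a) b).
    move=> ez zl; apply: same_path_trans (same_path_catr zl pe ez) _.
    exact/same_path_sym/same_path_catA.
  have ye : cend e = cstart y by rewrite -sE.
  exists (ccat e a), b, d; split=> //; rewrite ?eea//.
  split; [exact: pc1_cat|exact: pc1_cat|].
  by case: H => -[h1 h2]; [left|right]; split; do ?[exact: long|exact: short].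
- exact: rst_refl.
- by apply: rst_sym; apply: IH; have [_ -> _] := bt_equiv_inv xy.
- apply: rst_trans (IH1 ce) (IH2 _).
  by have [_ <- _] := bt_equiv_inv xy.
Qed.

Lemma bt_cat c c' d d' : pc1 c -> pc1 d -> cend c = cstart d ->
  bt_equiv c c' -> bt_equiv d d' -> bt_equiv (ccat c d) (ccat c' d').
Proof.
move=> pc pd cd cc' dd'; apply: rst_trans (bt_catl cc' pd cd) _.
have [pcc' _ ec] := bt_equiv_inv cc'.
by apply: bt_catr => //; [exact/pcc'|rewrite -ec].
Qed.

End BacktrackCalculus.

Section BacktrackMap.
Variables (R : realType) (M N : manifoldType R) (F : M -> N).
Hypothesis cF : forall x, C1_map_at F x.

Lemma ccomp_cat (c d : curve R M) :
  ccomp F (ccat c d) = ccat (ccomp F c) (ccomp F d).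
Proof. by congr Curve; apply/funext => t /=; case: ifP. Qed.

Lemma same_path_map (c c' : curve R M) :
  same_path c c' -> same_path (ccomp F c) (ccomp F c').
Proof.
elim=> [x y /reparamP[px py [phi [pp mono pa pb E]]]|x|x y _|x y z _ h1 _ h2].
- apply: same_path_step; apply/reparamP; split; [exact: pc1_comp..|].
  by exists phi; split=> // t at_ tb /=; rewrite E.
- exact: same_path_refl.
- exact: same_path_sym.
- exact: same_path_trans h1 h2.
Qed.

Lemma bt_map (c c' : curve R M) :
  bt_equiv c c' -> bt_equiv (ccomp F c) (ccomp F c').
Proof.
elim=> [x y|x|x y _|x y z _ h1 _ h2].
- move=> [a [b [d [[pa pb pd] ad ab [px py H]]]]]; apply: rst_step.
  exists (ccomp F a), (ccomp F b), (ccomp F d); split.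
  + by split; exact: pc1_comp.
  + by have := congr1 F ad.
  + by have := congr1 F ab.
  split; [exact: pc1_comp..|].
  rewrite (_ : crev (ccomp F d) = ccomp F (crev d))// -!ccomp_cat.
  by case: H => -[h1 h2]; [left|right]; split; exact: same_path_map.
- exact: rst_refl.
- exact: rst_sym.
- exact: rst_trans h1 h2.
Qed.

End BacktrackMap.

(** * Lifting backtrack equivalence *)

Section LiftBacktrack.
Variables (R : realType) (G : lieGroupType R) (P M : manifoldType R).
Variables (B : principal_bundle G P M) (A : connection B).

Local Notation C1R := (fun U g => Ck 1 (U : set R^o) (g : R^o -> R^o)).
Local Notation lift := (is_lift A).

Lemma is_lift_pc1 d c : lift d c -> [/\ pc1 d, pc1 c & bproj B (cstart d) = cstart c].
Proof.
move=> [[pd _] da db dE]; have ab := pc1_le pd; split=> //.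
  apply: (@pc1_congr _ _ (ccomp (bproj B) d)) => //.
    by move=> t; rewrite /= da db; exact: dE.
  by apply: pc1_comp => //; exact: bproj_C1.
by rewrite /cstart da dE// lexx -da -db.
Qed.

Lemma is_lift_cat d c d' c' : lift d c -> lift d' c' -> cend d = cstart d' ->
  lift (ccat d d') (ccat c c').
Proof.
move=> [hd da db dE] [hd' da' db' dE'] dd'; split=> /=.
- exact: horizontal_cat.
- by [].
- by rewrite db da' db'.
move=> t /andP[at_ tb]; rewrite db; case: leP => tc.
  by apply: dE; rewrite at_.
by rewrite da'; apply: dE'; apply/andP; split; lra.
Qed.

Lemma is_lift_rev d c : lift d c -> lift (crev d) (crev c).
Proof.
move=> [hd da db dE]; split=> //=; first exact: horizontal_rev.
move=> t /andP[at_ tb]; rewrite da db; apply: dE; apply/andP; split; lra.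
Qed.

Lemma is_lift_translate d c g : lift d c -> lift (ccomp (bact B ^~ g) d) c.
Proof.
move=> [hd da db dE]; split=> //; first exact: horizontal_translate.
by move=> t tab /=; rewrite bproj_act dE.
Qed.

(** Monotonicity carries left limits to left limits, and where phi is differentiable the velocity is
    a multiple, possibly zero, of a horizontal one. *)
Lemma weakly_horizontal_reparam (d : curve R P) (a b : R) (phi : R -> R) :
  horizontal A d -> locally_piecewise C1R a b phi ->
  (forall s t, a <= s -> s < t -> t <= b -> phi s < phi t) ->
  phi a = ca d -> phi b = cb d ->
  weakly_horizontal A (cf d \o phi) a b.
Proof.
move=> hd pp mono pa pb; have [l r [s hs]] := horizontal_weakly hd.
have [ab Hl Hr] := pp.
have mono_le x y : a <= x -> x <= y -> y <= b -> phi x <= phi y.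
  by move=> ax; rewrite le_eqVlt => /predU1P[->//|xy] yb; exact/ltW/mono.
split=> [t at_ tb C AC|t at_ tb C AC|].
- have ct : ca d < phi t by rewrite -pa; exact: mono.
  have td : phi t <= cb d by rewrite -pb; exact: mono_le (ltW at_) tb (lexx b).
  have := left_C1_real_continuous (Hl t at_ tb) (l _ ct td _ AC).
  move=> H; near=> u => ut; have au : a < u by near: u; exact: lt_nbhsr.
  have H' : u <= t -> phi u <= phi t -> C (cf d (phi u)) by near: u.
  by apply: H' => //; exact: mono_le (ltW au) ut tb.
- have ct : ca d <= phi t by rewrite -pa; exact: mono_le (lexx a) at_ (ltW tb).
  have td : phi t < cb d by rewrite -pb; exact: mono.
  have := right_C1_real_continuous (Hr t at_ tb) (r _ ct td _ AC).
  move=> H; near=> u => tu; have ub : u < b by near: u; exact: lt_nbhsl.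
  have H' : t <= u -> phi t <= phi u -> C (cf d (phi u)) by near: u.
  by apply: H' => //; exact: mono_le at_ tu (ltW ub).
have [s' Hs'] := piecewise_off_finite (local_piecewise pp).
(* The inverse of phi serves only to pull the finite exceptional set back; 0 is its value off the
   image. *)
pose psi x := xget 0 [set t | a <= t /\ t <= b /\ phi t = x].
have psiK t : a <= t -> t <= b -> psi (phi t) = t.
  move=> at_ tb; rewrite /psi; case: xgetP => [u _ [au [ub E]]|/(_ t)]; last first.
    by move=> /(_ (conj at_ (conj tb erefl))).
  have [ut|tu|//] := ltgtP u t.
  - by have := mono u t au ut tb; rewrite E ltxx.
  - by have := mono t u at_ tu ub; rewrite E ltxx.
exists (s' ++ [seq psi x | x <- s]) => t at_ tb.
rewrite mem_cat negb_or => /andP[ts' ts].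
have [g cg fg] := Hs' t at_ tb ts'.
have dg : derivable (g : R^o -> R^o) t 1.
  by apply/derivable1_diffP; apply: C1_at_differentiable; exact: cg.
apply: (@horizontal_at_reparam _ _ _ _ B A (cf d) phi t ('D_1 (g : R^o -> R^o) t)).
  apply: near_eq_is_derive (derivableP dg).
  by apply: filterS fg => u ->.
apply: hs.
- by rewrite -pa; apply: mono => //; exact: ltW.
- by rewrite -pb; apply: mono => //; exact: ltW.
by apply: contra ts => ts; apply/mapP; exists (phi t) => //; rewrite psiK// ltW.
Unshelve. all: by end_near. Qed.

Lemma weakly_horizontal_sub (f : R -> P) (a b t : R) : t <= b ->
  weakly_horizontal A f a b -> weakly_horizontal A f a t.
Proof.
move=> tb [l r [s h]]; split; [| |exists s] => x ax xt; [apply: l|apply: r|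
  move=> xs; apply: h] => //.
- exact: le_trans xt tb.
- exact: lt_le_trans xt tb.
- exact: lt_le_trans xt tb.
Qed.

(** [d'] and [cf d \o phi] are weakly horizontal over the same curve with the same start, so they
    agree, and phi reparametrizes the lifts as well. *)
Lemma lift_reparam c c' d d' : reparam c c' -> lift d c -> lift d' c' ->
  cstart d = cstart d' -> reparam d d'.
Proof.
move=> /reparamP[pc pc' [phi [pp mono pa pb E]]] ld ld' dd'.
have [pd _ _] := is_lift_pc1 ld; have [pd' _ _] := is_lift_pc1 ld'.
have [hd da db dE] := ld; have [hd' da' db' dE'] := ld'.
apply/reparamP; split=> //; exists phi; rewrite da da' db db'; split=> //.
have mono_le x y : ca c' <= x -> x <= y -> y <= cb c' -> phi x <= phi y.
  by move=> ax; rewrite le_eqVlt => /predU1P[->//|xy] yb; exact/ltW/mono.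
move=> t at_ tb.
have wd : weakly_horizontal A (cf d \o phi) (ca c') (cb c').
  by apply: weakly_horizontal_reparam; rewrite ?da ?db.
have wd' := horizontal_weakly hd'; rewrite da' db' in wd'.
apply: (@weakly_horizontal_unique _ _ _ _ B A (cf d') (cf d \o phi) (ca c') t) => //.
- exact: weakly_horizontal_sub wd'.
- exact: weakly_horizontal_sub wd.
- move=> x ax xt; have xb := le_trans xt tb.
  rewrite dE' ?ax//= dE ?E// -pa -pb mono_le ?mono_le//.
- by rewrite /= pa -da -da' -/(cstart d) -/(cstart d').
Qed.

(** In the transitive case the intermediate curve has to be lifted first. In the reflexive case two
    lifts may still differ outside the interval. *)
Lemma lift_same_path c c' : same_path c c' -> forall d d', lift d c ->
  lift d' c' -> cstart d = cstart d' -> same_path d d'.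
Proof.
elim=> [x y xy|x|x y _ IH|x y z xy IH1 _ IH2] d d' ld ld' dd'.
- by apply: same_path_step; exact: lift_reparam xy ld ld' dd'.
- have [pd _ _] := is_lift_pc1 ld.
  have [_ da db _] := ld; have [_ da' db' _] := ld'.
  apply: same_path_step; apply: reparam_congr; rewrite ?da ?db//.
  exact: is_lift_unique ld ld' dd'.
- by apply: same_path_sym; exact: IH.
- have [_ px sx] := is_lift_pc1 ld; have [pxy sxy _] := same_path_inv xy.
  have [|e [he ea eb es eE]] := @lift_exists _ _ _ _ B A y (cstart d) (pxy.1 px).
    by rewrite sx.
  apply: (@same_path_trans _ _ _ e); first by apply: IH1 => //; split.
  by apply: IH2 => //; rewrite es.
Qed.

(* The horizontal lift of d^-1 d returns to its start. *)
Lemma lift_bt c c' : bt_equiv c c' -> forall d d', lift d c ->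
  lift d' c' -> cstart d = cstart d' -> bt_equiv d d'.
Proof.
elim=> [x y xy|x|x y _ IH|x y z xy IH1 _ IH2] d d' ld ld' dd'; last 3 first.
- have [pd _ _] := is_lift_pc1 ld.
  apply: same_path_bt => //.
  exact: lift_same_path (same_path_refl x) _ _ ld ld' dd'.
- by apply: rst_sym; exact: IH.
- have [_ px sx] := is_lift_pc1 ld; have [pxy sxy _] := bt_equiv_inv xy.
  have [|e [he ea eb es eE]] := @lift_exists _ _ _ _ B A y (cstart d) (pxy.1 px).
    by rewrite sx.
  apply: (@rst_trans _ _ _ e); first by apply: IH1 => //; split.
  by apply: IH2 => //; rewrite es.
have [pd _ sd] := is_lift_pc1 ld; have [pd' _ sd'] := is_lift_pc1 ld'.
have [_ _ sxy exy] := elem_backtrack_inv xy.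
move: xy => [a [b [e [[pa pb pe] ae ab [px py H]]]]].
have sx : cstart x = cstart a.
  have [p1 _ p2] := pc1_long pa pb pe ae ab.
  have p3 : pc1 (ccat a e) by exact: pc1_cat.
  by case: H => -[/same_path_inv[_ -> _] _]; rewrite !cstart_cat.
have [|la [ha1 ha2 ha3 ha4 ha5]] := @lift_exists _ _ _ _ B A a (cstart d) pa.
  by rewrite sd.
have LA : lift la a by [].
have enda : bproj B (cend la) = cend a.
  by rewrite /cend ha3 ha5// lexx pc1_le.
have [|le [he1 he2 he3 he4 he5]] := @lift_exists _ _ _ _ B A e (cend la) pe.
  by rewrite enda.
have LE : lift le e by [].
(* [lb] starts at the end of [la], where [le] followed by its reverse returns, so it continues the
   lifts of both the long and the short curve. *)
have [|lb [hb1 hb2 hb3 hb4 hb5]] := @lift_exists _ _ _ _ B A b (cend la) pb.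
  by rewrite enda.
have LB : lift lb b by [].
have [pla _ _] := is_lift_pc1 LA; have [ple _ _] := is_lift_pc1 LE.
have [plb _ _] := is_lift_pc1 LB.
have j1 : cend la = cstart le by rewrite he4.
have j2 : cend la = cstart lb by rewrite hb4.
have [q1 q2 q3] := pc1_long pla plb ple j1 j2.
have q4 : pc1 (ccat la le) by exact: pc1_cat.
have j3 : cend (ccat la le) = cstart (crev le) by rewrite cend_cat// cstart_rev.
have LL : lift (ccat (ccat (ccat la le) (crev le)) lb)
    (ccat (ccat (ccat a e) (crev e)) b).
  by apply: is_lift_cat => //; apply: is_lift_cat => //;
    [exact: is_lift_cat|exact: is_lift_rev].
have LS : lift (ccat la lb) (ccat a b) by exact: is_lift_cat.
apply: rst_step; exists la, lb, le; split=> //; split=> //.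
have SL : cstart (ccat (ccat (ccat la le) (crev le)) lb) = cstart d.
  by rewrite !cstart_cat.
have SS : cstart (ccat la lb) = cstart d by rewrite cstart_cat.
case: H => -[h1 h2]; [left|right]; split.
- by apply: (lift_same_path h1) => //; rewrite SL.
- by apply: (lift_same_path h2) => //; rewrite SS.
- by apply: (lift_same_path h1) => //; rewrite SS.
- by apply: (lift_same_path h2) => //; rewrite SL.
Qed.

End LiftBacktrack.

(** * Computing with chosen representatives of backtrack classes *)

Section BacktrackClasses.
Variables (R : realType) (M : manifoldType R) (Q : set (curve R M)).
Implicit Types X Y : btpath Q.

Lemma btrep_in X : Q (btrep X).
Proof. exact: (s2valP (cid2 (svalP X))). Qed.

Lemma btrep_class X : sval X = bt_class (btrep X).
Proof. exact: (s2valP' (cid2 (svalP X))). Qed.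

Lemma bt_class_eq c c' : bt_equiv c c' -> @bt_class R M c = bt_class c'.
Proof.
move=> cc'; apply/seteqP; split=> e /= H; first exact: rst_trans (rst_sym _ _ _ _ cc') H.
exact: rst_trans cc' H.
Qed.

Lemma bt_class_equiv c c' : @bt_class R M c = bt_class c' -> bt_equiv c c'.
Proof. move=> E; have : bt_class c' c' by exact: rst_refl.
by rewrite -E. Qed.

Lemma btpath_eq X Y : bt_equiv (btrep X) (btrep Y) -> X = Y.
Proof.
move=> /bt_class_eq; rewrite -!btrep_class.
case: X Y => [S HS] [S' HS'] /= E; subst S'; congr exist; exact: Prop_irrelevance.
Qed.

Lemma btrep_btclass c (Qc : Q c) : bt_equiv (btrep (btclass Qc)) c.
Proof. by apply: bt_class_equiv; rewrite -btrep_class. Qed.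

Lemma btrep_btpath_of X c : Q c ->
  bt_equiv (btrep (btpath_of X (bt_class c))) c.
Proof.
move=> Qc; apply: bt_class_equiv; rewrite -btrep_class /btpath_of.
by case: pselect => // -[]; exists c.
Qed.

Hypothesis Qpc1 : forall c, Q c -> pc1 c.

Lemma btrep_pc1 X : pc1 (btrep X).
Proof. exact/Qpc1/btrep_in. Qed.

(** Since concatenation respects equivalence, the set in [btcomp] is the class of one concatenation.
    Every later computation with [btcomp] goes through this form. *)
Lemma btrep_btcomp Y X :
  (forall c d, Q c -> Q d -> cend c = cstart d -> Q (ccat c d)) ->
  bttgt X = btsrc Y ->
  bt_equiv (btrep (btcomp Y X)) (ccat (btrep X) (btrep Y)).
Proof.
move=> Qcat XY; rewrite /btcomp.
have -> : [set c | exists c1 c2,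
    [/\ sval X c1, sval Y c2 & bt_equiv (ccat c1 c2) c]] =
    bt_class (ccat (btrep X) (btrep Y)).
  apply/seteqP; split=> [c [c1 [c2 [Xc1 Yc2 H]]]|c H] /=; last first.
    exists (btrep X), (btrep Y); split=> //; rewrite btrep_class; exact: rst_refl.
  rewrite btrep_class in Xc1; rewrite btrep_class in Yc2.
  apply: rst_trans H; apply: bt_cat => //; exact: btrep_pc1.
by apply: btrep_btpath_of; apply: Qcat => //; exact: btrep_in.
Qed.

End BacktrackClasses.

Section BacktrackClassMap.
Variables (R : realType) (M N : manifoldType R).
Variables (Q : set (curve R M)) (Q' : set (curve R N)) (F : M -> N).

Lemma btrep_btmap (X0 : btpath Q') (X : btpath Q) :
  (forall x, C1_map_at F x) -> (forall c, Q c -> Q' (ccomp F c)) ->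
  bt_equiv (btrep (btmap F X0 X)) (ccomp F (btrep X)).
Proof.
move=> cF QF; rewrite /btmap.
have -> : [set c | exists2 c1, sval X c1 & bt_equiv (ccomp F c1) c] =
    bt_class (ccomp F (btrep X)).
  apply/seteqP; split=> [c [c1 Xc1 H]|c H] /=; last first.
    by exists (btrep X) => //; rewrite btrep_class; exact: rst_refl.
  rewrite btrep_class in Xc1; apply: rst_trans H; exact: bt_map.
by apply: btrep_btpath_of; apply: QF; exact: btrep_in.
Qed.

End BacktrackClassMap.

(** * The principal categorical bundle *)

Section CrossedModuleCategory.
Variables (G H : groupType) (X : crossed_module G H).

Local Notation tau := (cm_tau X).
Local Notation alpha := (cm_alpha X).

Lemma tau1 : tau 1%g = 1%g.
Proof. by apply: (mulgI (tau 1%g)); rewrite -cm_tauM !mulg1. Qed.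

Lemma tauV h : tau h^-1%g = (tau h)^-1%g.
Proof. by apply: (mulgI (tau h)); rewrite -cm_tauM !mulgV tau1. Qed.

Lemma alphag1 g : alpha g 1%g = 1%g.
Proof. by apply: (mulgI (alpha g 1%g)); rewrite -cm_alpha_mor !mulg1. Qed.

Lemma alphaV g h : alpha g h^-1%g = (alpha g h)^-1%g.
Proof. by apply: (mulgI (alpha g h)); rewrite -cm_alpha_mor !mulgV alphag1. Qed.

(** alpha(1) is idempotent and injective. *)
Lemma alpha1g h : alpha 1%g h = h.
Proof.
by apply: (bij_inj (cm_alpha_bij X 1%g)); rewrite -cm_alphaM mulg1.
Qed.

Lemma alphaK g : cancel (alpha g) (alpha g^-1%g).
Proof. by move=> h; rewrite -cm_alphaM mulVg alpha1g. Qed.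

Lemma alphaVK g : cancel (alpha g^-1%g) (alpha g).
Proof. by move=> h; rewrite -cm_alphaM mulgV alpha1g. Qed.

Lemma tau_alphaV g h : tau (alpha g^-1%g h) = (g^-1 * tau h * g)%g.
Proof. by rewrite cm_tau_alpha invgK. Qed.

Lemma crossed_catgroupP : is_categorical_group (crossed_catgroup X).
Proof.
split.
- split=> [a|g f /= gf|[h a]|h g f _ _] /=.
  + by rewrite tau1 mul1g.
  + by rewrite gf cm_tauM mulgA.
  + by rewrite mul1g mulg1.
  + by rewrite mulgA.
- split=> [[f g]|[[h a] [k c]]|[a c]|[[h2 b] [k2 d]] [[h1 a] [k1 c]]] //=.
  + by rewrite cm_tauM cm_tau_alpha !mulgA mulgVK.
  + by rewrite alphag1 mul1g.
  (* Interchange law: with b = tau(h1) a, the Peiffer identity turns alpha(b)(k2) into the conjugate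
     of alpha(a)(k2) by h1. *)
  + move=> [-> _]; congr pair; rewrite cm_alphaM cm_alpha_tau cm_alpha_mor.
    by rewrite !mulgA mulgVK.
- split=> [x y z|x|x|x]; rewrite /obM /= ?mulgA ?mul1g ?mulg1//.
  by exists x^-1%g; rewrite mulVg mulgV.
- split=> [[h a] [k c] [l e]|[h a]|[h a]|[h a]]; rewrite /morM /=.
  + by rewrite cm_alpha_mor cm_alphaM !mulgA.
  + by rewrite alpha1g !mul1g.
  + by rewrite alphag1 !mulg1.
  + exists (alpha a^-1%g h^-1%g, a^-1%g) => /=.
    by rewrite !mulVg !mulgV -cm_alpha_mor mulVg alphag1 alphaVK mulgV.
Qed.

End CrossedModuleCategory.

(** * Category laws for classes of paths, horizontal or not *)

Section PathCategories.
Variables (R : realType) (M : manifoldType R) (Q : set (curve R M)).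
Hypothesis Qpc1 : forall c, Q c -> pc1 c.
Hypothesis Qcat : forall c d, Q c -> Q d -> cend c = cstart d -> Q (ccat c d).
Implicit Types X Y Z : btpath Q.

Lemma btsrc_btcomp Y X : bttgt X = btsrc Y -> btsrc (btcomp Y X) = btsrc X.
Proof.
move=> XY; have [_ E _] := bt_equiv_inv (btrep_btcomp Qpc1 Qcat XY).
by rewrite /btsrc E cstart_cat//; exact: btrep_pc1.
Qed.

Lemma bttgt_btcomp Y X : bttgt X = btsrc Y -> bttgt (btcomp Y X) = bttgt Y.
Proof.
move=> XY; have [_ _ E] := bt_equiv_inv (btrep_btcomp Qpc1 Qcat XY).
by rewrite /bttgt E cend_cat//; exact: btrep_pc1.
Qed.

Lemma btcompA Z Y X : bttgt X = btsrc Y -> bttgt Y = btsrc Z ->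
  btcomp Z (btcomp Y X) = btcomp (btcomp Z Y) X.
Proof.
move=> XY YZ; apply: btpath_eq.
have pX := btrep_pc1 Qpc1 X; have pY := btrep_pc1 Qpc1 Y.
have pZ := btrep_pc1 Qpc1 Z.
have h1 : bttgt (btcomp Y X) = btsrc Z by rewrite bttgt_btcomp.
have h2 : bttgt X = btsrc (btcomp Z Y) by rewrite btsrc_btcomp.
apply: rst_trans (btrep_btcomp Qpc1 Qcat h1) _.
apply: rst_trans _ (rst_sym _ _ _ _ (btrep_btcomp Qpc1 Qcat h2)).
apply: (@rst_trans _ _ _ (ccat (ccat (btrep X) (btrep Y)) (btrep Z))).
  by apply: bt_catl => //; exact: btrep_btcomp.
apply: (@rst_trans _ _ _ (ccat (btrep X) (ccat (btrep Y) (btrep Z)))).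
  apply: same_path_bt; last exact: same_path_catA.
  by apply: pc1_cat => //; [exact: pc1_cat|rewrite cend_cat].
apply: rst_sym; apply: bt_catr => //; first exact: btrep_btcomp.
Qed.

(** The unit is given through its representative, so that the lemma serves [btid] and [hid]
    alike. *)
Lemma btcomp_idl X (I : btpath Q) :
  bt_equiv (btrep I) (Defs.cpoint R (bttgt X)) -> btcomp I X = X.
Proof.
move=> HI; apply: btpath_eq; have [_ E _] := bt_equiv_inv HI.
have pX := btrep_pc1 Qpc1 X.
have XI : bttgt X = btsrc I by rewrite /btsrc E.
apply: rst_trans (btrep_btcomp Qpc1 Qcat XI) _.
apply: (@rst_trans _ _ _ (ccat (btrep X) (Defs.cpoint R (bttgt X)))).
  exact: bt_catr.
apply: same_path_bt; last exact: same_path_cat_point.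
by apply: pc1_cat => //; exact: pc1_point.
Qed.

Lemma btcomp_idr X (I : btpath Q) :
  bt_equiv (btrep I) (Defs.cpoint R (btsrc X)) -> btcomp X I = X.
Proof.
move=> HI; apply: btpath_eq; have [_ _ E] := bt_equiv_inv HI.
have pX := btrep_pc1 Qpc1 X.
have XI : bttgt I = btsrc X by rewrite /bttgt E.
apply: rst_trans (btrep_btcomp Qpc1 Qcat XI) _.
apply: (@rst_trans _ _ _ (ccat (Defs.cpoint R (btsrc X)) (btrep X))).
  by apply: bt_catl.
apply: same_path_bt; last exact: same_path_point_cat.
by apply: pc1_cat => //; exact: pc1_point.
Qed.

End PathCategories.

Lemma path_catP (R : realType) (M : manifoldType R) : is_category (path_cat M).
Proof.
have id_rep (x : M) : bt_equiv (btrep (btid x)) (Defs.cpoint R x).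
  exact: btrep_btclass.
split=> [x|g f gf|f|h g f hg gf] /=.
- have [_ E1 E2] := bt_equiv_inv (id_rep x).
  by rewrite /btsrc /bttgt E1 E2.
- by split; [apply: btsrc_btcomp|apply: bttgt_btcomp] => //; exact: pc1_cat.
- by split; [apply: btcomp_idl|apply: btcomp_idr] => //; exact: pc1_cat.
- by apply: btcompA => //; exact: pc1_cat.
Qed.

(** * The decorated path category, its projection and its action *)

Section DecoratedBundle.
Variables (R : realType) (G H : lieGroupType R).
Variables (X : lie_crossed_module G H) (P M : manifoldType R).
Variables (B : principal_bundle G P M) (A : connection B).
Implicit Types (gamma : hpath A) (g : G) (h : H).

Local Notation tau := (cm_tau X).
Local Notation alpha := (cm_alpha X).

Lemma horizontal_pc1 (c : curve R P) : horizontal A c -> pc1 c.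
Proof. by case. Qed.

Local Notation hcat := (@horizontal_cat R G P M B A).

Lemma btrep_hid p : bt_equiv (btrep (hid A p)) (Defs.cpoint R p).
Proof. exact: btrep_btclass. Qed.

Lemma hid_ends p : btsrc (hid A p) = p /\ bttgt (hid A p) = p.
Proof.
by have [_ E1 E2] := bt_equiv_inv (btrep_hid p); rewrite /btsrc /bttgt E1 E2.
Qed.

Lemma btrep_htranslate gamma g :
  bt_equiv (btrep (htranslate gamma g)) (ccomp (bact B ^~ g) (btrep gamma)).
Proof.
apply: btrep_btmap; first exact: bact_C1l.
by move=> c; exact: horizontal_translate.
Qed.

Lemma btsrc_htranslate gamma g :
  btsrc (htranslate gamma g) = bact B (btsrc gamma) g.
Proof. by have [_ E _] := bt_equiv_inv (btrep_htranslate gamma g). Qed.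

Lemma bttgt_htranslate gamma g :
  bttgt (htranslate gamma g) = bact B (bttgt gamma) g.
Proof. by have [_ _ E] := bt_equiv_inv (btrep_htranslate gamma g). Qed.

Lemma ccomp_id (c : curve R P) (F : P -> P) : (forall p, F p = p) ->
  ccomp F c = c.
Proof. by case: c => a b f FE; congr Curve; apply/funext => t /=. Qed.

Lemma htranslate1 gamma : htranslate gamma 1%g = gamma.
Proof.
apply: btpath_eq; have := btrep_htranslate gamma 1%g.
by rewrite ccomp_id// => p; exact: bact1.
Qed.

Lemma htranslateM gamma g g' :
  htranslate gamma (g * g')%g = htranslate (htranslate gamma g) g'.
Proof.
apply: btpath_eq; apply: rst_trans (btrep_htranslate gamma (g * g')%g) _.
apply: rst_sym; apply: rst_trans (btrep_htranslate _ g') _.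
have -> : ccomp (bact B ^~ (g * g')%g) (btrep gamma) =
    ccomp (bact B ^~ g') (ccomp (bact B ^~ g) (btrep gamma)).
  by congr Curve; apply/funext => t /=; rewrite bactM.
apply: bt_map; [exact: bact_C1l|exact: btrep_htranslate].
Qed.

Lemma htranslate_hid p g : htranslate (hid A p) g = hid A (bact B p g).
Proof.
apply: btpath_eq; apply: rst_trans (btrep_htranslate _ g) _.
apply: rst_trans _ (rst_sym _ _ _ _ (btrep_hid _)).
by apply: (bt_map (bact_C1l B g) (btrep_hid p)).
Qed.

Lemma htranslate_comp gamma' gamma g : bttgt gamma = btsrc gamma' ->
  htranslate (btcomp gamma' gamma) g =
  btcomp (htranslate gamma' g) (htranslate gamma g).
Proof.
move=> E; apply: btpath_eq; apply: rst_trans (btrep_htranslate _ g) _.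
have E' : bttgt (htranslate gamma g) = btsrc (htranslate gamma' g).
  by rewrite btsrc_htranslate bttgt_htranslate E.
apply: rst_trans _ (rst_sym _ _ _ _ (btrep_btcomp horizontal_pc1 hcat E')).
apply: rst_trans (bt_map (bact_C1l B g) (btrep_btcomp horizontal_pc1 hcat E)) _.
rewrite ccomp_cat; apply: rst_sym; apply: bt_cat.
- exact: (btrep_pc1 horizontal_pc1).
- exact: (btrep_pc1 horizontal_pc1).
- exact: E'.
- exact: btrep_htranslate.
- exact: btrep_htranslate.
Qed.

(** Composability is s(gamma2) = t(gamma1) tau(h1)^-1, which says exactly that gamma2 tau(h1) starts
    where gamma1 ends; all laws reduce to those of paths and of H. *)
Lemma dec_catP : is_category (dec_cat X A).
Proof.
split=> [p|[g' h'] [g h] /= gf|[g h]|[g3 h3] [g2 h2] [g1 h1] /= E32 E21] /=.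
- by have [-> ->] := hid_ends p; rewrite invg1 tau1 bact1.
- have E : bttgt g = btsrc (htranslate g' (tau h)).
    by rewrite btsrc_htranslate gf -bactM tauV mulVg bact1.
  rewrite (btsrc_btcomp horizontal_pc1 hcat E) (bttgt_btcomp horizontal_pc1 hcat E).
  split=> //; rewrite bttgt_htranslate -bactM invgM cm_tauM tauV.
  by rewrite mulVKg.
- split; congr pair; rewrite ?mul1g ?mulg1//.
    rewrite htranslate_hid; apply: (btcomp_idl horizontal_pc1 hcat).
    rewrite -bactM tauV mulVg bact1; exact: btrep_hid.
  rewrite tau1 htranslate1; apply: (btcomp_idr horizontal_pc1 hcat).
  exact: btrep_hid.
- congr pair; last by rewrite mulgA.
  have E1 : bttgt g1 = btsrc (htranslate g2 (tau h1)).
    by rewrite btsrc_htranslate E21 -bactM tauV mulVg bact1.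
  have E2 : bttgt g2 = btsrc (htranslate g3 (tau h2)).
    by rewrite btsrc_htranslate E32 -bactM tauV mulVg bact1.
  (* Translation distributes over composition, and gamma3 is translated by tau(h2) tau(h1) = tau(h2
     h1) in both bracketings. *)
  rewrite htranslate_comp// -htranslateM -cm_tauM.
  apply: (btcompA horizontal_pc1 hcat) => //.
  by rewrite bttgt_htranslate btsrc_htranslate cm_tauM bactM E2 btsrc_htranslate.
Qed.

Lemma btrep_proj gamma x0 :
  bt_equiv (btrep (btmap (Q' := @pc1 R M) (bproj B) x0 gamma))
    (ccomp (bproj B) (btrep gamma)).
Proof.
apply: btrep_btmap; first exact: bproj_C1.
by move=> c [pc _]; apply: pc1_comp => //; exact: bproj_C1.
Qed.

Lemma bproj_lift gamma :
  is_lift A (btrep gamma) (ccomp (bproj B) (btrep gamma)).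
Proof. by split=> //; exact: btrep_in. Qed.

Lemma dec_proj_functor : is_functor (dec_proj X A).
Proof.
split=> [[gamma h]|[gamma h]|p|[g2 h2] [g1 h1] /= E] /=.
- by have [_ E _] := bt_equiv_inv (btrep_proj gamma (btid (bproj B (btsrc gamma)))).
- have [_ _ E] := bt_equiv_inv (btrep_proj gamma (btid (bproj B (btsrc gamma)))).
  by rewrite bproj_act.
- apply: btpath_eq; apply: rst_trans (btrep_proj _ _) _.
  apply: rst_trans (bt_map (bproj_C1 B) (btrep_hid p)) _.
  apply: rst_sym; exact: btrep_btclass.
have E1 : bttgt g1 = btsrc (htranslate g2 (tau h1)).
  by rewrite btsrc_htranslate E -bactM tauV mulVg bact1.
apply: btpath_eq; apply: rst_trans (btrep_proj _ _) _.
apply: rst_trans (bt_map (bproj_C1 B) (btrep_btcomp horizontal_pc1 hcat E1)) _.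
set x1 := btid _; set x2 := btid _.
have Q1 := btrep_proj g1 x2; have Q2 := btrep_proj g2 x1.
have p1 := btrep_pc1 horizontal_pc1 g1; have p2 := btrep_pc1 horizontal_pc1 g2.
have p3 := btrep_pc1 horizontal_pc1 (htranslate g2 (tau h1)).
(* The translation by tau(h1) in the composition is invisible after projection. *)
have F2 : bt_equiv (ccomp (bproj B) (btrep (htranslate g2 (tau h1))))
    (ccomp (bproj B) (btrep g2)).
  apply: rst_trans (bt_map (bproj_C1 B) (btrep_htranslate g2 (tau h1))) _.
  rewrite (_ : ccomp _ (ccomp _ _) = ccomp (bproj B) (btrep g2)).
    exact: rst_refl.
  by congr Curve; apply/funext => t /=; rewrite bproj_act.
have E' : bttgt (btmap (Q' := @pc1 R M) (bproj B) x2 g1) =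
    btsrc (btmap (Q' := @pc1 R M) (bproj B) x1 g2).
  have [_ _ EE1] := bt_equiv_inv Q1; have [_ EE2 _] := bt_equiv_inv Q2.
  rewrite /bttgt /btsrc EE1 EE2.
  have [_ <- _] := bt_equiv_inv F2.
  by congr (bproj B); exact: E1.
have C := @btrep_btcomp R M (@pc1 R M) (fun _ hc => hc) _ _ (@pc1_cat R M) E'.
apply: rst_sym; apply: rst_trans C _; apply: rst_sym.
rewrite ccomp_cat; apply: bt_cat.
- by apply: pc1_comp => //; exact: bproj_C1.
- by apply: pc1_comp => //; exact: bproj_C1.
- by congr (bproj B); exact: E1.
- exact: rst_sym.
- apply: rst_trans F2 _; exact: rst_sym.
Qed.

Lemma dec_action_categorical :
  is_categorical_action (K := crossed_catgroup X) (dec_action X A).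
Proof.
split.
- split=> [[[gamma h] [h1 g1]]|[[gamma h] [h1 g1]]|[p g]|] /=.
  + exact: btsrc_htranslate.
  + rewrite bttgt_htranslate -!bactM -alphaV tau_alphaV invgM invgK cm_tauM.
    by rewrite !mulgA mulgV mul1g.
  + by rewrite htranslate_hid invg1 mulg1 alphag1.
  move=> [[gam2 h2] [k2 g2]] [[gam1 h1] [k1 g1]] /= [E12 Eg].
  congr pair.
    have E : bttgt gam1 = btsrc (htranslate gam2 (tau h1)).
      by rewrite btsrc_htranslate E12 -bactM tauV mulVg bact1.
    rewrite htranslate_comp// -!htranslateM; congr (btcomp (htranslate _ _) _).
    (* With g2 = tau(k1) g1, the factors g1 g1^-1 and tau(k1) tau(k1)^-1 cancel, and g2
       tau(alpha(g1^-1)(k1^-1 h1)) = tau(h1) g1. *)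
    by rewrite Eg tau_alphaV cm_tauM tauV !mulgA mulgK mulgV mul1g.
  (* Here alpha(g2^-1) is alpha(g1^-1) after conjugation by k1^-1, by the Peiffer identity; the
     inner k1 k1^-1 cancels and leaves (k2 k1)^-1 h2 h1. *)
  rewrite Eg (invgM (cm_tau X k1)) cm_alphaM -tauV cm_alpha_tau invgK -cm_alpha_mor.
  by congr (alpha _ _); rewrite invgM !mulgA; rewrite ?mulgK ?mulgVK.
- split=> [p|p g g']; first exact: bact1.
  exact: bactM.
split=> [[gamma h]|[gamma h] [k1 g1] [k2 g2]]; rewrite /mact /morM /=.
  by rewrite htranslate1 !invg1 mul1g alpha1g.
rewrite htranslateM; congr pair.
rewrite !invgM cm_alphaM; congr (alpha _ _).
by rewrite -!mulgA cm_alpha_mor alphaV alphaK.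
Qed.

Lemma dec_proj_surjective (f : btpath (@pc1 R M)) :
  exists gamma, fmor (dec_proj X A) (gamma, 1%g) = f.
Proof.
have pf : pc1 (btrep f) by exact: btrep_in.
have [p pE] : exists p, bproj B p = cstart (btrep f).
  have [U [_ Uf [triv [tinv [_ _ tinvK _ _]]]]] := bundle_trivial B (cstart (btrep f)).
  by exists (tinv (cstart (btrep f)) 1%g); case: (tinvK _ 1%g Uf).
have [d [hd da db _ dE]] := lift_exists A pf pE.
exists (btclass hd); apply: btpath_eq; apply: rst_trans (btrep_proj _ _) _.
apply: rst_trans (bt_map (bproj_C1 B) (btrep_btclass hd)) _.
have pd := horizontal_pc1 hd.
apply: same_path_bt; first by apply: pc1_comp => //; exact: bproj_C1.
apply: same_path_step; apply: reparam_congr => //.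
  by apply: pc1_comp => //; exact: bproj_C1.
by move=> t; rewrite /= da db; exact: dE.
Qed.

(** The element g is read off the initial points. Then gamma g and gamma' lift equivalent curves
    from the same start, so [lift_bt] identifies their classes. *)
Lemma dec_proj_transitive (gamma gamma' : hpath A) x x' :
  btmap (Q' := @pc1 R M) (bproj B) x gamma =
  btmap (Q' := @pc1 R M) (bproj B) x' gamma' ->
  exists g, gamma' = htranslate gamma g.
Proof.
move=> E; have Q1 := btrep_proj gamma x; have Q2 := btrep_proj gamma' x'.
rewrite -E in Q2; have Q12 := rst_trans _ _ _ _ _ (rst_sym _ _ _ _ Q1) Q2.
have [_ S _] := bt_equiv_inv Q12.
have [g gE] := bact_transitive (B := B) (p := btsrc gamma) (q := btsrc gamma') S.
exists g; apply: btpath_eq; apply: rst_sym.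
apply: rst_trans (btrep_htranslate _ g) _.
apply: (lift_bt Q12 _ (bproj_lift gamma')).
  exact: is_lift_translate (bproj_lift gamma).
by rewrite -[RHS]/(btsrc gamma') gE.
Qed.

End DecoratedBundle.

Theorem theorem6p1 (R : realType) (G H : lieGroupType R)
    (X : lie_crossed_module G H) (P M : manifoldType R)
    (B : principal_bundle G P M) (A : connection B) :
  @is_principal_categorical_bundle
    (dec_cat X A) (path_cat M) (crossed_catgroup X)
    (dec_proj X A) (dec_action X A).
Proof.
split.
- split; [exact: dec_catP|exact: path_catP|exact: crossed_catgroupP].
- split; [exact: dec_proj_functor|exact: dec_action_categorical].
- split=> [b|f]; last first.
    by have [gamma <-] := dec_proj_surjective X A f; exists (gamma, 1%g).
  have [U [_ Ub [triv [tinv [_ _ tinvK _ _]]]]] := bundle_trivial B b.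
  by exists (tinv b 1%g); case: (tinvK b 1%g Ub).
- split=> [p k|[gamma h] [k g]]; first exact: bact_free.
  rewrite /mact /= => -[Eg Eh].
  have g1 : g = 1%g.
    by apply: (@bact_free _ _ _ _ B (btsrc gamma)); rewrite -btsrc_htranslate Eg.
  move: Eh; rewrite g1 invg1 alpha1g => Eh; congr pair.
  by apply: invg_inj; apply: (mulIg h); rewrite Eh invg1 mul1g.
split=> [p k|p q pq|[gamma h] [k g]|[gamma h] [gamma' h']].
- exact: bproj_act.
- exact: bact_transitive.
- rewrite /mact /=; apply: btpath_eq; apply: rst_trans (btrep_proj _ _) _.
  apply: rst_sym; apply: rst_trans (btrep_proj _ _) _; apply: rst_sym.
  apply: rst_trans (bt_map (bproj_C1 B) (btrep_htranslate gamma g)) _.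
  rewrite (_ : ccomp _ (ccomp _ _) = ccomp (bproj B) (btrep gamma)).
    exact: rst_refl.
  by congr Curve; apply/funext => t /=; rewrite bproj_act.
move=> /= /dec_proj_transitive[g ->].
(* The first component k solves alpha(g^-1)(k^-1 h) = h'. *)
exists ((h * (cm_alpha X g h')^-1)%g, g); rewrite /mact /=; congr pair.
by rewrite invgM invgK mulgVK alphaK.
Qed.
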